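(* Let $F:T_0\times\mathbb{R}^n\to\mathbb{R}$, $(t,x)\mapsto F(t,x)$, be measurable in $t$ for any $x\in\mathbb{R}^n$ and of class $C^1$ in $x$ for any $t\in T_0$. Suppose there exist $a\in C^1(\mathbb{R}^+,\mathbb{R}^+)$ with derivative $a'$ bounded from above and $b\in C(T_0,\mathbb{R}^+)$ such that $$|F(t,x)|\le a(|x|)\,b(t),\qquad |\nabla_xF(t,x)|\le a(|x|)\,b(t)$$ for any $x\in\mathbb{R}^n$ and any $t\in T_0$. Let $$\varphi(u)=\int_{T_0}\left[\frac12\left|\frac{\partial u}{\partial t}\right|^2+F(t,u(t))\right]dt^1\wedge\dots\wedge dt^p,\qquad u\in H^1_T .$$ If $u\in H^1_T$ is a solution of the equation $\varphi'(u)=0$ (i.e. a critical point of $\varphi$), then $u$ has a weak Laplacian $\Delta u$ (the Jacobian matrix $\frac{\partial u}{\partial t}$ has a weak divergence), and $$\Delta u(t)=\nabla F(t,u(t))\quad\text{a.e. on }T_0,$$ and $$u|_{S_i^-}=u|_{S_i^+},\qquad \frac{\partial u}{\partial t}\Big|_{S_i^-}=\frac{\partial u}{\partial t}\Big|_{S_i^+},\qquad i=1,\dots,p.$$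
   Context: $T_0=[0,T^1]\times\dots\times[0,T^p]\subset\mathbb{R}^p$ with $T^1,\dots,T^p>0$, $T=(T^1,\dots,T^p)$, $t=(t^1,\dots,t^p)$, and $dt^1\wedge\dots\wedge dt^p$ is Lebesgue measure. $\mathbb{R}^+=[0,\infty)$ and $|x|=\sqrt{\delta_{ij}x^ix^j}$ is the Euclidean norm on $\mathbb{R}^n$. $\nabla F(t,x)=\nabla_xF(t,x)$ is the gradient with respect to $x$. $C_T^\infty$ is the space of all indefinitely differentiable functions $\mathbb{R}^p\to\mathbb{R}^n$ that are multiple $T$-periodic (periodic in each variable $t^i$ with period $T^i$). Weak derivatives are defined with test functions in $C_T^\infty$: $w_\alpha$ is the weak derivative $\partial u/\partial t^\alpha$ of $u$ if $\int_{T_0}\delta_{ij}u^i\,\frac{\partial v^j}{\partial t^\alpha}\,dt^1\wedge\dots\wedge dt^p=-\int_{T_0}\delta_{ij}w_\alpha^i v^j\,dt^1\wedge\dots\wedge dt^p$ for all $v\in C_T^\infty$. $H_T^1$ (the Sobolev space $W_T^{1,2}$) is the Hilbert space of functions $u\in L^2[T_0,\mathbb{R}^n]$ having weak derivatives $\frac{\partial u}{\partial t}\in L^2$ in this sense, with scalar product $\langle u,v\rangle=\int_{T_0}\left(\delta_{ij}u^iv^j+\delta_{ij}\delta^{\alpha\beta}\frac{\partial u^i}{\partial t^\alpha}\frac{\partial v^j}{\partial t^\beta}\right)dt^1\wedge\dots\wedge dt^p$. Also $\left|\frac{\partial u}{\partial t}\right|^2=\delta^{\alpha\beta}\delta_{ij}\frac{\partial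 u^i}{\partial t^\alpha}\frac{\partial u^j}{\partial t^\beta}$ (summation over repeated indices). A function $u\in H^1_T$ has weak Laplacian $\Delta u$ (an integrable $\mathbb{R}^n$-valued function on $T_0$) if $\int_{T_0}\delta^{\alpha\beta}\delta_{ij}\frac{\partial u^i}{\partial t^\alpha}\frac{\partial v^j}{\partial t^\beta}\,dt^1\wedge\dots\wedge dt^p=-\int_{T_0}\delta_{ij}(\Delta u)^iv^j\,dt^1\wedge\dots\wedge dt^p$ for all $v\in C^\infty_T$; this is also called the weak divergence of $\frac{\partial u}{\partial t}$. $\varphi'$ is the derivative of the functional $\varphi$ on $H_T^1$ ($\varphi$ is of class $C^1$ under the stated hypotheses on $F$). $S_i^-$ and $S_i^+$ are the opposite faces of $T_0$ given by $t^i=0$ and $t^i=T^i$, identified by translation; boundary values are understood in the sense of traces. *)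

(* Defs.v *)
From HB Require Import structures.
From mathcomp Require Import all_boot all_order all_algebra.
From mathcomp Require Import all_classical all_reals all_analysis.
Set Implicit Arguments.
Unset Strict Implicit.
Unset Printing Implicit Defensive.
Import Order.TTheory GRing.Theory Num.Theory.
Import numFieldNormedType.Exports.
Local Open Scope classical_set_scope.
Local Open Scope ring_scope.

(* sigma-algebra on R^p generated by the coordinates, i.e. the Borel one *)
Section rV_measurable.
Context {R : realType} {p : nat}.

Definition rV_coord (i : 'I_p) (t : 'rV[R]_p) : measurableTypeR R := t 0 i.

Let rV_set0 : g_sigma_preimage rV_coord set0.
Proof. exact: sigma_algebra0. Qed.

Let rV_setC A : g_sigma_preimage rV_coord A -> g_sigma_preimage rV_coord (~` A).
Proof. exact: sigma_algebraC. Qed.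

Let rV_bigcup (F : _^nat) : (forall i, g_sigma_preimage rV_coord (F i)) ->
  g_sigma_preimage rV_coord (\bigcup_i (F i)).
Proof. exact: sigma_algebra_bigcup. Qed.

HB.instance Definition _ := @isMeasurable.Build
  (measure_tuple_display R.-ocitv.-measurable.-sigma) 'rV[R]_p (g_sigma_preimage rV_coord)
  rV_set0 rV_setC rV_bigcup.

End rV_measurable.

Section row_lebesgue.
Context {R : realType} {p : nat}.

Definition row_cons (x : measurableTypeR R * 'rV[R]_p) : 'rV[R]_p.+1 :=
  row_mx (x.1%:M : 'rV[R]_1) x.2.

Definition row_uncons (t : 'rV[R]_p.+1) : measurableTypeR R * 'rV[R]_p :=
  (t 0 0, \row_i t 0 (lift 0 i)).

Lemma row_consE x i : row_cons x 0 i = oapp (x.2 0) x.1 (unlift 0 i).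
Proof.
rewrite /row_cons; case: unliftP => [j|] -> /=.
  have -> : lift 0 j = rshift 1 j by apply/val_inj.
  by rewrite [LHS](row_mxEr x.1%:M).
have -> : (0 : 'I_p.+1) = lshift p (0 : 'I_1) by apply/val_inj.
by rewrite [LHS](row_mxEl x.1%:M) mxE eqxx mulr1n.
Qed.

Lemma row_consK : cancel row_cons row_uncons.
Proof.
case=> a y; rewrite /row_uncons row_consE unlift_none; congr pair.
by apply/rowP => i; rewrite mxE row_consE liftK.
Qed.

Lemma row_unconsK : cancel row_uncons row_cons.
Proof.
move=> t; apply/rowP => i; rewrite row_consE.
by case: unliftP => [j|] -> //=; rewrite mxE.
Qed.

End row_lebesgue.

Lemma measurable_rV_coord {R : realType} p (i : 'I_p) :
  measurable_fun [set: 'rV[R]_p] (rV_coord i).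
Proof.
move=> _ Y mY; rewrite setTI; apply: sub_sigma_algebra => /=.
rewrite -bigcup_seq/=; exists i => /=; first by rewrite mem_index_enum.
by exists Y => //; rewrite setTI.
Qed.

Lemma measurable_fun_rV {R : realType} d (X : measurableType d) p
    (f : X -> 'rV[R]_p) :
  (forall i, measurable_fun [set: X] (rV_coord i \o f)) ->
  measurable_fun [set: X] f.
Proof.
move=> mf; suff prefS : g_sigma_preimage (fun i => rV_coord i \o f) `<=` measurable.
  by move=> _ A mA; apply: prefS; rewrite g_sigma_preimage_comp; exists A.
apply: smallest_sub; first exact: sigma_algebra_measurable.
case: p => [|p] in f mf *; first by rewrite big_ord0.
rewrite -bigcup_mkord_ord; apply: bigcup_sub => i Ii.
by move=> A [B mB <-]; exact: mf.
Qed.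

Lemma measurable_row_cons {R : realType} p :
  measurable_fun setT (@row_cons R p).
Proof.
apply: measurable_fun_rV => i.
rewrite (_ : _ \o _ = fun x => oapp (fun j => rV_coord j x.2) x.1 (unlift 0 i)).
  case: unliftP => [j|] _ /=; last exact: measurable_fst.
  exact: (measurableT_comp (measurable_rV_coord j)).
apply: funext => x /=; rewrite {1}/rV_coord row_consE.
by case: unlift.
Qed.

Lemma measurable_row_uncons {R : realType} p :
  measurable_fun setT (@row_uncons R p).
Proof.
apply: measurable_fun_pair; first exact: measurable_rV_coord.
apply: measurable_fun_rV => i.
rewrite (_ : _ \o _ = rV_coord (lift 0 i)); first exact: measurable_rV_coord.
by apply: funext => t; rewrite /= /rV_coord mxE.
Qed.

Section lebesgue_cons.
Local Open Scope ereal_scope.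
Context {R : realType} {p : nat}.
Variable mu : {sigma_finite_measure set 'rV[R]_p -> \bar R}.

Definition lebesgue_cons : set 'rV[R]_p.+1 -> \bar R :=
  pushforward (@lebesgue_measure R \x mu) row_cons.

Let m : {measure set 'rV[R]_p.+1 -> \bar R} :=
  [the {measure set _ -> \bar R} of
     measure_function_pushforward__canonical__measure_function_Measure
       (@lebesgue_measure R \x mu) (@measurable_row_cons R p)].

HB.instance Definition _ := isMeasure.Build _ _ _ lebesgue_cons
  (measure0 m) (measure_ge0 m) (@measure_semi_sigma_additive _ _ _ m).

Let sigma_finite_lebesgue_cons : sigma_finite setT lebesgue_cons.
Proof.
have /sigma_finiteP[F [FT ndF Foo]] := sigma_finiteT (@lebesgue_measure R).
have /sigma_finiteP[G [GT ndG Goo]] := sigma_finiteT mu.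
exists (fun k => row_uncons @^-1` (F k `*` G k)).
  rewrite -preimage_bigcup -[LHS](preimage_setT row_uncons) -setXTT FT GT.
  congr (_ @^-1` _); rewrite predeqE => -[x y]; split=> [[[k _ Fx] [l _ Gy]]|].
    exists (maxn k l) => //; split.
    - by apply: (subsetPset _ _ (ndF _ _ (leq_maxl _ _))).
    - by apply: (subsetPset _ _ (ndG _ _ (leq_maxr _ _))).
  by move=> [k _ [/= Fx Gy]]; split; exists k.
move=> k; have [mF Fk] := Foo k; have [mG Gk] := Goo k; split.
  rewrite -[X in measurable X]setTI; apply: measurable_row_uncons => //.
  exact: measurableX.
rewrite /lebesgue_cons /pushforward -comp_preimage.
rewrite (_ : row_uncons \o row_cons = id); last first.
  by apply: funext; exact: row_consK.
by rewrite preimage_id product_measure1E// lte_mul_pinfty// ge0_fin_numE.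
Qed.

HB.instance Definition _ := Measure_isSigmaFinite.Build _ _ _ lebesgue_cons
  sigma_finite_lebesgue_cons.

End lebesgue_cons.

(* iterated product of the one-dimensional Lebesgue measures; on R^0 it is the
   unit mass *)
Fixpoint borel_lebesgue {R : realType} (p : nat) :
    {sigma_finite_measure set 'rV[R]_p -> \bar R} :=
  match p with
  | 0 => \d_(0 : 'rV[R]_0)
  | q.+1 => lebesgue_cons (borel_lebesgue q)
  end.

Notation rV_leb R p := (caratheodory_type ((@borel_lebesgue R p)^*)%mu).

(* Lebesgue measure on R^p, on the complete sigma-algebra of all Lebesgue
   measurable sets; the points of the type rV_leb R p are those of 'rV[R]_p *)
Definition lebesgue_rV {R : realType} (p : nat) : set (rV_leb R p) -> \bar R :=
  @completed_measure_extension _ _ R (borel_lebesgue p).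

Arguments lebesgue_rV {R} p _.

HB.instance Definition _ (R : realType) (p : nat) :=
  Measure.on (@lebesgue_rV R p).

Section calculus.
Context {R : realType}.

Definition dot n (x y : 'rV[R]_n) : R := \sum_(j < n) x 0 j * y 0 j.

(* the norm `|x| of the library on 'rV[R]_n is the sup norm *)
Definition enorm n (x : 'rV[R]_n) : R := Num.sqrt (dot x x).

Definition basis_vec p (i : 'I_p) : 'rV[R]_p := delta_mx 0 i.

Definition partial p (V : normedModType R) (i : 'I_p) (f : 'rV[R]_p -> V) :
  'rV[R]_p -> V := fun t => 'D_(basis_vec i) f t.

(* indefinitely differentiable: all iterated partial derivatives exist and are
   differentiable *)
Definition smooth p (V : normedModType R) (f : 'rV[R]_p -> V) : Prop :=
  forall (s : seq 'I_p) (t : 'rV[R]_p),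
    differentiable (foldr (fun i g => partial i g) f s) t.

Definition gradient n (f : 'rV[R]_n -> R) (x : 'rV[R]_n) : 'rV[R]_n :=
  \row_j partial j f x.

Definition C1 n (f : 'rV[R]_n -> R) : Prop :=
  (forall x, differentiable f x) /\ continuous (gradient f).

(* a' is the (one-sided at 0) derivative of a on [0, +oo[ and is continuous
   there *)
Definition C1_halfline (a a' : R -> R) : Prop :=
  (forall s, 0 <= s ->
     (a r - a s) / (r - s) @[r --> within [set r | 0 <= r] s^'] --> a' s) /\
  {within [set r | 0 <= r], continuous a'}.

End calculus.

Section L2.
Context {R : realType} {p n : nat}.
Implicit Types (D : set 'rV[R]_p) (u v : 'rV[R]_p -> 'rV[R]_n).

Definition vmeasurable D u : Prop :=
  forall j, measurable_fun (D : set (rV_leb R p)) (fun t => u t 0 j).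

Definition vintegrable D u : Prop :=
  forall j, (lebesgue_rV p).-integrable D (fun t => (u t 0 j)%:E).

Definition L2 D u : Prop :=
  vmeasurable D u /\
  (\int[lebesgue_rV p]_(t in D) (enorm (u t) ^+ 2)%:E < +oo)%E.

Definition cvg_L2 D (u_ : nat -> 'rV[R]_p -> 'rV[R]_n) u : Prop :=
  (\int[lebesgue_rV p]_(t in D) (enorm (u_ k t - u t) ^+ 2)%:E)%E
    @[k --> \oo] --> 0%E.

End L2.

Section sobolev.
Context {R : realType} {p n : nat}.
(* the vector T of the periods T^1, ..., T^p *)
Variable T : 'rV[R]_p.
Implicit Types (u v w : 'rV[R]_p -> 'rV[R]_n).

Definition box : set 'rV[R]_p := [set t | forall i, 0 <= t 0 i <= T 0 i].

Definition multiperiodic u : Prop :=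
  forall (i : 'I_p) t, u (t + T 0 i *: basis_vec i) = u t.

Definition Cinf_per v : Prop := smooth v /\ multiperiodic v.

Definition is_weak_partial (al : 'I_p) u w : Prop :=
  forall v, Cinf_per v ->
    \int[lebesgue_rV p]_(t in box) dot (u t) (partial al v t) =
    - \int[lebesgue_rV p]_(t in box) dot (w t) (v t).

(* Elements of H^1_T are represented by functions on R^p, only the values on
   the box being relevant, up to equality almost everywhere. *)
Definition H1 u : Prop :=
  L2 box u /\ forall al, exists w, L2 box w /\ is_weak_partial al u w.

(* a representative of the weak derivative, which is unique a.e. on the box *)
Definition weak_partial (al : 'I_p) u : 'rV[R]_p -> 'rV[R]_n :=
  get [set w | L2 box w /\ is_weak_partial al u w].

Definition H1dot u v : R :=
  \int[lebesgue_rV p]_(t in box)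
    (dot (u t) (v t) +
     \sum_(al < p) dot (weak_partial al u t) (weak_partial al v t)).

Definition H1norm u : R := Num.sqrt (H1dot u u).

Definition H1_dual (L : ('rV[R]_p -> 'rV[R]_n) -> R) : Prop :=
  (forall c u v, H1 u -> H1 v -> L (c *: u + v) = c * L u + L v) /\
  exists C, forall u, H1 u -> `|L u| <= C * H1norm u.

(* L is the Frechet derivative at u of the functional phi on H^1_T *)
Definition is_H1_derivative (phi : ('rV[R]_p -> 'rV[R]_n) -> R) u
    (L : ('rV[R]_p -> 'rV[R]_n) -> R) : Prop :=
  H1_dual L /\
  forall eps, 0 < eps -> exists2 delta, 0 < delta &
    forall h, H1 h -> H1norm h <= delta ->
      `|phi (u + h) - phi u - L h| <= eps * H1norm h.

Definition H1_critical (phi : ('rV[R]_p -> 'rV[R]_n) -> R) u : Prop :=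
  is_H1_derivative phi u (fun=> 0).

Definition action (F : 'rV[R]_p -> 'rV[R]_n -> R) u : R :=
  \int[lebesgue_rV p]_(t in box)
    (2^-1 * (\sum_(al < p) dot (weak_partial al u t) (weak_partial al u t))
     + F t (u t)).

Definition is_weak_laplacian u w : Prop :=
  vintegrable box w /\
  forall v, Cinf_per v ->
    \int[lebesgue_rV p]_(t in box)
      (\sum_(al < p) dot (weak_partial al u t) (partial al v t)) =
    - \int[lebesgue_rV p]_(t in box) dot (w t) (v t).

(* Faces of the box are parametrized by the p - 1 coordinates other than t^i;
   two points of opposite faces with the same parameter are translates. *)
Definition face_box (i : 'I_p) : set 'rV[R]_p.-1 :=
  [set y | forall k, 0 <= y 0 k <= T 0 (lift i k)].

Definition face_point (i : 'I_p) (c : R) (y : 'rV[R]_p.-1) : 'rV[R]_p :=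
  \row_k oapp (y 0) c (unlift i k).

(* g is the trace of w : box -> R^n on the face t^i = c: the value at w of the
   continuous extension to W^{1,2} of the restriction of smooth functions to
   this face *)
Definition is_trace (i : 'I_p) (c : R) w (g : 'rV[R]_p.-1 -> 'rV[R]_n) : Prop :=
  [/\ L2 box w, L2 (face_box i) g &
   exists v_ : nat -> 'rV[R]_p -> 'rV[R]_n,
   [/\ forall k, smooth (v_ k),
       cvg_L2 box v_ w,
       forall al, exists2 w', L2 box w' &
         cvg_L2 box (fun k => partial al (v_ k)) w' &
       cvg_L2 (face_box i) (fun k y => v_ k (face_point i c y)) g]].

Definition same_traces (i : 'I_p) w : Prop :=
  exists gm gp, [/\ is_trace i 0 w gm, is_trace i (T 0 i) w gp &
    {ae lebesgue_rV p.-1, forall y, face_box i y -> gm y = gp y}].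

End sobolev.

(* Main.v *)
(** Since [a'] is bounded above, [a] grows at most linearly, so [F] and its
gradient are dominated by [K (1 + |x|)] and the difference quotients of the
action along a smooth periodic direction converge by dominated convergence;
at a critical point this says that [gradient F (t, u t)], a square integrable
function, is the weak Laplacian of [u].

For the boundary conditions, trigonometric polynomials are total in [L^2] of
the box (they form an algebra, so a function orthogonal to them is also
orthogonal to indicators of orthants), and they are eigenfunctions of the
Laplacian.  Projecting [(u, Delta u)] on the pairs [(v, Delta v)] with [v] a
trigonometric polynomial therefore gives [v_k -> u] with [Delta v_k] Cauchy,
and on such [v] the [L^2] norms of first and second partials are controlled by
those of [v] and [Delta v].  A trace inequality makes the restrictions of
[v_k] and of its partials to the faces converge, and by periodicity the limits
on opposite faces coincide. *)

Require Import Defs.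
From mathcomp Require Import all_boot all_order all_algebra.
From mathcomp Require Import all_classical all_reals all_analysis.
From mathcomp Require Import measurable_realfun ring lra.
Set Implicit Arguments.
Unset Strict Implicit.
Unset Printing Implicit Defensive.
Import Order.TTheory GRing.Theory Num.Theory.
Import numFieldNormedType.Exports.
Local Open Scope classical_set_scope.
Local Open Scope ring_scope.

(** * Superposition of measurable functions *)

(** Three constraints shape the argument. A trace is defined through smooth functions whose first
    partials also converge in L^2, so the trace of a first partial of [u] asks for approximants
    whose second partials converge. For periodic functions the Laplacian alone controls them: after
    two integrations by parts, the squared norms of all second partials add up to that of the
    Laplacian. Approximating inside the graph of the Laplacian replaces Fourier series; no Parseval
    identity and no coefficients enter. Orthogonality to the graph mixes the error on [u] with the
    error on its Laplacian, and the eigenvalue relation separates them: on a wave the sum of both is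
    [1 + lam ^+ 2] times the error on [u]. Finally, Tonelli's theorem holds for the Borel product
    measure, whereas the statement integrates over Lebesgue measurable sets. Slicing is therefore
    applied to Borel functions only, and totality reaches Lebesgue sets through a Borel hull. Since
    [weak_partial] is a choice among functions equal almost everywhere, it is used only through its
    defining property and through tests against trigonometric polynomials. *)

Lemma cvg_rV (R : realType) n {U : Type} (G : set_system U) {FG : Filter G}
    (f : U -> 'rV[R]_n) (l : 'rV[R]_n) :
  (forall j, f x 0 j @[x --> G] --> l 0 j) -> f @ G --> l.
Proof.
move=> fl; apply/cvgrPdist_lt => e e0.
have : \forall x \near G, forall j, `|l 0 j - f x 0 j| < e.
  by apply: filter_forall => j; apply: cvgr_dist_lt.
apply: filterS => x xe.
rewrite [`|_|](_ : _ = mx_norm (l - f x))//.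
have [->//|/mx_norm_neq0[[i j] /= ->]] := eqVneq (mx_norm (l - f x)) 0.
by rewrite ord1 !mxE.
Qed.

Section caratheodory_functions.
Context d (X : measurableType d) (R : realType) (n : nat).
Variables (D : set X) (mD : measurable D).

(** Here [u] is rounded down to the grid of mesh [1 / c]. The rounded vector takes countably many
    values, and on the set where it is constant the composite is a section [F ^~ x]. *)
Lemma measurable_fun_floor_comp (F : X -> 'rV[R]_n -> R) (u : X -> 'rV[R]_n) (c : R) :
  0 < c ->
  (forall x, measurable_fun D (F ^~ x)) ->
  (forall j, measurable_fun D (fun t => u t 0 j)) ->
  measurable_fun D (fun t => F t (\row_j ((Num.floor (c * u t 0 j))%:~R / c))).
Proof.
move=> c0 mF mu _ Y mY.
pose q (z : 'rV[int]_n) : 'rV[R]_n := \row_j ((z 0 j)%:~R / c).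
(* [A z] is the cell where the integer vector is [z]; starting the intersection from [D] keeps this
   correct for [n = 0]. *)
pose A (z : 'rV[int]_n) := \big[setI/D]_(j < n) (D `&` (fun t => u t 0 j) @^-1`
   [set` `[((z 0 j)%:~R / c), ((z 0 j + 1)%:~R / c)[]).
rewrite [X in measurable X](_ : _ = \bigcup_z (A z `&` (D `&` (F ^~ (q z)) @^-1` Y))).
  apply: countable_bigcupT_measurable; first exact: countableP.
  move=> z; apply: measurableI; last exact: mF.
  rewrite /A; elim/big_ind : _ => //=; first by move=> ? ?; exact: measurableI.
  by move=> j _; apply: mu => //; exact: measurable_itv.
have AP z t : A z t <-> D t /\ (forall j, Num.floor (c * u t 0 j) = z 0 j).
  have -> : A z t <-> D t /\ forall j, u t 0 j \in `[((z 0 j)%:~R / c), ((z 0 j + 1)%:~R / c)[.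
    split.
      move=> Azt; split.
        by move: Azt; rewrite /A; elim/big_ind : _ => // [B C hB hC [/hB]|j _ []].
      move=> j; move: Azt; rewrite /A (bigD1 j)//= => -[[] //].
    move=> [Dt h]; rewrite /A; elim/big_ind : _ => //.
    by move=> j _; split => //; apply: h.
  split=> -[Dt h]; split => // j.
    have := h j; rewrite in_itv/= => /andP[h1 h2]; apply: floor_def.
    by rewrite -[c * _]mulrC -ler_pdivrMr// -ltr_pdivlMr// h1.
  rewrite in_itv/= ler_pdivrMr// ltr_pdivlMr// -(h j) mulrC.
  exact: floor_itv.
apply/seteqP; split => [t [Dt /= Ft]|t [z _ [/AP[Dt h] [_ /= Ft]]]].
  exists (\row_j Num.floor (c * u t 0 j)) => //; split.
    by apply/AP; split => // j; rewrite mxE.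
  split => //=; rewrite [q _](_ : _ = (\row_j ((Num.floor (c * u t 0 j))%:~R / c)))//.
  by apply/rowP => j; rewrite !mxE.
split => //=; rewrite (_ : \row_j _ = q z)//.
by apply/rowP => j; rewrite !mxE h.
Qed.

(** Rounding [u] to the grid of mesh [1 / k.+1] gives measurable composites, which converge
    pointwise by continuity of [F t]. *)
Lemma measurable_fun_caratheodory (F : X -> 'rV[R]_n -> R) (u : X -> 'rV[R]_n) :
  (forall x, measurable_fun D (F ^~ x)) ->
  (forall t, D t -> continuous (F t)) ->
  (forall j, measurable_fun D (fun t => u t 0 j)) ->
  measurable_fun D (fun t => F t (u t)).
Proof.
move=> mF cF mu.
apply: (@measurable_fun_cvg _ _ _ _ (fun k t =>
   F t (\row_j ((Num.floor (k.+1%:R * u t 0 j))%:~R / k.+1%:R)))).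
  by move=> k; exact: measurable_fun_floor_comp.
move=> t Dt; apply: (@cvg_comp _ _ _ _ (F t) _ (nbhs (u t))); last exact: cF.
apply: cvg_rV => j.
under eq_fun do rewrite mxE.
apply: (@squeeze_cvgr _ _ _ _ (fun k : nat => u t 0 j - k.+1%:R^-1) (fun=> u t 0 j)).
- near=> k; have k0 : 0 < k.+1%:R :> R by [].
  have /andP[h1 h2] := floor_itv (k.+1%:R * u t 0 j).
  rewrite ler_pdivrMr// (mulrC (u t 0 j)) h1 andbT ler_pdivlMr// mulrBl mulVf//.
  by rewrite lerBlDr (mulrC (u t 0 j)) -intrD1 ltW.
- rewrite -[X in _ --> X]subr0; apply: cvgB; first exact: cvg_cst.
  exact: cvg_harmonic.
- exact: cvg_cst.
Unshelve. all: by end_near. Qed.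

End caratheodory_functions.

(** * Square integrable functions *)

Lemma discriminant_le (R : realFieldType) (c b e : R) : 0 <= c ->
  (forall l, 0 <= c * l ^+ 2 - 2 * b * l + e) -> b ^+ 2 <= c * e.
Proof.
rewrite le_eqVlt => /predU1P[<-|c0] h; last first.
  have := h (b / c); rewrite -(pmulr_rge0 _ c0).
  rewrite [X in 0 <= X](_ : _ = c * e - b ^+ 2) ?subr_ge0//.
  by field; rewrite gt_eqF.
rewrite mul0r; have [->|b0] := eqVneq b 0; first by rewrite expr0n.
(* With [c = 0] the polynomial is affine of slope [- 2 * b], and at this point it equals -1. *)
have := h ((e + 1) / (2 * b)).
rewrite [X in 0 <= X](_ : _ = -1); first by rewrite ler0N1.
by field.
Qed.

(** * Semi-inner products on a subspace given by a predicate *)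

Section semi_inner_product.
Context (R : realType) (V : lmodType R) (P : V -> Prop) (B : V -> V -> R).
Hypotheses (PD : forall x y, P x -> P y -> P (x + y))
  (PZ : forall a x, P x -> P (a *: x))
  (Bsym : forall x y, B x y = B y x)
  (BD : forall x y z, P x -> P y -> P z -> B (x + y) z = B x z + B y z)
  (BZ : forall a x y, P x -> P y -> B (a *: x) y = a * B x y)
  (Bge0 : forall x, P x -> 0 <= B x x).

Lemma semi_inner_sqrB l x y : P x -> P y ->
  B (x - l *: y) (x - l *: y) = B y y * l ^+ 2 - 2 * B x y * l + B x x.
Proof.
move=> Px Py; have Ply : P (- l *: y) by exact: PZ.
have Pxy : P (x + - l *: y) by exact: PD.
rewrite -scaleNr BD// BZ// !(Bsym _ (x + _)) !BD// !BZ// (Bsym y x).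
by ring.
Qed.

(** [B] is only semi-definite, because functions are not identified almost everywhere; the
    discriminant bound covers [B y y = 0] as well. The abstract setting serves both L^2 and the
    product of two copies of it. *)
Lemma semi_inner_CS x y : P x -> P y -> B x y ^+ 2 <= B x x * B y y.
Proof.
move=> Px Py; rewrite mulrC; apply: discriminant_le; first exact: Bge0.
move=> l; rewrite -semi_inner_sqrB//; apply: Bge0.
by rewrite -scaleNr; apply: PD => //; apply: PZ.
Qed.

Variables (S : V -> Prop) (SP : forall x, S x -> P x) (S0 : S 0)
  (SD : forall x y, S x -> S y -> S (x + y))
  (SZ : forall a x, S x -> S (a *: x)).

(* An approximate orthogonal projection of [h] on [S]: [s] minimizes the distance
   to [h] up to [1 / k.+1], which makes it Cauchy (parallelogram identity) and
   makes [h - s k] asymptotically orthogonal to [S]. *)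
Lemma near_projection h : P h -> exists s : nat -> V,
  [/\ forall k, S (s k),
   forall k l, B (s k - s l) (s k - s l) <= 2 / k.+1%:R + 2 / l.+1%:R &
   forall k v, S v -> B (h - s k) v ^+ 2 <= B v v / k.+1%:R].
Proof.
move=> Ph; pose q s := B (h - s) (h - s).
have Phs s : S s -> P (h - s).
  by move=> /SP Ps; rewrite -scaleN1r; apply: PD => //; exact: PZ.
pose E := [set q s | s in S]; have E0 : E !=set0 by exists (q 0), 0.
have lE : has_lbound E by exists 0 => _ [s Ss <-]; exact/Bge0/Phs.
have Einf s : S s -> inf E <= q s by move=> Ss; apply: ge_inf => //; exists s.
have /choice[s sP] (k : nat) : exists s, S s /\ q s <= inf E + k.+1%:R^-1.
  have [|_ [s Ss <-] /ltW sk] := @inf_adherent _ E k.+1%:R^-1 _ (conj E0 lE).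
    by rewrite invr_gt0.
  by exists s.
have Sscomb x a y : S x -> S y -> S (x + a *: y) by move=> *; apply/SD/SZ.
exists s; split; first by move=> k; case: (sP k).
  move=> k l; have [Sk hk] := sP k; have [Sl hl] := sP l.
  (* The midpoint competes for the infimum. By the parallelogram identity the squared distance is at
     most twice the sum of the two defects, which are at most [1 / k.+1] and [1 / l.+1]. *)
  have Sm : S (2^-1 *: (s k + s l)) by apply/SZ/SD.
  have := Einf _ Sm.
  have Pk := Phs _ Sk; have Pl := Phs _ Sl.
  have q1 : B (s k - s l) (s k - s l) =
      q (s l) - 2 * B (h - s l) (h - s k) + q (s k).
    rewrite (_ : s k - s l = (h - s l) - 1 *: (h - s k)); last first.
      by rewrite scale1r opprB [RHS]addrC addrA subrK.
    by rewrite semi_inner_sqrB// /q; ring.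
  have -> : q (2^-1 *: (s k + s l)) =
      2^-1 ^+ 2 * (q (s l) + 2 * B (h - s l) (h - s k) + q (s k)).
    rewrite /q (_ : h - _ = 2^-1 *: ((h - s l) - (-1) *: (h - s k))); last first.
      rewrite scaleN1r opprK addrACA -opprD scalerBr [s l + _]addrC.
      by rewrite -mulr2n -(scaler_nat 2 h) scalerA mulVf ?pnatr_eq0// scale1r.
    have Pc : P ((h - s l) - (-1) *: (h - s k)).
      by rewrite scaleN1r opprK; apply: PD.
    rewrite BZ//; last exact: PZ.
    by rewrite Bsym BZ// semi_inner_sqrB//; ring.
  move: hk hl; rewrite q1; set b := B (h - s l) _; set i := inf E.
  set x := q (s k); set y := q (s l).
  set a := k.+1%:R^-1; set c := l.+1%:R^-1.
  have -> : 2^-1 ^+ 2 = 4^-1 :> R by field.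
  lra.
move=> k v Sv; have [Sk hk] := sP k.
(* Moving [s k] by any multiple of [v] stays in [S], hence above [inf E]: this is a nonnegative
   quadratic in [l] with constant term [1 / k.+1]. *)
apply: discriminant_le => [|l]; first exact/Bge0/SP.
have := Einf _ (Sscomb _ l _ Sk Sv).
rewrite /q opprD addrA semi_inner_sqrB//; [|exact: Phs|exact: SP].
move=> hl; rewrite -[B (h - s k) (h - s k)]/(q (s k)) in hl.
set z := _ - _ in hl *; move: (k.+1%:R^-1) hk hl => e; lra.
Qed.

End semi_inner_product.

Section square_integrable.
Context d (X : measurableType d) (R : realType).
Variables (mu : {measure set X -> \bar R}) (D : set X) (mD : measurable D).
Implicit Types f g h : X -> R.

Definition sqint f := measurable_fun D f /\
  mu.-integrable D (fun x => (f x ^+ 2)%:E).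

Definition ip f g := \int[mu]_(x in D) (f x * g x).

Lemma ipE f g : ip f g = \int[mu]_(x in D) (f x * g x).
Proof. by []. Qed.

Lemma sqint_ltyP f : measurable_fun D f ->
  (\int[mu]_(x in D) (f x ^+ 2)%:E < +oo)%E <-> sqint f.
Proof.
move=> mf; have mf2 : measurable_fun D (fun x => (f x ^+ 2)%:E).
  by apply/measurable_EFinP; exact: measurable_funX.
have e : (\int[mu]_(x in D) `|(f x ^+ 2)%:E| = \int[mu]_(x in D) (f x ^+ 2)%:E)%E.
  by apply: eq_integral => x _; rewrite gee0_abs// lee_fin sqr_ge0.
split=> [h|[_ /integrableP[_]]]; last by rewrite e.
by split => //; apply/integrableP; split => //; rewrite e.
Qed.

Lemma sqint_mul f g : sqint f -> sqint g ->
  mu.-integrable D (fun x => (f x * g x)%:E).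
Proof.
move=> [mf f2] [mg g2].
apply: (le_integrable mD _ _ (integrableD mD f2 g2)).
  by apply/measurable_EFinP; exact: measurable_funM.
move=> x Dx; rewrite /= lee_fin [leRHS]ger0_norm ?addr_ge0 ?sqr_ge0//.
rewrite normrM -(real_normK (num_real (f x))) -(real_normK (num_real (g x))).
by have := sqr_ge0 (`|f x| - `|g x|); nra.
Qed.

Lemma sqintD f g : sqint f -> sqint g -> sqint (f + g).
Proof.
move=> sf sg; have fg := sqint_mul sf sg.
move: sf sg => [mf f2] [mg g2]; split; first exact: measurable_funD.
have := integrableD mD (integrableD mD f2 g2) (integrableD mD fg fg).
apply: eq_integrable => // x _ /=; rewrite -!EFinD; congr EFin.
by rewrite fctE; ring.
Qed.

Lemma sqintZ a f : sqint f -> sqint (a *: f).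
Proof.
move=> [mf f2]; split.
  exact: (measurable_funM (measurable_cst a) mf).
have := integrableZl mD (a ^+ 2) f2.
by apply: eq_integrable => // x _ /=; rewrite -EFinM -exprMn.
Qed.

Lemma sqintN f : sqint f -> sqint (- f).
Proof. by move=> /(sqintZ (-1)); rewrite scaleN1r. Qed.

Lemma sqintB f g : sqint f -> sqint g -> sqint (f - g).
Proof. by move=> sf /sqintN; exact: sqintD. Qed.

Lemma ipC f g : ip f g = ip g f.
Proof. by apply: eq_Rintegral => x _; rewrite mulrC. Qed.

Lemma ipDl f g h : sqint f -> sqint g -> sqint h ->
  ip (f + g) h = ip f h + ip g h.
Proof.
move=> sf sg sh; rewrite /ip -RintegralD//; try exact: sqint_mul.
by apply: eq_Rintegral => x _; rewrite fctE mulrDl.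
Qed.

Lemma ipZl a f g : sqint f -> sqint g -> ip (a *: f) g = a * ip f g.
Proof.
move=> sf sg; rewrite /ip -RintegralZl//; last exact: sqint_mul.
by apply: eq_Rintegral => x _; rewrite fctE mulrA.
Qed.

Lemma ip_ge0 f : 0 <= ip f f.
Proof. by apply: Rintegral_ge0 => x _; rewrite -expr2 sqr_ge0. Qed.

Lemma ipNl f g : sqint f -> sqint g -> ip (- f) g = - ip f g.
Proof. by move=> sf sg; rewrite -scaleN1r ipZl// mulN1r. Qed.

Lemma ipBl f g h : sqint f -> sqint g -> sqint h ->
  ip (f - g) h = ip f h - ip g h.
Proof. by move=> sf sg sh; rewrite ipDl ?ipNl//; exact: sqintN. Qed.

Lemma ip_CS f g : sqint f -> sqint g -> ip f g ^+ 2 <= ip f f * ip g g.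
Proof.
apply: (semi_inner_CS sqintD sqintZ ipC ipDl ipZl).
by move=> *; exact: ip_ge0.
Qed.

Lemma ip_sqrE f : sqint f -> (ip f f)%:E = (\int[mu]_(x in D) (f x ^+ 2)%:E)%E.
Proof. by move=> [mf f2]; rewrite /ip /Rintegral fineK// integrable_fin_num. Qed.

Definition cvgL2 (f_ : nat -> X -> R) f :=
  ip (f_ k - f) (f_ k - f) @[k --> \oo] --> (0 : R).

Definition cauchyL2 (f_ : nat -> X -> R) := forall e, 0 < e -> exists N,
  forall k l, (N <= k)%N -> (N <= l)%N -> ip (f_ k - f_ l) (f_ k - f_ l) <= e.

Lemma cvgL2_ip (f_ : nat -> X -> R) f g : (forall k, sqint (f_ k)) -> sqint f -> sqint g ->
  cvgL2 f_ f -> ip (f_ k) g @[k --> \oo] --> ip f g.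
Proof.
move=> sf_ sf sg ff; apply/cvgrPdist_le => e e0.
(* Cauchy-Schwarz multiplies this threshold by [ip g g], leaving at most [e ^+ 2]; the added 1
   allows [ip g g = 0]. *)
have /cvgrPdist_le/(_ _ (_ : 0 < e ^+ 2 / (ip g g + 1))) := ff.
have g0 : 0 < ip g g + 1 by have := ip_ge0 g; lra.
have e2 : 0 < e ^+ 2 / (ip g g + 1) by rewrite divr_gt0// exprn_gt0.
move=> /(_ e2); apply: filterS => k.
rewrite sub0r normrN ger0_norm ?ip_ge0// => hk.
rewrite distrC -ipBl// -ler_sqr ?nnegrE// ?(ltW e0)// real_normK ?num_real//.
apply: (le_trans (ip_CS (sqintB (sf_ k) sf) sg)).
apply: (le_trans (ler_wpM2r (ip_ge0 _) hk)).
rewrite -mulrA ler_piMr ?sqr_ge0// mulrC ler_pdivrMr// mul1r; lra.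
Qed.

End square_integrable.

Lemma cvg_series_domination (R : realType) (u : nat -> R) (M : R) :
  (forall j, `|u j.+1 - u j| <= M * 2^-1 ^+ j) -> cvgn u.
Proof.
move=> uM; rewrite (_ : u = fun n => u 0%N + series (telescope u) n); last first.
  by apply/funext => n; exact: eq_sum_telescope.
apply: is_cvgD; first exact: is_cvg_cst.
apply: normed_cvg; apply: (series_le_cvg _ _ uM) => //.
  by move=> j; rewrite (le_trans _ (uM j)).
by apply: is_cvg_geometric_series; rewrite gtr0_norm// invf_lt1// ltr1n.
Qed.

(** * Completeness of L^2 (Riesz-Fischer) *)

Section completeness.
Context d (X : measurableType d) (R : realType).
Variables (mu : {measure set X -> \bar R}) (D : set X) (mD : measurable D).
Local Notation sqint := (sqint mu D).
Local Notation ip := (ip mu D).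
Local Notation cvgL2 := (cvgL2 mu D).
Local Notation cauchyL2 := (cauchyL2 mu D).

(** The rate [8^-1 ^+ j] leaves room for the weight [4 ^+ j]: the integrals of [4 ^+ j * h j ^+ 2]
    are at most [2^-1 ^+ j], so their sum is finite almost everywhere. There [h j] is at most a
    constant times [2^-1 ^+ j], and the increments are summable. *)
Lemma rapid_cauchy_ae_cvg (g : nat -> X -> R) : (forall j, sqint (g j)) ->
  (forall j, ip (g j.+1 - g j) (g j.+1 - g j) <= 8^-1 ^+ j) ->
  {ae mu, forall x, D x -> cvgn (g ^~ x)}.
Proof.
move=> sg hg; pose h j := g j.+1 - g j.
have sh j : sqint (h j) by exact: sqintB.
pose H j x := (4 ^+ j * (h j x) ^+ 2)%:E.
have mH j : measurable_fun D (H j).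
  apply/measurable_EFinP; apply: measurable_funM; first exact: measurable_cst.
  by apply: measurable_funX; case: (sh j).
have H0 j x : D x -> (0 <= H j x)%E.
  by move=> _; rewrite lee_fin mulr_ge0 ?sqr_ge0// exprn_ge0.
have iH j : (\int[mu]_(x in D) H j x <= (2^-1 ^+ j)%:E)%E.
  have -> : (\int[mu]_(x in D) H j x = (4 ^+ j)%:E * \int[mu]_(x in D) (h j x ^+ 2)%:E)%E.
    rewrite -ge0_integralZl//.
      by apply/measurable_EFinP; apply: measurable_funX; case: (sh j).
    by move=> x _; rewrite lee_fin sqr_ge0.
  rewrite -ip_sqrE// -EFinM lee_fin.
  rewrite (_ : 2^-1 ^+ j = 4 ^+ j * 8^-1 ^+ j); last first.
    by rewrite -exprMn; congr (_ ^+ _); field.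
  by apply: ler_wpM2l; [exact: exprn_ge0|exact: hg].
have int_G : mu.-integrable D (fun x => \sum_(0 <= j <oo) H j x)%E.
  apply/integrableP; split.
    by apply: (@ge0_emeasurable_sum _ _ _ D H predT) => [j x /H0 Dx _ //|j _]; exact: mH.
  rewrite (eq_integral (fun x => \sum_(0 <= j <oo) H j x)%E); last first.
    by move=> x /set_mem Dx; rewrite gee0_abs// nneseries_ge0// => j _ _; exact: H0.
  rewrite integral_nneseries//; apply: (@le_lt_trans _ _ 2%:E); last exact: ltry.
  apply: lime_le; first by apply: is_cvg_nneseries => j _ _; apply: integral_ge0; exact: H0.
  apply: nearW => n; apply: (@le_trans _ _ (2 - 2 * 2^-1 ^+ n)%:E); last first.
    by rewrite lee_fin lerBlDr lerDl mulr_ge0// exprn_ge0// invr_ge0.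
  elim: n => [|n IHn]; first by rewrite big_nil expr0 mulr1 subrr.
  rewrite big_nat_recr//=; apply: (le_trans (leeD IHn (iH n))).
  by rewrite -EFinD lee_fin exprS; lra.
have := integrable_ae mD int_G; apply: filterS => x hx Dx.
pose r := fine (\sum_(0 <= j <oo) H j x)%E.
have hr j : 4 ^+ j * h j x ^+ 2 <= r.
  rewrite -lee_fin /r fineK; last exact: hx.
  apply: le_trans (nneseries_lim_ge j.+1 _).
    by rewrite big_nat_recr//= leeDr// sume_ge0// => i _; exact: H0.
  by move=> i _ _; exact: H0.
have r0 : 0 <= r by rewrite (le_trans _ (hr 0%N))// mulr_ge0 ?sqr_ge0// exprn_ge0.
(* [r + 1] bounds the square root of [r] without naming it, since [r <= (r + 1) ^+ 2]. *)
apply: (@cvg_series_domination _ _ (r + 1)) => j.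
rewrite -[leLHS]/(`|h j x|) exprVn ler_pdivlMr ?exprn_gt0//.
rewrite -ler_sqr ?nnegrE ?mulr_ge0 ?exprn_ge0 ?addr_ge0//.
rewrite exprMn real_normK ?num_real// exprAC mulrC.
rewrite (_ : 2 ^+ 2 = 4 :> R); last by ring.
by rewrite (le_trans (hr j))//; nra.
Qed.

Lemma limn_einf_le (v : nat -> \bar R) e : (\forall n \near \oo, v n <= e)%E ->
  (limn_einf v <= e)%E.
Proof.
move=> [N _ ve]; rewrite limn_einf_lim; apply: lime_le; first exact: is_cvg_einfs.
apply: nearW => n; apply: le_trans (ve (maxn n N) (leq_maxr _ _)).
by apply: ereal_inf_lbound; exists (maxn n N) => //=; exact: leq_maxl.
Qed.

(** A rapidly Cauchy subsequence converges almost everywhere; Fatou's lemma along it, with [k]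
    fixed, bounds the distance to the limit from every [f k] and not only from the subsequence. *)
Lemma L2_complete (f : nat -> X -> R) : (forall k, sqint (f k)) ->
  cauchyL2 f -> exists g, sqint g /\ cvgL2 f g.
Proof.
move=> sf cf.
have /choice[N hN] (j : nat) : exists N, forall k l, (N <= k)%N -> (N <= l)%N ->
    ip (f k - f l) (f k - f l) <= 8^-1 ^+ j.
  by apply: cf; rewrite exprn_gt0// invr_gt0.
(* Summing all thresholds up to [j] puts both [kap j] and [kap j.+1] beyond [N j] although [N] need
   not be monotone; the summand [j] makes [kap] unbounded. *)
pose kap j := (j + \sum_(i < j.+1) N i)%N.
have kapN i j : (i <= j)%N -> (N i <= kap j)%N.
  move=> ij; rewrite /kap (bigD1 (Ordinal (ij : (i < j.+1)%N)))//=.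
  by rewrite addnCA leq_addr.
have kap_ge j : (j <= kap j)%N by exact: leq_addr.
have ae_cvg := @rapid_cauchy_ae_cvg (fun j => f (kap j)) (fun j => sf _)
  (fun j => hN j _ _ (kapN _ _ (leqnSn j)) (kapN _ _ (leqnn j))).
(* The upper limit is defined everywhere and measurable, and it is the limit wherever the
   subsequence converges. *)
pose g x := fine (limn_esup (fun j => (f (kap j) x)%:E)).
have mg : measurable_fun D g.
  apply: measurableT_comp => //; apply: measurable_fun_limn_esup => j.
  by apply/measurable_EFinP; case: (sf (kap j)).
have fatou_bound k e :
    (\forall j \near \oo, ip (f k - f (kap j)) (f k - f (kap j)) <= e) ->
    (\int[mu]_(x in D) ((f k x - g x) ^+ 2)%:E <= e%:E)%E.
  move=> he; pose w j x := ((f k x - f (kap j) x) ^+ 2)%:E.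
  have mw j : measurable_fun D (w j).
    by apply/measurable_EFinP; apply: measurable_funX; apply: measurable_funB;
      [case: (sf k)|case: (sf (kap j))].
  have w0 j x : D x -> (0 <= w j x)%E by rewrite lee_fin sqr_ge0.
  have := fatou mu mD mw w0.
  rewrite (_ : (\int[mu]_(x in D) limn_einf (w ^~ x) = \int[mu]_(x in D) ((f k x - g x) ^+ 2)%:E)%E).
    move=> /le_trans; apply; apply: limn_einf_le.
    apply: filterS he => j; rewrite -lee_fin => /(le_trans _); apply.
    by rewrite ip_sqrE//; exact: sqintB.
  apply: ge0_ae_eq_integral => //.
  - under eq_fun do rewrite limn_einf_lim.
    apply: (@emeasurable_fun_cvg _ _ _ _ (fun n x => einfs (w ^~ x) n)).
      by move=> m; exact: measurable_fun_einfs.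
    by move=> x Dx; exact: is_cvg_einfs.
  - apply/measurable_EFinP; apply: measurable_funX; apply: measurable_funB => //.
    by case: (sf k).
  - move=> x Dx; rewrite limn_einf_lim; apply: lime_ge; first exact: is_cvg_einfs.
    apply: nearW => n; apply: le_ereal_inf_tmp => _ [m _ <-]; exact: w0.
  - by move=> x _; rewrite lee_fin sqr_ge0.
  apply: filterS ae_cvg => x hx Dx.
  have /cvg_ex[l fl] := hx Dx.
  have -> : g x = l.
    have fle : (f (kap j) x)%:E @[j --> \oo] --> l%:E by apply: cvg_EFin fl; exact: nearW.
    by rewrite /g (cvg_limn_einf_sup fle).2.
  apply: (cvg_limn_einf_sup _).1; apply: cvg_EFin; first exact: nearW.
  by apply: cvgM; apply: cvgB => //; exact: cvg_cst.
have fin_bound e : 0 < e -> exists K, forall k, (K <= k)%N ->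
    (\int[mu]_(x in D) ((f k x - g x) ^+ 2)%:E <= e%:E)%E.
  move=> e0; have [K hK] := cf _ e0; exists K => k Kk; apply: fatou_bound.
  by exists K => // j /= Kj; apply: hK => //; exact: leq_trans Kj (kap_ge j).
have sg : sqint g.
  have [K /(_ _ (leqnn _)) hK] := fin_bound 1 ltr01.
  rewrite (_ : g = f K - (f K - g)); last by rewrite opprB addrC subrK.
  apply: sqintB => //; apply/sqint_ltyP => //.
    by apply: measurable_funB => //; case: (sf K).
  exact: le_lt_trans hK (ltry _).
exists g; split => //; apply/cvgrPdist_le => e e0.
have [K hK] := fin_bound _ e0; exists K => // k /= /hK.
rewrite sub0r normrN ger0_norm ?ip_ge0// -lee_fin => /(le_trans _); apply.
by rewrite ip_sqrE//; exact: sqintB.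
Qed.

Lemma eq_cvgL2 (v : nat -> X -> R) (u w : X -> R) :
  (forall k, sqint (v k)) -> sqint u -> sqint w ->
  {ae mu, forall x, D x -> u x = w x} -> cvgL2 v u -> cvgL2 v w.
Proof.
move=> sv su sw uw; have e k : ip (v k - u) (v k - u) = ip (v k - w) (v k - w).
  have svu := sqintB mD (sv k) su; have svw := sqintB mD (sv k) sw.
  apply: EFin_inj; rewrite !ip_sqrE//; apply: ae_eq_integral => //.
  - by case: svu => _ /integrableP[].
  - by case: svw => _ /integrableP[].
  - by apply: filterS uw => x h Dx; rewrite !fctE h.
by rewrite /cvgL2; under eq_fun do rewrite e.
Qed.

Lemma cvgL2_cauchy (f : nat -> X -> R) (g : X -> R) : (forall k, sqint (f k)) -> sqint g ->
  cvgL2 f g -> cauchyL2 f.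
Proof.
(* A quarter of [e] suffices: the squared norm of a difference is at most twice the sum of the
   squared norms. *)
move=> sf sg /cvgrPdist_le fg e e0; have e4 : 0 < e / 4 by rewrite divr_gt0.
have [N _ hN] := fg _ e4; exists N => k l Nk Nl.
have sfk m : sqint (f m - g) by exact: sqintB.
have hm m : (N <= m)%N -> ip (f m - g) (f m - g) <= e / 4.
  by move=> Nm; have := hN m Nm; rewrite /= sub0r normrN ger0_norm ?ip_ge0.
have := hm _ Nk; have := hm _ Nl; set x := f k - g; set y := f l - g => hy hx.
have -> : f k - f l = x - 1 *: y by rewrite scale1r /x /y opprB addrA subrK.
have sx : sqint x by exact: sfk. have sy : sqint y by exact: sfk.
have sqB := semi_inner_sqrB (sqintD mD) (sqintZ mD) (ipC mu D) (ipDl mD) (ipZl mD).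
rewrite sqB//; have := ip_ge0 mu D (x + y).
have -> : x + y = x - (-1) *: y by rewrite scaleN1r opprK.
rewrite sqB//; lra.
Qed.

Lemma integral_le_ip (q a b : X -> R) K : sqint a -> sqint b -> 0 <= K ->
  measurable_fun D q -> (forall x, D x -> 0 <= q x <= K * (a x ^+ 2 + b x ^+ 2)) ->
  (\int[mu]_(x in D) (q x)%:E <= (K * (ip a a + ip b b))%:E)%E.
Proof.
move=> sa sb K0 mq hq; have [[ma _] [mb _]] := (sa, sb).
have ma2 : measurable_fun D (fun x => (a x ^+ 2)%:E).
  by apply/measurable_EFinP; exact: measurable_funX.
have mb2 : measurable_fun D (fun x => (b x ^+ 2)%:E).
  by apply/measurable_EFinP; exact: measurable_funX.
rewrite EFinM EFinD !ip_sqrE// -ge0_integralD//; last 2 first.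
- by move=> x _; rewrite lee_fin sqr_ge0.
- by move=> x _; rewrite lee_fin sqr_ge0.
rewrite -ge0_integralZl//; last 2 first.
- exact: emeasurable_funD.
- by move=> x _; rewrite lee_fin addr_ge0// sqr_ge0.
apply: ge0_le_integral => //.
- by move=> x /hq/andP[]; rewrite lee_fin.
- exact/measurable_EFinP.
- by apply: emeasurable_funM => //; exact: emeasurable_funD.
- by move=> x /hq/andP[_]; rewrite -EFinD -EFinM lee_fin.
Qed.

End completeness.

(** * Lebesgue measure on the box *)

Section borel_vs_lebesgue.
Context {R : realType} {p : nat}.
Implicit Types (A D : set 'rV[R]_p) (f : 'rV[R]_p -> \bar R).

Lemma measurable_rV_leb A : measurable A -> measurable (A : set (rV_leb R p)).
Proof. exact: caratheodory_measurable_mu_ext. Qed.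

Lemma measurable_fun_rV_leb {d} {Y : measurableType d} D (f : 'rV[R]_p -> Y) :
  measurable D -> measurable_fun D f -> measurable_fun (D : set (rV_leb R p)) f.
Proof. by move=> mD mf _ B mB; apply: measurable_rV_leb; exact: mf. Qed.

Lemma lebesgue_rVE A : measurable A -> lebesgue_rV p A = borel_lebesgue p A.
Proof.
move=> mA; rewrite /lebesgue_rV /completed_measure_extension.
by rewrite measurable_mu_extE.
Qed.

(** The identity from [rV_leb] to the Borel space is measurable and pushes [lebesgue_rV] forward to
    [borel_lebesgue]. This is the bridge to the product measure, where Tonelli's theorem applies. *)
Lemma ge0_integral_lebesgue_rV D f : measurable D -> measurable_fun D f ->
  (forall t, D t -> 0 <= f t)%E ->
  (\int[lebesgue_rV p]_(t in D) f t = \int[borel_lebesgue p]_(t in D) f t)%E.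
Proof.
move=> mD mf f0.
pose phi : rV_leb R p -> 'rV[R]_p := id.
have mphi : measurable_fun setT phi.
  by move=> _ B mB; rewrite setTI; exact: measurable_rV_leb.
have := @ge0_integral_pushforward _ _ _ _ R phi mphi (@lebesgue_rV R p) D f mD mf.
move=> /(_ _)/= <-; last by move=> y /set_mem; exact: f0.
apply: eq_measure_integral => //= A mA _.
by rewrite /pushforward /= /phi preimage_id lebesgue_rVE.
Qed.

End borel_vs_lebesgue.

(** * Tonelli's theorem with respect to an arbitrary coordinate *)

Section tonelli.
Local Open Scope ereal_scope.
Context {R : realType}.

Lemma integral_row_cons p (f : 'rV[R]_p.+1 -> \bar R) :
  measurable_fun setT f -> (forall t, 0 <= f t) ->
  \int[borel_lebesgue p.+1]_t f t =
  \int[@lebesgue_measure R]_s \int[borel_lebesgue p]_y f (row_cons (s, y)).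
Proof.
move=> mf f0.
have := @ge0_integral_pushforward _ _ _ _ R (@row_cons R p) (@measurable_row_cons R p)
  (@lebesgue_measure R \x borel_lebesgue p) setT f measurableT mf.
move=> /(_ (fun y _ => f0 y)) ->; rewrite preimage_setT.
rewrite fubini_tonelli1//=.
exact: measurableT_comp mf (@measurable_row_cons R p).
Qed.

Lemma measurable_face_point p (i : 'I_p.+1) :
  measurable_fun setT (fun x : measurableTypeR R * 'rV[R]_p => face_point i x.1 x.2).
Proof.
apply: measurable_fun_rV => k.
rewrite (_ : _ \o _ = fun x => oapp (fun j => rV_coord j x.2) x.1 (unlift i k)).
  case: unliftP => [j|] _ /=; last exact: measurable_fst.
  exact: (measurableT_comp (measurable_rV_coord j)).
by apply: funext => x /=; rewrite /rV_coord mxE; case: unlift.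
Qed.

Lemma face_point0 p s (y : 'rV[R]_p) : face_point ord0 s y = row_cons (s, y).
Proof. by apply/rowP => k; rewrite row_consE mxE. Qed.

(** Inserting a later coordinate commutes with prepending the first one, which is the geometric
    content of the induction in [tonelli_coord]. *)
Lemma face_pointS p (i : 'I_p.+1) s z (y : 'rV[R]_p) :
  face_point (lift ord0 i) s (row_cons (z, y) : 'rV[R]_p.+2.-1) =
  row_cons (z, face_point i s y).
Proof.
apply/rowP => k; rewrite mxE row_consE.
case: (unliftP ord0 k) => [k'|] -> /=; last first.
  have -> : ord0 = lift (lift ord0 i) (ord0 : 'I_p.+1) :> 'I_p.+2 by exact/val_inj.
  by rewrite liftK /= row_consE unlift_none.
rewrite mxE; case: (unliftP i k') => [k''|] -> /=; last by rewrite unlift_none.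
have -> : lift ord0 (lift i k'') = lift (lift ord0 i) (lift ord0 k'') :> 'I_p.+2.
  by apply/val_inj; rewrite /= /bump !leq0n !add1n ltnS addnS.
by rewrite liftK /= row_consE liftK.
Qed.

(** The measure is built by splitting off the first coordinate, so [i = 0] is a plain exchange of
    integrals. For a later [i], the first coordinate is split off, the induction hypothesis treats
    [i] in the remaining ones, and the first coordinate is put back under the outer integral. *)
Lemma tonelli_coord p (i : 'I_p.+1) (f : 'rV[R]_p.+1 -> \bar R) :
  measurable_fun setT f -> (forall t, 0 <= f t) ->
  \int[borel_lebesgue p.+1]_t f t =
  \int[borel_lebesgue p]_y \int[@lebesgue_measure R]_s f (face_point i s y).
Proof.
elim: p => [|p IHp] in i f *.
  move=> mf f0; have mfr := measurableT_comp mf (@measurable_row_cons R 0).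
  rewrite (integral_row_cons mf f0) (fubini_tonelli _ mfr (fun=> f0 _)).
  by apply: eq_integral => y _; apply: eq_integral => s _; rewrite ord1 face_point0.
move=> mf f0; have mg : measurable_fun setT
    (fun x : measurableTypeR R * 'rV[R]_p.+1 => f (face_point i x.1 x.2)).
  exact: measurableT_comp mf (@measurable_face_point p.+1 i).
case: (unliftP ord0 i) => [j|] ij; last first.
  have mfr := measurableT_comp mf (@measurable_row_cons R p.+1).
  rewrite (integral_row_cons mf f0) (fubini_tonelli _ mfr (fun=> f0 _)).
  apply: eq_integral => y _; apply: eq_integral => s _.
  by rewrite ij face_point0.
rewrite (integral_row_cons mf f0).
have mh : measurable_fun setT (fun y : 'rV[R]_p.+1 =>
    \int[@lebesgue_measure R]_s f (face_point i s y)).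
  exact: (@measurable_fun_fubini_tonelli_G _ _ _ _ R lebesgue_measure _ mg).
have h0 (y : 'rV[R]_p.+1) : 0 <= \int[@lebesgue_measure R]_s f (face_point i s y).
  exact: integral_ge0.
rewrite (integral_row_cons mh h0).
apply: eq_integral => z _.
have mcons : measurable_fun setT (fun y : 'rV[R]_p.+1 => row_cons (z, y)).
  exact: measurableT_comp (@measurable_row_cons R _) (measurable_pair1 z).
rewrite (IHp j _ (measurableT_comp mf mcons) (fun=> f0 _)).
by apply: eq_integral => y _; apply: eq_integral => s _; rewrite ij face_pointS.
Qed.

End tonelli.

(** * Slicing the box by its faces *)

Section box_integrals.
Context {R : realType}.

Lemma continuous_measurable_rV p (f : 'rV[R]_p -> R) :
  continuous f -> measurable_fun setT f.
Proof.
move=> cf; apply: (@measurable_fun_caratheodory _ _ R p setT measurableT (fun=> f) id).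
- by move=> x; exact: measurable_cst.
- by move=> t _.
- by move=> j; exact: measurable_rV_coord.
Qed.

Lemma measurable_box p (T : 'rV[R]_p) : measurable (box T).
Proof.
rewrite (_ : box T = \big[setI/setT]_(i < p) (rV_coord i @^-1` `[0, T 0 i])).
  elim/big_ind : _ => //=; first by move=> ? ?; exact: measurableI.
  by move=> i _; rewrite -[X in measurable X]setTI; apply: measurable_rV_coord.
apply/seteqP; split => [t tT|t].
  by elim/big_ind : _ => // i _; rewrite /= in_itv; exact: tT.
by move=> tT i; move: tT; rewrite (bigD1 i)//= => -[]; rewrite /= in_itv.
Qed.

Lemma face_boxE p (T : 'rV[R]_p.+1) i : face_box T i = box (\row_k T 0 (lift i k)).
Proof. by apply/seteqP; split => y yT k; have := yT k; rewrite mxE. Qed.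

Lemma measurable_face_box p (T : 'rV[R]_p.+1) i : measurable (face_box T i).
Proof. by rewrite face_boxE; exact: measurable_box. Qed.

Lemma box_face_point p (T : 'rV[R]_p.+1) i s y :
  box T (face_point i s y) <-> s \in `[0, T 0 i] /\ face_box T i y.
Proof.
split=> [h|[s0 h] k]; last by rewrite mxE; case: (unliftP i k) => [j|] -> //=.
split; first by have := h i; rewrite mxE unlift_none in_itv.
by move=> k; have := h (lift i k); rewrite mxE liftK.
Qed.

(** Extend [f] by zero and apply Tonelli on the whole space: the indicator of the box is the product
    of those of the segment and of the face. *)
Lemma integral_box_face p (T : 'rV[R]_p.+1) (i : 'I_p.+1) (f : 'rV[R]_p.+1 -> \bar R) :
  measurable_fun setT f -> (forall t, box T t -> 0 <= f t)%E ->
  (\int[lebesgue_rV p.+1]_(t in box T) f t =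
   \int[lebesgue_rV p]_(y in face_box T i)
     \int[@lebesgue_measure R]_(s in `[0%R, T 0%R i]) f (face_point i s y))%E.
Proof.
move=> mf f0; have mB := measurable_box T; have mF := measurable_face_box T i.
have pf0 t : (0 <= (f \_ (box T)) t)%E.
  by rewrite patchE; case: ifPn => // /set_mem; exact: f0.
have mpf : measurable_fun setT (f \_ (box T)).
  by apply/(measurable_restrictT f mB); exact: measurable_funTS.
rewrite ge0_integral_lebesgue_rV//; last exact: measurable_funTS.
rewrite integral_mkcond (tonelli_coord i)//.
have patch_face y : (\int[@lebesgue_measure R]_s (f \_ (box T)) (face_point i s y) =
    ((fun y => \int[@lebesgue_measure R]_(s in `[0%R, T 0%R i]) f (face_point i s y))
      \_ (face_box T i)) y)%E.
  rewrite patchE; case: ifPn => [/set_mem yF|/negP yF].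
    rewrite [RHS]integral_mkcond; apply: eq_integral => s _; rewrite !patchE.
    congr (if _ then _ else _).
    by apply/idP/idP => /set_mem h; apply/mem_set; [case/box_face_point : h|apply/box_face_point].
  rewrite integral0_eq// => s _; rewrite patchE ifF//; apply/negP => /set_mem.
  by case/box_face_point => _ /mem_set.
under eq_integral do rewrite patch_face.
rewrite -integral_mkcond ge0_integral_lebesgue_rV//; last first.
  by move=> y yF; apply: integral_ge0 => s s0; apply: f0; apply/box_face_point.
apply/measurable_restrictT => //.
have := @measurable_fun_fubini_tonelli_G _ _ _ _ R lebesgue_measure _
  (measurableT_comp mpf (@measurable_face_point R p i)) (fun=> pf0 _).
by congr measurable_fun; apply/funext => y; rewrite -patch_face.
Qed.

Lemma lebesgue_box_lty p (T : 'rV[R]_p) : (lebesgue_rV p (box T) < +oo)%E.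
Proof.
elim: p T => [|p IHp] T.
  rewrite lebesgue_rVE; last exact: measurable_box.
  by rewrite /= diracE; case: (_ \in _); exact: ltry.
have mF := measurable_face_box T 0.
have -> : lebesgue_rV p.+1 (box T) = (\int[lebesgue_rV p.+1]_(t in box T) 1)%E.
  rewrite integral_cst//=; last by apply: measurable_rV_leb; exact: measurable_box.
  by rewrite mul1e.
rewrite (integral_box_face ord0)//.
rewrite (eq_integral (cst (lebesgue_measure `[0, T 0 ord0]%classic))); last first.
  by move=> y _; rewrite integral_cst// mul1e.
rewrite integral_cst; last exact: measurable_rV_leb.
rewrite lebesgue_measure_itv/= lte_mul_pinfty//.
- by case: ifPn => [|_]; rewrite ?lexx// -EFinD !lte_fin !lee_fin oppr0 addr0 => /ltW.
- by case: ifPn.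
- by rewrite face_boxE.
Qed.

(** Each line in direction [i] meets the hyperplane in one point. This later discards the face
    [t 0 i = T 0 i]. *)
Lemma lebesgue_hyperplane p (i : 'I_p) (c : R) : lebesgue_rV p [set t : 'rV[R]_p | t 0 i = c] = 0%E.
Proof.
case: p i => [|p] i; first by case: i.
set A := [set t : 'rV[R]_p.+1 | t 0 i = c]; have mA : measurable A.
  rewrite (_ : A = rV_coord i @^-1` [set c])// -[X in measurable X]setTI.
  exact: measurable_rV_coord.
rewrite lebesgue_rVE// -(setIT A) -[LHS](@integral_indic _ _ _ (borel_lebesgue p.+1) _ measurableT)//.
rewrite (tonelli_coord i)//; last by apply/measurable_EFinP; exact: measurable_indic.
rewrite integral0_eq// => y _.
rewrite (eq_integral (fun s : measurableTypeR R => (\1_[set c] s : R)%:E)); last first.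
  move=> s _ /=; rewrite !indicE; congr (_%:E); congr ((_ : bool)%:R).
  by apply/idP/idP => /set_mem h; apply/mem_set; move: h; rewrite /A /= mxE unlift_none.
by rewrite integral_indic// setIT; exact: lebesgue_measure_set1.
Qed.

End box_integrals.

(** * The fundamental theorem of calculus along a coordinate *)

Section coordinate_calculus.
Context {R : realType}.

Lemma box_compact p (T : 'rV[R]_p) : compact (box T).
Proof.
rewrite (_ : box T = [set v | forall i, [set` `[0, T 0 i]] (v ord0 i)]).
  have cA i : compact [set` `[0, T 0 i]] by exact: segment_compact.
  exact: (rV_compact cA).
by apply/seteqP; split => t tT i; have := tT i; rewrite /= in_itv.
Qed.

Lemma within_continuous_box_bounded p (T : 'rV[R]_p) (f : 'rV[R]_p -> R) :
  {within box T, continuous f} -> exists2 C, 0 < C & forall t, box T t -> `|f t| <= C.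
Proof.
move=> /continuous_compact/(_ (@box_compact p T))/compact_bounded.
move=> [M [_ h]]; exists (`|M| + 1); first by rewrite ltr_wpDl.
move=> t tT; apply: (h (`|M| + 1)); last by exists t.
by rewrite (le_lt_trans (ler_norm M))// ltrDl.
Qed.

Lemma continuous_box_bounded p (T : 'rV[R]_p) (f : 'rV[R]_p -> R) :
  continuous f -> exists2 C, 0 < C & forall t, box T t -> `|f t| <= C.
Proof.
by move=> cf; apply: within_continuous_box_bounded; exact: continuous_subspaceT.
Qed.

Lemma continuous_box_integrable p (T : 'rV[R]_p) (f : 'rV[R]_p -> R) :
  continuous f -> (lebesgue_rV p).-integrable (box T) (EFin \o f).
Proof.
move=> cf; have mB := measurable_box T.
apply: measurable_bounded_integrable.
- exact: measurable_rV_leb.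
- exact: lebesgue_box_lty.
- apply: measurable_fun_rV_leb => //; apply: measurable_funTS.
  exact: continuous_measurable_rV.
- have [C C0 fC] := continuous_box_bounded T cf.
  exists C; split; first exact: num_real.
  by move=> x Cx t tT; apply: (le_trans (fC _ tT)); exact: ltW.
Qed.

Lemma face_point_add p (i : 'I_p.+1) (h s : R) (y : 'rV[R]_p) :
  face_point i (h + s) y = h *: basis_vec i + face_point i s y.
Proof.
apply/rowP => k; rewrite !mxE eqxx /= eq_sym.
case: (unliftP i k) => [j|] -> /=; last by rewrite eqxx mulr1.
by rewrite (negbTE (neq_lift _ _)) mulr0 add0r.
Qed.

Lemma continuous_face_point p (i : 'I_p.+1) (y : 'rV[R]_p) :
  continuous (fun s : R => face_point i s y).
Proof.
move=> s; apply: cvg_rV => k; rewrite mxE.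
rewrite (_ : (fun _ => _) = fun s : R => oapp (y 0) s (unlift i k)); last first.
  by apply/funext => x; rewrite mxE.
by case: unlift => [j|]; [exact: cvg_cst|exact: cvg_id].
Qed.

Lemma derivable_face_point p (i : 'I_p.+1) (g : 'rV[R]_p.+1 -> R) s y :
  derivable g (face_point i s y) (basis_vec i) ->
  is_derive s 1 (fun s => g (face_point i s y)) (partial i g (face_point i s y)).
Proof.
have e : (fun h => h^-1 *: (((fun s => g (face_point i s y)) \o shift s) (h *: 1)
      - (fun s => g (face_point i s y)) s)) =
    fun h => h^-1 *: ((g \o shift (face_point i s y)) (h *: basis_vec i)
      - g (face_point i s y)).
  by apply/funext => h /=; rewrite -face_point_add [h *: 1]mulr1.
move=> dg; split; first by rewrite /derivable e.
by rewrite /partial /derive e.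
Qed.

(** Differentiation is asked in direction [i] alone: this is enough for the fundamental theorem on
    lines parallel to that axis, and it is stable under products. *)
Definition C1_along p (i : 'I_p) (g : 'rV[R]_p -> R) :=
  [/\ continuous g, forall t, derivable g t (basis_vec i) & continuous (partial i g)].

Section along.
Context p (T : 'rV[R]_p.+1) (i : 'I_p.+1) (g : 'rV[R]_p.+1 -> R).
Hypotheses (T0 : 0 < T 0 i) (gC1 : C1_along i g).

(** The integrand is the derivative in [s] of [(a * s + b) * g + c * s]. Slope 0 and intercept 1
    give the vanishing of periodic integrals; slope 1 and intercept [- T 0 i] give the trace
    inequality. *)
Lemma FTC2_affine (a b c : R) y :
  (\int[lebesgue_measure]_(s in `[0%R, T 0%R i])
     (a * g (face_point i s y) + (a * s + b) * partial i g (face_point i s y) + c)%:E =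
   ((a * T 0 i + b) * g (face_point i (T 0 i) y) + c * T 0 i - b * g (face_point i 0 y))%:E)%E.
Proof.
have [cg dg cdg] := gC1; pose f s := g (face_point i s y).
have cf : continuous f.
  by move=> s; apply: continuous_comp; [exact: continuous_face_point|exact: cg].
have cdf : continuous (fun s => partial i g (face_point i s y)).
  by move=> s; apply: continuous_comp; [exact: continuous_face_point|exact: cdg].
have df (s : R) := derivable_face_point (dg (face_point i s y)).
pose G s := (a * s + b) * f s + c * s.
have dG (s : R) : is_derive s 1 G (a * f s + (a * s + b) * partial i g (face_point i s y) + c).
  apply: is_derive_eq.
  by rewrite addr0 -![_ *: _]/(_ * _) !mulr1 /f; ring.
have cG : continuous G by move=> s; apply/differentiable_continuous/derivable1_diffP; case: (dG s).
rewrite (@continuous_FTC2 _ _ G)//.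
- by rewrite -EFinB /G; congr EFin; rewrite mulr0 add0r mulr0 addr0 /f; ring.
- apply: continuous_subspaceT => s.
  apply: cvgD; last exact: cvg_cst.
  apply: cvgD; first by apply: cvgM; [exact: cvg_cst|exact: cf].
  apply: cvgM; last exact: cdf.
  apply: cvgD; last exact: cvg_cst.
  by apply: cvgM; [exact: cvg_cst|exact: cvg_id].
- split.
  + by move=> s _; case: (dG s).
  + exact/cvg_at_right_filter/cG.
  + exact/cvg_at_left_filter/cG.
- by move=> s _; rewrite derive1E derive_val.
Qed.

(** The slicing formula asks for a nonnegative integrand, so a bound [C] of the partial is added and
    finally cancelled. On each line the fundamental theorem leaves [C * T 0 i], the boundary terms
    being equal by periodicity. *)
Lemma Rintegral_partial_periodic :
  (forall t, g (t + T 0 i *: basis_vec i) = g t) ->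
  \int[lebesgue_rV p.+1]_(t in box T) partial i g t = 0.
Proof.
move=> gT; have [cg dg cdg] := gC1.
have mB := measurable_rV_leb (measurable_box T).
have [C C0 hC] := continuous_box_bounded T cdg.
have mdg := continuous_measurable_rV cdg.
have idg := continuous_box_integrable T cdg.
have iC : (lebesgue_rV p.+1).-integrable (box T) (EFin \o cst C).
  by apply: continuous_box_integrable; exact: cst_continuous.
have face_const c : (\int[lebesgue_measure]_(s in `[0%R, T 0%R i]) c%:E = (c * T 0 i)%:E)%E.
  have lT : lebesgue_measure (`[0, T 0 i]%classic : set R) = (T 0 i)%:E.
    by rewrite lebesgue_measure_itv/= lte_fin T0 -EFinB subr0.
  rewrite (eq_integral (cst c%:E))// integral_cst//.
  by transitivity (c%:E * (T 0 i)%:E)%E => //; congr (_ * _)%E; exact: lT.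
have : (\int[lebesgue_rV p.+1]_(t in box T) (partial i g t + C)%:E =
    \int[lebesgue_rV p.+1]_(t in box T) (cst C t)%:E)%E.
  rewrite (integral_box_face i); last 2 first.
  - by apply/measurable_EFinP; apply: measurable_funD => //; exact: measurable_cst.
  - by move=> t /hC; rewrite ler_norml lee_fin -lerBlDr sub0r => /andP[].
  rewrite (integral_box_face i); last 2 first.
  - by apply/measurable_EFinP; exact: measurable_cst.
  - by move=> t _; rewrite lee_fin ltW.
  apply: eq_integral => y _; rewrite [RHS]face_const.
  rewrite (eq_integral (fun s : measurableTypeR R => (0 * g (face_point i s y) +
      (0 * (s : R) + 1) * partial i g (face_point i s y) + C)%:E)); last first.
    by move=> s _; congr EFin; ring.
  rewrite FTC2_affine; congr EFin.
  by rewrite -[in face_point i _ _](addr0 (T 0 i)) face_point_add [_ *: _ + _]addrC gT; ring.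
have e : (\int[lebesgue_rV p.+1]_(t in box T) (partial i g t + C)%:E =
    \int[lebesgue_rV p.+1]_(t in box T) (partial i g t)%:E +
    \int[lebesgue_rV p.+1]_(t in box T) (cst C t)%:E)%E := integralD mB idg iC.
rewrite e -(fineK (integrable_fin_num mB idg)) -(fineK (integrable_fin_num mB iC)).
by rewrite -EFinD => -[]; rewrite /Rintegral/=; lra.
Qed.

Lemma measurable_integral_face (f : 'rV[R]_p.+1 -> \bar R) :
  measurable_fun setT f -> (forall t, 0 <= f t)%E ->
  measurable_fun setT (fun y : 'rV[R]_p =>
    \int[lebesgue_measure]_(s in `[0%R, T 0%R i]) f (face_point i s y))%E.
Proof.
move=> mf f0; pose D := `[0, T 0 i]%classic `*` [set: 'rV[R]_p] : set (measurableTypeR R * _).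
have mD : measurable D by exact: measurableX.
pose h (x : measurableTypeR R * 'rV[R]_p) := f (face_point i x.1 x.2).
have mh : measurable_fun setT (h \_ D).
  apply/(measurable_restrictT h mD)/measurable_funTS.
  exact: measurableT_comp mf (@measurable_face_point R p i).
have h0 x : (0 <= (h \_ D) x)%E by rewrite patchE; case: ifPn => // _; exact: f0.
have := @measurable_fun_fubini_tonelli_G _ _ _ _ R lebesgue_measure _ mh h0.
congr measurable_fun; apply/funext => y; rewrite [RHS]integral_mkcond.
apply: eq_integral => s _; rewrite !patchE; congr (if _ then _ else _).
by apply/idP/idP => /set_mem h'; apply/mem_set; [case: h'|split].
Qed.

(** On each line [T 0 i * g] at the face [s = 0] is the integral of [g + (s - T 0 i) * partial i g],
    and the weight is at most [T 0 i] in absolute value. *)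
Lemma face_trace_le : (forall t, 0 <= g t) ->
  ((T 0 i)%:E * \int[lebesgue_rV p]_(y in face_box T i) (g (face_point i 0 y))%:E <=
   \int[lebesgue_rV p.+1]_(t in box T) (g t + T 0 i * `|partial i g t|)%:E)%E.
Proof.
move=> g0; have [cg dg cdg] := gC1.
have mF : measurable (face_box T i : set (rV_leb R p)).
  exact: measurable_rV_leb (measurable_face_box T i).
have mg := continuous_measurable_rV cg.
have mdg := continuous_measurable_rV cdg.
have mface (s : R) : measurable_fun setT (fun y : 'rV[R]_p => face_point i s y).
  exact: measurableT_comp (@measurable_face_point R p i) (measurable_pair1 s).
rewrite (integral_box_face i); last 2 first.
- apply/measurable_EFinP; apply: measurable_funD => //.
  by apply: measurable_funM; [exact: measurable_cst|exact: measurableT_comp].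
- by move=> t _; rewrite lee_fin addr_ge0// mulr_ge0// ltW.
have mface0 : measurable_fun (face_box T i : set (rV_leb R p)) (fun y => g (face_point i 0 y)).
  apply: measurable_fun_rV_leb; first exact: measurable_face_box.
  by apply: measurable_funTS; exact: measurableT_comp mg (mface 0).
have T0E : (0 <= (T 0%R i)%:E)%E by rewrite lee_fin ltW.
have g0E y : face_box T i y -> (0 <= (g (face_point i 0 y))%:E)%E by rewrite lee_fin.
have /measurable_EFinP mface0E := mface0.
rewrite -(ge0_integralZl (lebesgue_rV p) mF mface0E g0E T0E).
apply: (ge0_le_integral (lebesgue_rV p) mF).
- by move=> y _; rewrite mule_ge0 ?lee_fin// ltW.
- by apply/measurable_EFinP; apply: (measurable_funM _ mface0); exact: measurable_cst.
- apply: measurable_fun_rV_leb; first exact: measurable_face_box.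
  apply: measurable_funTS.
  apply: (@measurable_integral_face (fun t => (g t + T 0 i * `|partial i g t|)%:E)).
    apply/measurable_EFinP; apply: measurable_funD => //.
    by apply: measurable_funM; [exact: measurable_cst|exact: measurableT_comp].
  by move=> t; rewrite lee_fin addr_ge0// mulr_ge0// ltW.
move=> y yF; rewrite -EFinM.
(* With [a = 1] and [b = - T 0 i] the weight vanishes at [s = T 0 i], so only the value at [s = 0]
   survives. *)
have -> : T 0 i * g (face_point i 0 y) = (1 * T 0 i + - T 0 i) * g (face_point i (T 0 i) y)
    + 0 * T 0 i - (- T 0 i) * g (face_point i 0 y) by ring.
rewrite -FTC2_affine.
have cf : continuous (fun s : R => g (face_point i s y)).
  by move=> s; apply: continuous_comp; [exact: continuous_face_point|exact: cg].
have cdf : continuous (fun s : R => partial i g (face_point i s y)).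
  by move=> s; apply: continuous_comp; [exact: continuous_face_point|exact: cdg].
apply: le_integral => //.
- apply: continuous_compact_integrable; first exact: segment_compact.
  apply: continuous_subspaceT => s; apply: cvgD; last exact: cvg_cst.
  apply: cvgD; first by apply: cvgM; [exact: cvg_cst|exact: cf].
  apply: cvgM; last exact: cdf.
  by apply: cvgD; [apply: cvgM; [exact: cvg_cst|exact: cvg_id]|exact: cvg_cst].
- apply: continuous_compact_integrable; first exact: segment_compact.
  apply: continuous_subspaceT => s; apply: cvgD; first exact: cf.
  apply: cvgM; first exact: cvg_cst.
  exact: (cvg_norm (cdf s)).
move=> s; rewrite inE/= in_itv/= => /andP[s0 sT]; rewrite lee_fin mul1r addr0 lerD2l.
rewrite (le_trans (ler_norm _))// normrM ler_wpM2r// mul1r distrC.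
by rewrite ger0_norm ?subr_ge0// gerBl.
Qed.

End along.
End coordinate_calculus.

(** * Totality of trigonometric polynomials *)

Section trigonometric_polynomials.
Context {R : realType} {p : nat}.
Variable T : 'rV[R]_p.

Definition freq (m : 'rV[int]_p) (i : 'I_p) : R := pi *+ 2 * (m 0 i)%:~R / T 0 i.

Definition phase (m : 'rV[int]_p) (t : 'rV[R]_p) : R := \sum_i freq m i * t 0 i.

(** A cosine with a free phase covers sines too: differentiation shifts the phase by [pi / 2], and a
    product of two waves is half the sum of two waves. *)
Definition wave (m : 'rV[int]_p) (c : R) (t : 'rV[R]_p) : R := cos (phase m t + c).

Inductive trigp : ('rV[R]_p -> R) -> Prop :=
| trigp0 : trigp (cst 0)
| trigp_cons a m c f : trigp f -> trigp (a *: wave m c + f).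

Lemma freqD m k i : freq (m + k) i = freq m i + freq k i.
Proof. by rewrite /freq mxE intrD mulrDr mulrDl. Qed.

Lemma freqN m i : freq (- m) i = - freq m i.
Proof. by rewrite /freq mxE intrN mulrN mulNr. Qed.

Lemma phaseD m k t : phase (m + k) t = phase m t + phase k t.
Proof. by rewrite /phase -big_split; apply: eq_bigr => i _; rewrite freqD mulrDl. Qed.

Lemma phaseN m t : phase (- m) t = - phase m t.
Proof. by rewrite /phase -sumrN; apply: eq_bigr => i _; rewrite freqN mulNr. Qed.

Lemma phase_lin m s x t : phase m (s *: x + t) = s * phase m x + phase m t.
Proof.
rewrite /phase mulr_sumr -big_split; apply: eq_bigr => i _.
by rewrite !mxE mulrDr mulrCA.
Qed.

Lemma phase_basis m i : phase m (basis_vec i) = freq m i.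
Proof.
rewrite /phase (bigD1 i)//= big1 ?addr0 => [|j ji]; rewrite !mxE ?eqxx ?mulr1//=.
by rewrite (negbTE ji) mulr0.
Qed.

Lemma wave_mul m c k e : wave m c * wave k e =
  2^-1 *: wave (m + k) (c + e) + 2^-1 *: wave (m - k) (c - e).
Proof.
apply/funext => t; rewrite !fctE /wave !phaseD phaseN.
rewrite (_ : _ + _ + (c + e) = (phase m t + c) + (phase k t + e)); last by ring.
rewrite (_ : _ + _ + (c - e) = (phase m t + c) - (phase k t + e)); last by ring.
move: (phase m t + c) (phase k t + e) => x y.
by rewrite cosD cosB -![_ *: _]/(_ * _); field.
Qed.

Lemma trigp_wave m c : trigp (wave m c).
Proof.
have := trigp_cons 1 m c trigp0; congr trigp.
by apply/funext => t; rewrite !fctE addr0 scale1r.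
Qed.

Lemma trigpD f g : trigp f -> trigp g -> trigp (f + g).
Proof.
move=> tf tg; elim: tf => [|a m c h _ IH].
  by rewrite (_ : cst 0 + g = g)//; apply/funext => t; rewrite !fctE add0r.
by rewrite -addrA; exact: trigp_cons.
Qed.

Lemma trigpZ a f : trigp f -> trigp (a *: f).
Proof.
elim=> [|b m c h _ IH].
  rewrite (_ : a *: cst 0 = cst 0); first exact: trigp0.
  by apply/funext => t; rewrite !fctE scaler0.
by rewrite scalerDr scalerA; exact: trigp_cons.
Qed.

Lemma trigpN f : trigp f -> trigp (- f).
Proof. by rewrite -scaleN1r; exact: trigpZ. Qed.

Lemma trigpB f g : trigp f -> trigp g -> trigp (f - g).
Proof. by move=> tf tg; apply: trigpD => //; exact: trigpN. Qed.

Lemma trigp_wave_mul m c f : trigp f -> trigp (wave m c * f).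
Proof.
elim=> [|a k e g _ IH].
  rewrite (_ : _ * _ = cst 0); first exact: trigp0.
  by apply/funext => t; rewrite !fctE mulr0.
rewrite mulrDr; apply: trigpD => //.
rewrite (_ : wave m c * (a *: wave k e) = a *: (wave m c * wave k e)).
  rewrite wave_mul; apply: trigpZ; apply: trigpD; apply: trigpZ; exact: trigp_wave.
by apply/funext => t; rewrite !fctE -![_ *: _]/(_ * _) mulrCA.
Qed.

Lemma trigpM f g : trigp f -> trigp g -> trigp (f * g).
Proof.
move=> tf tg; elim: tf => [|a m c h _ IH].
  rewrite (_ : _ * _ = cst 0); first exact: trigp0.
  by apply/funext => t; rewrite !fctE mul0r.
rewrite mulrDl; apply: trigpD => //.
rewrite (_ : (a *: wave m c) * g = a *: (wave m c * g)).
  by apply: trigpZ; exact: trigp_wave_mul.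
by apply/funext => t; rewrite !fctE -![_ *: _]/(_ * _) mulrA.
Qed.

Lemma trigp_cst a : trigp (cst a).
Proof.
have := trigpZ a (trigp_wave 0 0); congr trigp; apply/funext => t.
rewrite !fctE /wave addr0 /phase big1 ?cos0 ?[_ *: _]mulr1// => i _.
by rewrite /freq mxE mulr0 !mul0r.
Qed.

Lemma trigpX f k : trigp f -> trigp (f ^+ k).
Proof.
move=> tf; elim: k => [|k IH]; first exact: trigp_cst.
by rewrite exprS; exact: trigpM.
Qed.

Lemma differentiable_phase m t : differentiable (phase m) t.
Proof.
rewrite (_ : phase m = \sum_i (fun t : 'rV[R]_p => freq m i * t 0 i)).
  apply: differentiable_sum => i.
  by apply: (differentiableM (differentiable_cst _ _)); exact: differentiable_coord.
by apply/funext => x; rewrite fct_sumE.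
Qed.

Lemma differentiable_wave m c t : differentiable (wave m c) t.
Proof.
apply: (@differentiable_comp _ _ _ _ (fun t => phase m t + c) cos).
  by apply: differentiableD; [exact: differentiable_phase|exact: differentiable_cst].
by apply/derivable1_diffP.
Qed.

Lemma partial_wave m c i : partial i (wave m c) = freq m i *: wave m (c + pi / 2).
Proof.
apply/funext => t; rewrite /partial /derive.
pose k (s : R) := cos (freq m i * s + (phase m t + c)).
rewrite (_ : (fun h => _) = fun h => h^-1 *: ((k \o shift 0) (h *: 1) - k 0)); last first.
  apply/funext => h; rewrite /= /k /wave phase_lin phase_basis addr0 mulr0 add0r.
  by rewrite [h *: 1]mulr1 (mulrC h) addrA.
rewrite -/(derive k 0 1).
have dk : is_derive (0 : R) 1 k (freq m i * cos (phase m t + c + pi / 2)).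
  apply: is_derive_eq.
  by rewrite cosDpihalf mulr0 add0r addr0 -![_ *: _]/(_ * _) mulr1 mulrC.
by rewrite derive_val -[RHS]/(freq m i * wave m (c + pi / 2) t) /wave addrA.
Qed.

Lemma trigp_differentiable f t : trigp f -> differentiable f t.
Proof.
elim=> [|a m c g _ IH]; first exact: differentiable_cst.
by apply: differentiableD => //; apply: differentiableZ; exact: differentiable_wave.
Qed.

Lemma trigp_derivable f t v : trigp f -> derivable f t v.
Proof. by move=> tf; apply: diff_derivable; exact: trigp_differentiable. Qed.

Lemma partialD i (f g : 'rV[R]_p -> R) : trigp f -> trigp g ->
  partial i (f + g) = partial i f + partial i g.
Proof.
by move=> tf tg; apply/funext => t; rewrite /partial deriveD//; exact: trigp_derivable.
Qed.

Lemma partialZ i a (f : 'rV[R]_p -> R) : trigp f -> partial i (a *: f) = a *: partial i f.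
Proof.
by move=> tf; apply/funext => t; rewrite /partial deriveZ//; exact: trigp_derivable.
Qed.

Lemma partial_cst0 i : partial i (cst 0 : 'rV[R]_p -> R) = cst 0.
Proof. by apply/funext => t; rewrite /partial derive_cst. Qed.

Lemma partial_trigp_cons i a m c f : trigp f ->
  partial i (a *: wave m c + f) = (a * freq m i) *: wave m (c + pi / 2) + partial i f.
Proof.
move=> tf; rewrite partialD//; last by apply: trigpZ; exact: trigp_wave.
by rewrite partialZ ?partial_wave ?scalerA//; exact: trigp_wave.
Qed.

Lemma trigp_partial i f : trigp f -> trigp (partial i f).
Proof.
elim=> [|a m c g tg IH]; first by rewrite partial_cst0; exact: trigp0.
by rewrite partial_trigp_cons//; exact: trigp_cons.
Qed.

Lemma partialB i (f g : 'rV[R]_p -> R) : trigp f -> trigp g ->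
  partial i (f - g) = partial i f - partial i g.
Proof.
by move=> tf tg; apply/funext => t; rewrite /partial deriveB//; exact: trigp_derivable.
Qed.

(** Either order multiplies a wave by the same two frequencies and shifts its phase by the same
    angle. *)
Lemma partialC i j f : trigp f -> partial i (partial j f) = partial j (partial i f).
Proof.
elim=> [|a m c g tg IH]; first by rewrite !partial_cst0.
have tp k := trigp_partial k tg.
rewrite (partial_trigp_cons j a m c tg) (partial_trigp_cons i a m c tg).
rewrite (partial_trigp_cons i _ _ _ (tp j)) (partial_trigp_cons j _ _ _ (tp i)) IH.
by rewrite mulrAC.
Qed.

Lemma trigp_continuous f : trigp f -> continuous f.
Proof. by move=> tf t; apply: differentiable_continuous; exact: trigp_differentiable. Qed.

Lemma trigp_C1 i f : trigp f -> C1_along i f.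
Proof.
move=> tf; split; [exact: trigp_continuous|by move=> t; exact: trigp_derivable|].
by apply: trigp_continuous; exact: trigp_partial.
Qed.

Lemma cosD2pi_int (x : R) (z : int) : cos (x + pi *+ 2 * z%:~R) = cos x.
Proof.
have cosn (k : nat) y : cos (y + pi *+ 2 * k%:R) = cos y :> R.
  elim: k y => [|k IHk] y; first by rewrite mulr0 addr0.
  by rewrite -natr1 mulrDr mulr1 addrA cosD2pi IHk.
case: z => k; first exact: cosn.
by rewrite NegzE mulrNz mulrN -[LHS](cosn k.+1) -addrA addNr addr0.
Qed.

Lemma trigp_periodic i f t : T 0 i != 0 -> trigp f -> f (t + T 0 i *: basis_vec i) = f t.
Proof.
move=> T0; elim=> [//|a m c g _ IH].
rewrite !fctE IH /wave addrC [t + _]addrC phase_lin phase_basis.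
rewrite (_ : T 0 i * freq m i = pi *+ 2 * (m 0 i)%:~R); last by rewrite /freq; field.
by rewrite -addrA [X in cos X]addrC cosD2pi_int addrC.
Qed.

End trigonometric_polynomials.

(** * Polynomials converging to a step function *)

Section step_approximation.
Context {R : realType}.

(** Write [z] as [s * s]: one factor [s ^+ m] keeps [m%:R * s ^+ m] below [(1 - s)^-1], the other
    tends to 0. *)
Lemma cvg_natM_expr (z : R) : 0 <= z < 1 -> m%:R * z ^+ m @[m --> \oo] --> 0.
Proof.
move=> /andP[z0 z1]; pose s := Num.sqrt z.
have s0 : 0 <= s by exact: sqrtr_ge0.
have s1 : s < 1 by rewrite -(@sqrtr1 R) ltr_sqrt.
have zE m : z ^+ m = s ^+ m * s ^+ m by rewrite -exprMn -expr2 sqr_sqrtr.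
have bound m : m%:R * s ^+ m <= (1 - s)^-1.
  rewrite -[leRHS]mul1r ler_pdivlMr ?subr_gt0//.
  elim: m => [|m IHm]; first by rewrite !mul0r.
  have -> : m.+1%:R * s ^+ m.+1 * (1 - s) =
     s * (m%:R * s ^+ m * (1 - s)) + s ^+ m.+1 * (1 - s).
    by rewrite exprS -natr1; ring.
  have : s ^+ m.+1 <= 1 by rewrite exprn_ile1// ltW.
  have : 0 <= s ^+ m.+1 by rewrite exprn_ge0.
  nra.
apply: (@squeeze_cvgr _ _ _ _ (cst 0) (fun m => (1 - s)^-1 * s ^+ m)).
- apply: nearW => m; rewrite mulr_ge0 ?exprn_ge0//= zE mulrA.
  by apply: ler_wpM2r (bound m); exact: exprn_ge0.
- exact: cvg_cst.
- rewrite -(mulr0 (1 - s)^-1); apply: cvgM; first exact: cvg_cst.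
  by apply: cvg_expr; rewrite ger0_norm.
Qed.

Lemma bernoulli_ge (a : R) N : 0 <= a <= 1 -> 1 - N%:R * a <= (1 - a) ^+ N.
Proof.
move=> /andP[a0 a1]; elim: N => [|N IHN]; first by rewrite mul0r subr0 expr0.
rewrite exprSr -natr1.
have N0 : 0 <= N%:R :> R by [].
have [h|h] := leP 0 (1 - N%:R * a); first by nra.
have : 0 <= (1 - a) ^+ N by rewrite exprn_ge0// subr_ge0.
nra.
Qed.

Lemma bernoulli_le (a : R) N : 0 <= a <= 1 -> (1 - a) ^+ N * (1 + N%:R * a) <= 1.
Proof.
move=> /andP[a0 a1]; elim: N => [|N IHN]; first by rewrite expr0 mul0r addr0 mul1r.
rewrite exprSr -natr1.
have N0 : 0 <= N%:R :> R by [].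
have h : 0 <= (1 - a) ^+ N by rewrite exprn_ge0// subr_ge0.
set b := _ ^+ N in h IHN *.
have : b * (1 - a) * (1 + (N%:R + 1) * a) = b * (1 + N%:R * a) - b * (N%:R + 1) * a ^+ 2.
  by ring.
have : 0 <= b * (N%:R + 1) * a ^+ 2 by rewrite mulr_ge0 ?sqr_ge0// mulr_ge0// addr_ge0.
lra.
Qed.

(* With [y = (1 - x) / 2], [N y ^ m] for [N = m 2 ^ m] tends to 0 if [x > 0] and
   to infinity otherwise, which Bernoulli's inequality turns into a limit of
   [(1 - y ^ m) ^ N]. *)
Definition step_poly (m : nat) (x : R) : R :=
  (1 - ((1 - x) / 2) ^+ m) ^+ (m * 2 ^ m).

Lemma step_poly_bound m x : -1 <= x <= 1 -> 0 <= step_poly m x <= 1.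
Proof.
move=> /andP[x1 x2]; have y0 : 0 <= (1 - x) / 2 by lra.
have y1 : (1 - x) / 2 <= 1 by lra.
have h0 : 0 <= 1 - ((1 - x) / 2) ^+ m by rewrite subr_ge0 exprn_ile1.
by rewrite exprn_ge0//= exprn_ile1// gerBl exprn_ge0.
Qed.

Lemma cvg_step_poly (x : R) : -1 <= x <= 1 -> step_poly m x @[m --> \oo] --> ((0 < x)%R%:R : R).
Proof.
move=> x11; have /andP[x1 x2] := x11; pose y := (1 - x) / 2.
have y0 : 0 <= y by rewrite /y; lra.
have y1 : y <= 1 by rewrite /y; lra.
have a01 m : 0 <= y ^+ m <= 1 by rewrite exprn_ge0//= exprn_ile1.
have NaE m : (m * 2 ^ m)%:R * y ^+ m = m%:R * (2 * y) ^+ m.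
  by rewrite natrM natrX [in RHS]exprMn mulrA.
have [x0|x0] := ltP 0 x.
  (* For [0 < x] one has [2 * y < 1], so the Bernoulli defect [m%:R * (2 * y) ^+ m] tends to 0. *)
  apply: (@squeeze_cvgr _ _ _ _ (fun m => 1 - m%:R * (2 * y) ^+ m) (cst 1)).
  - apply: nearW => m; have /andP[_ ->] := step_poly_bound m x11.
    by rewrite andbT -NaE bernoulli_ge.
  - rewrite -[X in _ --> X]subr0; apply: cvgB; first exact: cvg_cst.
    by apply: cvg_natM_expr; rewrite mulr_ge0//= /y; lra.
  - exact: cvg_cst.
(* For [x <= 0], including [x = 0], one has [1 <= 2 * y], so the exponent times [y ^+ m] is at least
   [m] and the value is at most [1 / m.+1]. *)
apply: (@squeeze_cvgr _ _ _ _ (cst 0) (fun m => m.+1%:R^-1)).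
- apply: nearW => m; have /andP[h0 _] := step_poly_bound m x11.
  rewrite h0/= -[leRHS]mul1r ler_pdivlMr//.
  apply: le_trans (bernoulli_le (m * 2 ^ m) (a01 m)).
  apply: ler_wpM2l => //.
  rewrite NaE -natr1 addrC lerD2l ler_peMr// exprn_ege1// /y; lra.
- exact: cvg_cst.
- exact: cvg_harmonic.
Qed.

End step_approximation.

(** * Orthants as a generating family closed under intersection *)

Section rays.
Context {R : realType} {p : nat}.

(** Extended bounds let [-oo] leave a coordinate free, so the coordinate half-spaces that generate
    the sigma-algebra are themselves orthants. *)
Definition upper_orthant (x : 'I_p -> \bar R) : set 'rV[R]_p :=
  [set t | forall i, (x i < (t 0 i)%:E)%E].

Lemma measurable_upper_orthant x : measurable (upper_orthant x).
Proof.
rewrite (_ : upper_orthant x =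
    \big[setI/setT]_(i < p) (rV_coord i @^-1` [set s | (x i < s%:E)%E])).
  elim/big_ind : _ => //=; first by move=> ? ?; exact: measurableI.
  move=> i _; rewrite -[X in measurable X]setTI; apply: measurable_rV_coord => //.
  case: (x i) => [r| |].
  - rewrite (_ : [set s | _] = `]r, +oo[%classic)//.
    by apply/seteqP; split => s; rewrite /= in_itv/= andbT lte_fin.
  - rewrite (_ : [set s | _] = set0)//; by apply/seteqP; split => s.
  - rewrite (_ : [set s | _] = setT)//; by apply/seteqP; split => s // _; exact: ltNyr.
apply/seteqP; split => [t tT|t].
  by elim/big_ind : _ => // i _; exact: tT.
by move=> tT i; move: tT; rewrite (bigD1 i)//= => -[].
Qed.

Lemma measurable_rV_orthantE :
  @measurable _ 'rV[R]_p = <<s range upper_orthant >>.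
Proof.
apply/seteqP; split; last first.
  apply: smallest_sub; first exact: sigma_algebra_measurable.
  by move=> _ [x _ <-]; exact: measurable_upper_orthant.
rewrite /measurable/=; apply: smallest_sub; first exact: smallest_sigma_algebra.
pose S : measurableType _ := g_sigma_algebraType (range upper_orthant).
have mcoord i : measurable_fun [set: S] (rV_coord i : S -> measurableTypeR R).
  apply: (measurability _ (RGenOInfty.measurableE R)) => //.
  move=> _ [_ [r ->] <-]; rewrite setTI; apply: sub_sigma_algebra.
  exists (fun j => if j == i then r%:E else -oo%E) => //.
  apply/seteqP; split => t /=.
    by move=> /(_ i); rewrite eqxx in_itv/= andbT lte_fin.
  rewrite in_itv/= andbT => h j; case: eqP => [->|_]; last exact: ltNyr.
  by rewrite lte_fin.
elim/big_ind : _ => // [A B hA hB C [/hA|/hB]//|i _ _ [B mB <-]].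
by have := mcoord i measurableT B mB.
Qed.

End rays.

(* The measurable sets of [rV_leb] are the Caratheodory ones, of which only the
   Borel ones are reached by the Dynkin argument. *)
Lemma borel_hull (R : realType) p (E : set (rV_leb R p)) :
  measurable E -> (lebesgue_rV p E < +oo)%E ->
  exists B : set 'rV[R]_p, [/\ measurable B, E `<=` B & lebesgue_rV p (B `\` E) = 0%E].
Proof.
move=> mE Eoo; have E0 : (0 <= lebesgue_rV p E)%E by exact: measure_ge0.
have Efin : lebesgue_rV p E \is a fin_num by rewrite ge0_fin_numE.
(* The outer measure is an infimum over countable Borel covers; near-optimal covers, one for each
   [n], are then intersected. *)
have /choice[A hA] (n : nat) : exists A : (set 'rV[R]_p)^nat,
    measurable_cover (E : set 'rV[R]_p) A /\
    (\sum_(k <oo) borel_lebesgue p (A k) < lebesgue_rV p E + (n.+1%:R^-1)%:E)%E.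
  have [||x [A cA <-] hx] := @lb_ereal_inf_adherent _
    [set (\sum_(k <oo) borel_lebesgue p (A k))%E | A in measurable_cover (E : set 'rV[R]_p)] n.+1%:R^-1.
  - by rewrite invr_gt0.
  - exact: Efin.
  - by exists A.
pose B_ n := \bigcup_k (A n k).
have mA n k : measurable (A n k) by exact: (cover_measurable (hA n).1 k).
have mB_ n : measurable (B_ n) by exact: bigcupT_measurable.
have EB_ n : E `<=` B_ n by exact: (cover_subset (hA n).1).
have mB : measurable (\bigcap_n B_ n) by exact: bigcapT_measurable.
exists (\bigcap_n B_ n); split => //; first by move=> t Et n _; exact: EB_.
have EB : E `<=` \bigcap_n B_ n by move=> t Et n _; exact: EB_.
have lB n : (lebesgue_rV p (\bigcap_n B_ n) <= lebesgue_rV p E + (n.+1%:R^-1)%:E)%E.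
  rewrite lebesgue_rVE//; apply: le_trans (ltW (hA n).2).
  apply: (@le_trans _ _ (borel_lebesgue p (B_ n))).
    by apply: le_measure; rewrite ?inE//; exact: bigcap_inf.
  exact: measure_sigma_subadditive.
have mBl := measurable_rV_leb mB.
rewrite measureD//; last exact: le_lt_trans (lB 0%N) (lte_add_pinfty Eoo (ltry _)).
rewrite setIidr//.
have lBE : (lebesgue_rV p (\bigcap_n B_ n) <= lebesgue_rV p E)%E.
  apply/lee_addgt0Pr => e e0; have [n ne] : exists n, n.+1%:R^-1 <= e :> R.
    exists (Num.truncn e^-1); rewrite -[leRHS]invrK lef_pV2 ?posrE ?invr_gt0//.
    by rewrite ltW// truncnS_gt.
  by apply: le_trans (lB n) _; rewrite leeD2l// lee_fin.
have eqB : lebesgue_rV p (\bigcap_n B_ n) = lebesgue_rV p E.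
  by apply/eqP; rewrite eq_le lBE/=; apply: le_measure; rewrite ?inE.
transitivity (lebesgue_rV p E - lebesgue_rV p E)%E; last by rewrite subee.
by congr (_ - _)%E.
Qed.

Lemma fct_expE (R : realType) (X : Type) (f : X -> R) k t : (f ^+ k) t = f t ^+ k.
Proof. by elim: k => [|k IHk]; rewrite ?expr0// !exprS -IHk. Qed.

Section perpendicular_sets.
Context {R : realType} {p : nat}.
Variable T : 'rV[R]_p.
Hypothesis T0 : forall i, 0 < T 0 i.
Variable w : 'rV[R]_p -> R.
Hypothesis iw : (lebesgue_rV p).-integrable (box T) (EFin \o w).
Hypothesis w_perp : forall g, trigp T g -> \int[lebesgue_rV p]_(t in box T) (w t * g t) = 0.

Let mbox : measurable (box T : set (rV_leb R p)) := measurable_rV_leb (measurable_box T).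

Lemma integrable_mul_trigp g A : trigp T g -> measurable (A : set (rV_leb R p)) ->
  (lebesgue_rV p).-integrable (box T `&` A) (fun t => (w t * g t)%:E).
Proof.
move=> tg mA; have [C C0 gC] := continuous_box_bounded T (trigp_continuous tg).
apply: (integrableS mbox (measurableI _ _ mbox mA) (@subIsetl _ _ _)).
have mg : measurable_fun (box T : set (rV_leb R p)) g.
  apply: measurable_fun_rV_leb; first exact: measurable_box.
  by apply: measurable_funTS; apply: continuous_measurable_rV; exact: (trigp_continuous tg).
have mw : measurable_fun (box T : set (rV_leb R p)) w.
  by apply/measurable_EFinP; case/integrableP : iw.
have mwg : measurable_fun (box T : set (rV_leb R p)) (fun t => (w t * g t)%:E).
  by apply/measurable_EFinP; exact: (measurable_funM mw mg).
apply: (le_integrable mbox mwg _ (integrableZl mbox C iw)).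
move=> t tT /=; rewrite lee_fin !normrM mulrC (gtr0_norm C0).
by rewrite ler_wpM2r// gC.
Qed.

(* Polynomials in a trigonometric polynomial [x] are trigonometric and approximate
   the indicator of [0 < x], so this family is stable under intersection with
   such sets. *)
Definition perp_on (A : set 'rV[R]_p) := measurable A /\
  forall g, trigp T g -> \int[lebesgue_rV p]_(t in box T `&` A) (w t * g t) = 0.

(** [step_poly m] composed with [x] is a polynomial in [x], hence trigonometric, and stays in
    [[0, 1]] on the box; dominated convergence by [w * g] in absolute value reaches the indicator of
    [0 < x]. *)
Lemma perp_on_pos A x : trigp T x -> (forall t, box T t -> -1 <= x t <= 1) ->
  perp_on A -> perp_on (A `&` [set t | 0 < x t]).
Proof.
move=> tx x1 [mA hA].
have mx : measurable_fun setT x.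
  by apply: continuous_measurable_rV; exact: (trigp_continuous tx).
have mx0 : measurable [set t | 0 < x t].
  rewrite (_ : [set t | _] = x @^-1` `]0, +oo[%classic); last first.
    by apply/seteqP; split => t /=; rewrite in_itv/= andbT.
  by rewrite -[X in measurable X]setTI; exact: mx.
have mA0 : measurable (A `&` [set t | 0 < x t]) by exact: measurableI.
split => // g tg.
have mD : measurable (box T `&` A : set (rV_leb R p)).
  by apply: measurableI => //; exact: measurable_rV_leb.
have tstep m : trigp T (g * (fun t => step_poly m (x t))).
  apply: trigpM => //; rewrite (_ : (fun t => _) =
     (cst 1 - (2^-1 *: (cst 1 - x)) ^+ m) ^+ (m * 2 ^ m)).
    apply: trigpX; apply: trigpB; first exact: trigp_cst.
    by apply: trigpX; apply: trigpZ; apply: trigpB => //; exact: trigp_cst.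
  apply/funext => t; rewrite fct_expE.
  rewrite -[X in X ^+ (m * 2 ^ m)]/(1 - ((2^-1 *: (cst 1 - x)) ^+ m) t) fct_expE.
  rewrite /step_poly; congr ((_ - _ ^+ _) ^+ _).
  by rewrite [RHS]mulrC.
have iwg := integrable_mul_trigp tg (measurable_rV_leb mA).
have lim_step : (\int[lebesgue_rV p]_(t in box T `&` A)
      (w t * (g * (fun t => step_poly m (x t))) t)%:E)%E @[m --> \oo] -->
    (\int[lebesgue_rV p]_(t in box T `&` A) (w t * (g t * (0 < x t)%R%:R))%:E)%E.
  apply: (@dominated_cvg _ _ R (lebesgue_rV p) _ mD _ _ (fun t => `|(w t * g t)%:E|)%E).
  - by move=> m; case/integrableP : (integrable_mul_trigp (tstep m) (measurable_rV_leb mA)).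
  - move=> t [tT _]; apply: cvg_EFin; first exact: nearW.
    apply: cvgM; first exact: cvg_cst.
    apply: cvgM; first exact: cvg_cst.
    exact: cvg_step_poly (x1 _ tT).
  - by move=> t _.
  - exact: integrable_abse.
  - move=> m t [tT _]; rewrite lee_fin [(g * _) t]/(_ * _) mulrA normrM ler_piMr//.
    by have /andP[h0 h1] := step_poly_bound m (x1 _ tT); rewrite ger0_norm.
move: lim_step; rewrite (_ : (fun m : nat => _) = cst 0%E); last first.
  apply/funext => m.
  have iwm := integrable_mul_trigp (tstep m) (measurable_rV_leb mA).
  by rewrite -(fineK (integrable_fin_num mD iwm)) [fine _](hA _ (tstep m)).
move=> /(cvg_unique _ (cvg_cst 0%E))/= => /(_ (@ereal_hausdorff R)) lim0.
rewrite /Rintegral setIA (_ : (\int[_]_(t in _) _)%E = 0%E)//.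
rewrite [LHS]integral_mkcondr [RHS]lim0; apply: eq_integral => t _.
rewrite patchE /=; case: ifPn => [/set_mem/= ->|/negP xt]; first by rewrite mulr1.
have -> : (0 < x t)%R = false by apply/negP => x0; apply: xt; exact/mem_set.
by rewrite !mulr0.
Qed.

End perpendicular_sets.

Lemma sin_gt0_slope (R : realType) (l x : R) : 0 < l -> 0 < x < l -> 0 < sin (pi * x / l).
Proof.
move=> l0 /andP[x0 xl]; apply: sin_gt0_pi; rewrite divr_gt0 ?mulr_gt0 ?pi_gt0//=.
by rewrite -mulrA gtr_pMr ?pi_gt0// ltr_pdivrMr// mul1r.
Qed.

Section totality.
Context {R : realType} {p : nat}.
Variable T : 'rV[R]_p.
Hypothesis T0 : forall i, 0 < T 0 i.
Variable w : 'rV[R]_p -> R.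
Hypothesis iw : (lebesgue_rV p).-integrable (box T) (EFin \o w).
Hypothesis w_perp : forall g, trigp T g -> \int[lebesgue_rV p]_(t in box T) (w t * g t) = 0.

Let mbox : measurable (box T : set (rV_leb R p)) := measurable_rV_leb (measurable_box T).

(* Each sine has period [2 T^i], but their product is [T^i]-periodic; on the box
   it is positive exactly when [r < t^i < T^i]. *)
Definition bump_fun (i : 'I_p) (r : R) (t : 'rV[R]_p) : R :=
  sin (pi * (t 0 i - r) / T 0 i) * sin (pi * (T 0 i - t 0 i) / T 0 i).

(** By [sin a * sin b = (cos (a - b) - cos (a + b)) / 2]: in [a + b] the variable cancels, and
    [a - b] has frequency [pi *+ 2 / T 0 i]. *)
Lemma trigp_bump i r : trigp T (bump_fun i r).
Proof.
have := trigpZ 2^-1 (trigpB (trigp_wave T (delta_mx 0 i) (- (pi * (T 0 i + r) / T 0 i)))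
  (trigp_cst T (cos (pi * (T 0 i - r) / T 0 i)))).
congr trigp; apply/funext => t.
rewrite -[LHS]/(2^-1 * (wave T (delta_mx 0 i) (- (pi * (T 0 i + r) / T 0 i)) t
   - cos (pi * (T 0 i - r) / T 0 i))) /wave /bump_fun.
have Ti0 : T 0 i != 0 by rewrite gt_eqF.
have -> : phase T (delta_mx 0 i) t = pi *+ 2 * t 0 i / T 0 i.
  rewrite /phase (bigD1 i)//= big1 ?addr0 => [|j ji]; rewrite /freq mxE eqxx /=.
    by rewrite eqxx mulr1 mulrAC.
  by rewrite (negbTE ji) mulr0 !mul0r.
set a := pi * (t 0 i - r) / T 0 i; set b := pi * (T 0 i - t 0 i) / T 0 i.
rewrite (_ : _ + - (pi * (T 0 i + r) / T 0 i) = a - b); last by rewrite /a /b; field.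
rewrite (_ : pi * (T 0 i - r) / T 0 i = a + b); last by rewrite /a /b; field.
by rewrite cosB cosD; field.
Qed.

Lemma bump_bound i r t : -1 <= bump_fun i r t <= 1.
Proof.
rewrite -ler_norml normrM -[leRHS]mulr1; apply: ler_pM => //; exact: sin_max.
Qed.

(** For these [r] both angles lie between [- pi] and [pi], where the sine is nonnegative or
    nonpositive according to the sign of the angle; the second sine vanishes at the far face. *)
Lemma bump_gt0 i r t : box T t -> 0 <= r < T 0 i ->
  (0 < bump_fun i r t) = (r < t 0 i) && (t 0 i != T 0 i).
Proof.
move=> tT /andP[r0 rT]; have /andP[t0 tTi] := tT i; have Ti0 := T0 i.
have [tTe|tneq] := eqVneq (t 0 i) (T 0 i).
  by rewrite /bump_fun tTe subrr mulr0 mul0r sin0 mulr0 ltxx andbF.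
have tlt : t 0 i < T 0 i by rewrite lt_neqAle tneq.
rewrite andbT /bump_fun.
have [rt|tr] := ltP r (t 0 i).
  rewrite mulr_gt0//; apply: sin_gt0_slope => //; lra.
apply/negbTE; rewrite -leNgt -oppr_ge0 -mulNr -sinN.
have angle x : 0 <= x <= T 0 i -> 0 <= sin (pi * x / T 0 i).
  move=> /andP[x0 xT]; apply: sin_ge0_pi.
  rewrite divr_ge0 ?mulr_ge0 ?pi_ge0 ?(ltW Ti0)//=.
  by rewrite -mulrA ger_pMr ?pi_gt0// ler_pdivrMr// mul1r.
rewrite (_ : - (pi * _ / _) = pi * (r - t 0 i) / T 0 i); last by ring.
by rewrite mulr_ge0// angle//; lra.
Qed.

Local Notation perp_on := (perp_on T w).

Lemma eq_perp_on A B : measurable B -> box T `&` A = box T `&` B -> perp_on A -> perp_on B.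
Proof. by move=> mB AB [mA hA]; split => // g tg; rewrite -AB hA. Qed.

(** A bound below 0 cuts nothing off the box and one from [T 0 i] on cuts everything off. In
    between, positivity of the bump describes the half-space up to the far face, which is a null
    set. *)
Lemma perp_on_ray A i x : perp_on A -> perp_on (A `&` [set t | (x < (t 0 i)%:E)%E]).
Proof.
move=> pA; have [mA hA] := pA.
have mray : measurable [set t : 'rV[R]_p | (x < (t 0 i)%:E)%E].
  rewrite (_ : [set t | _] = upper_orthant (fun j => if j == i then x else -oo%E)).
    exact: measurable_upper_orthant.
  apply/seteqP; split => t /= h; last by have := h i; rewrite eqxx.
  by move=> j; case: eqP => [->//|_]; exact: ltNyr.
have mAr := measurableI _ _ mA mray.
have empty_case : box T `&` (A `&` [set t : 'rV[R]_p | (x < (t 0 i)%:E)%E]) = set0 ->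
    perp_on (A `&` [set t | (x < (t 0 i)%:E)%E]).
  by move=> e; split => // g tg; rewrite e Rintegral_set0.
case: x mray mAr empty_case => [r| |] mray mAr empty_case.
- have [r0|r0] := ltP r 0.
    apply: eq_perp_on pA => //; apply/seteqP; split => t [tT]; last by case.
    move=> At; split => //; split => //=; rewrite lte_fin.
    by have /andP[t0 _] := tT i; exact: lt_le_trans t0.
  have [Tr|rT] := leP (T 0 i) r.
    apply: empty_case; apply/seteqP; split => // t [tT [_ /=]]; rewrite lte_fin => rt.
    by have /andP[_ tTi] := tT i; have := lt_le_trans rt (le_trans tTi Tr); rewrite ltxx.
  have [mB hB] := perp_on_pos iw (trigp_bump i r) (fun t _ => bump_bound i r t) pA.
  split => // g tg; rewrite -[RHS](hB _ tg) /Rintegral; congr fine.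
  pose N := [set t : rV_leb R p | t 0 i = T 0 i].
  have mN : measurable N.
    apply: measurable_rV_leb; rewrite (_ : N = rV_coord i @^-1` [set T 0 i])//.
    by rewrite -[X in measurable X]setTI; exact: measurable_rV_coord.
  have mD : measurable (box T `&` (A `&` [set t : 'rV[R]_p | (r%:E < (t 0 i)%:E)%E]) : set (rV_leb R p)).
    by apply: measurableI => //; exact: measurable_rV_leb.
  rewrite (negligible_integral mN mD _ (lebesgue_hyperplane i (T 0 i))); last first.
    exact: (integrable_mul_trigp iw tg (measurable_rV_leb mAr)).
  congr (integral _ _ _); apply/seteqP; split => t /=.
    move=> [[tT [At rt]] Nt]; split => //; split => //=.
    by rewrite bump_gt0 ?r0//= -lte_fin rt; apply/eqP.
  move=> [tT [At]]; rewrite /= bump_gt0 ?r0// => /andP[rt /eqP tN].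
  by split => //; split => //; split.
- by apply: empty_case; apply/seteqP; split => // t [_ []].
- apply: eq_perp_on pA => //; apply/seteqP; split => t [tT]; last by case.
  by move=> At; split => //; split => //=; exact: ltNyr.
Qed.

Lemma perp_on_orthant x : perp_on (upper_orthant x).
Proof.
have : perp_on (\big[setI/setT]_(i < p) [set t : 'rV[R]_p | (x i < (t 0 i)%:E)%E]).
  elim: (index_enum _) => [|i s IHs].
    by rewrite big_nil; split => // g tg; rewrite setIT; exact: w_perp.
  by rewrite big_cons setIC; exact: perp_on_ray.
congr perp_on; apply/seteqP; split => [t tT i|t tT].
  by move: tT; rewrite (bigD1 i)//= => -[].
by elim/big_ind : _ => // i _; exact: tT.
Qed.

(** Dynkin's theorem: testing against the constant 1 gives the orthants, and complements and
    disjoint unions follow from integrability of [w]. *)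
Lemma integral_borel_eq0 (S : set 'rV[R]_p) : measurable S ->
  (\int[lebesgue_rV p]_(t in box T `&` S) (w t)%:E = 0)%E.
Proof.
have iwS A : measurable (A : set 'rV[R]_p) ->
    (lebesgue_rV p).-integrable (box T `&` A) (EFin \o w).
  move=> /measurable_rV_leb mA.
  by apply: (integrableS mbox (measurableI _ _ mbox mA) (@subIsetl _ _ _)).
have orth1 A : perp_on A -> (\int[lebesgue_rV p]_(t in box T `&` A) (w t)%:E = 0)%E.
  move=> [mA /(_ _ (trigp_cst T 1))]; rewrite /Rintegral => h.
  have mD := measurableI _ _ mbox (measurable_rV_leb mA).
  rewrite -[LHS](fineK (integrable_fin_num mD (iwS _ mA))) -[RHS]/(0%:E) -h.
  by congr ((fine _)%:E); apply: eq_integral => t _; rewrite mulr1.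
have intT : (\int[lebesgue_rV p]_(t in box T) (w t)%:E = 0)%E.
  rewrite -[box T]setIT; apply: orth1; split => // g tg.
  by rewrite setIT; exact: w_perp.
rewrite measurable_rV_orthantE.
apply: (@dynkin_induction _ _ (range upper_orthant)
  (fun S => (\int[lebesgue_rV p]_(t in box T `&` S) (w t)%:E = 0)%E)).
- exact: measurable_rV_orthantE.
- move=> _ _ [x _ <-] [y _ <-]; exists (fun i => maxe (x i) (y i)) => //.
  apply/seteqP; split => t /=.
    by move=> h; split => i; have := h i; rewrite gt_max => /andP[].
  by move=> [hx hy] i; rewrite gt_max hx hy.
- by rewrite setIT.
- by move=> _ [x _ <-]; apply: orth1; exact: perp_on_orthant.
- move=> A mA A0; have mAl := measurable_rV_leb mA.
  have mD := measurableI _ _ mbox mAl.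
  have mD' := measurableI _ _ mbox (measurableC mAl).
  have : (\int[lebesgue_rV p]_(t in (box T `&` A) `|` (box T `&` ~` A)) (w t)%:E = 0)%E.
    by rewrite -setIUr setUv setIT.
  rewrite (integral_setU (lebesgue_rV p) mD mD'); first by rewrite A0 add0e.
  + by rewrite -setIUr setUv setIT; case/integrableP : iw.
  + by apply/disj_setPS => t [[_ At] [_ nAt]].
- move=> F mF tF F0; rewrite setI_bigcupr integral_bigcup.
  + by apply: eseries0 => i _ _; exact: F0.
  + by apply: trivIset_setIl.
  + by move=> k; apply: measurableI => //; exact: measurable_rV_leb.
  + by rewrite -setI_bigcupr; apply: iwS; exact: bigcupT_measurable.
Qed.

(** A Lebesgue measurable subset of the box differs from its Borel hull by a null set, so [w] has
    integral 0 on every such subset. *)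
Theorem trigp_total : {ae lebesgue_rV p, forall t, box T t -> w t = 0}.
Proof.
have : ae_eq (lebesgue_rV p) (box T) (EFin \o w) (cst 0%E).
  apply: integral_ae_eq => // E ET mE; rewrite integral0.
  have Eoo : (lebesgue_rV p E < +oo)%E.
    apply: le_lt_trans (lebesgue_box_lty T).
    by apply: le_measure; rewrite ?inE.
  have [B [mB EB BE0]] := borel_hull mE Eoo.
  have mBl := measurable_rV_leb mB.
  rewrite -(integral_borel_eq0 mB).
  have mTB := measurableI _ _ mbox mBl.
  rewrite [RHS](negligible_integral (measurableD mBl mE) mTB _ BE0)/=; last first.
    by apply: (integrableS mbox mTB (@subIsetl _ _ _)).
  congr (integral _ _ _); apply/seteqP; split => t.
    by move=> Et; split; [split; [exact: ET|exact: EB]|case].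
  by move=> [[tT Bt] nBE]; apply: contrapT => nEt; exact: nBE.
by apply: filterS => t h tT; have [] := h tT.
Qed.

End totality.

(** * Approximation by trigonometric polynomials *)

Section integration_by_parts_on_the_box.
Context {R : realType} {p : nat}.
Variable T : 'rV[R]_p.
Hypothesis T0 : forall i, 0 < T 0 i.
Implicit Types f g u : 'rV[R]_p -> R.

Lemma C1_alongM i f g : C1_along i f -> C1_along i g ->
  C1_along i (f * g) /\ partial i (f * g) = f * partial i g + g * partial i f.
Proof.
move=> [cf df cdf] [cg dg cdg].
have e : partial i (f * g) = f * partial i g + g * partial i f.
  by apply/funext => t; rewrite /partial deriveM.
split; last by [].
split; first by move=> t; exact: (cvgM (cf t) (cg t)).
  by move=> t; exact: derivableM.
by rewrite e => t; exact: (cvgD (cvgM (cf t) (cdg t)) (cvgM (cg t) (cdf t))).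
Qed.

Lemma Rintegral_by_parts i f g : C1_along i f -> C1_along i g ->
  (forall t, f (t + T 0 i *: basis_vec i) = f t) ->
  (forall t, g (t + T 0 i *: basis_vec i) = g t) ->
  \int[lebesgue_rV p]_(t in box T) (f t * partial i g t) =
  - \int[lebesgue_rV p]_(t in box T) (partial i f t * g t).
Proof.
move=> Cf Cg pf pg; have [Cfg dfg] := C1_alongM Cf Cg.
have [cf _ cdf] := Cf; have [cg _ cdg] := Cg.
have mB := measurable_rV_leb (measurable_box T).
have : \int[lebesgue_rV p]_(t in box T) partial i (f * g) t = 0.
  (* The periodic lemma is stated in positive dimension; in dimension 0 there is no index [i]. *)
  case: p T i f g T0 Cfg pf pg {cf cdf cg cdg mB Cf Cg dfg} => [|q] T' i f g T0' Cfg pf pg.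
    by case: i {Cfg pf pg}.
  apply: Rintegral_partial_periodic Cfg _ => // t.
  by rewrite -[LHS]/(_ * _) pf pg.
rewrite dfg (RintegralD mB).
- rewrite [X in _ + X](_ : _ = \int[lebesgue_rV p]_(t in box T) (partial i f t * g t)).
    by move/eqP; rewrite addr_eq0 => /eqP.
  by apply: eq_Rintegral => t _; rewrite mulrC.
- by apply: (continuous_box_integrable T) => t; exact: (cvgM (cf t) (cdg t)).
- by apply: (continuous_box_integrable T) => t; exact: (cvgM (cg t) (cdf t)).
Qed.

Local Notation sq := (sqint (lebesgue_rV p) (box T)).
Local Notation ip := (ip (lebesgue_rV p) (box T)).

Lemma continuous_sqint f : continuous f -> sq f.
Proof.
move=> cf; split.
  apply: measurable_fun_rV_leb; first exact: measurable_box.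
  by apply: measurable_funTS; exact: continuous_measurable_rV.
apply: (continuous_box_integrable T (f := fun t => f t ^+ 2)) => t.
by apply: (@cvg_comp _ _ _ f (fun x => x ^+ 2) _ _ _ (cf t)); exact: exprn_continuous.
Qed.

Lemma trigp_sqint f : trigp T f -> sq f.
Proof. by move=> /trigp_continuous; exact: continuous_sqint. Qed.

Lemma ip_partial i f g : trigp T f -> trigp T g ->
  ip f (partial i g) = - ip (partial i f) g.
Proof.
move=> tf tg; have Ti : T 0 i != 0 by rewrite gt_eqF.
by rewrite !ipE; apply: (Rintegral_by_parts (trigp_C1 i tf) (trigp_C1 i tg)) => t; exact: trigp_periodic.
Qed.

Definition lap f : 'rV[R]_p -> R := \sum_i partial i (partial i f).

Lemma trigp_sum (I : Type) (s : seq I) (P : pred I) (F : I -> 'rV[R]_p -> R) :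
  (forall i, trigp T (F i)) -> trigp T (\sum_(i <- s | P i) F i).
Proof.
move=> tF; elim/big_ind : _ => //; [exact: trigp_cst T 0|exact: trigpD].
Qed.

Lemma trigp_lap f : trigp T f -> trigp T (lap f).
Proof. by move=> tf; apply: trigp_sum => i; do 2 apply: trigp_partial. Qed.

Lemma lapD f g : trigp T f -> trigp T g -> lap (f + g) = lap f + lap g.
Proof.
move=> tf tg; rewrite /lap -big_split; apply: eq_bigr => i _.
by rewrite (partialD i tf tg) (partialD i (trigp_partial i tf) (trigp_partial i tg)).
Qed.

Lemma lapZ a f : trigp T f -> lap (a *: f) = a *: lap f.
Proof.
move=> tf; rewrite /lap scaler_sumr; apply: eq_bigr => i _.
by rewrite (partialZ i a tf) (partialZ i a (trigp_partial i tf)).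
Qed.

Lemma lapB f g : trigp T f -> trigp T g -> lap (f - g) = lap f - lap g.
Proof.
move=> tf tg; rewrite -scaleN1r lapD//; last exact: trigpZ.
by rewrite lapZ// scaleN1r.
Qed.

Lemma partial_sum i (I : Type) (s : seq I) (F : I -> 'rV[R]_p -> R) :
  (forall k, trigp T (F k)) ->
  partial i (\sum_(k <- s) F k) = \sum_(k <- s) partial i (F k).
Proof.
move=> tF; elim: s => [|k s IHs]; first by rewrite !big_nil; exact: partial_cst0.
by rewrite !big_cons (partialD i (tF k) (trigp_sum _ _ tF)) IHs.
Qed.

Lemma lap_partial k f : trigp T f -> lap (partial k f) = partial k (lap f).
Proof.
move=> tf; rewrite /lap partial_sum; last by move=> i; do 2 apply: trigp_partial.
apply: eq_bigr => i _.
by rewrite (partialC i k tf) (partialC i k (trigp_partial i tf)).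
Qed.

Lemma lap_wave m c : lap (wave T m c) = (- \sum_i freq T m i ^+ 2) *: wave T m c.
Proof.
rewrite scaleNr scaler_suml -sumrN /lap; apply: eq_bigr => i _.
rewrite partial_wave (partialZ i _ (trigp_wave T m _)) partial_wave scalerA -expr2.
rewrite -scalerN; congr (_ *: _); apply/funext => t.
rewrite -[RHS]/(- wave T m c t) /wave -(addrA c).
by rewrite -splitr addrA cosDpi.
Qed.

Lemma sqint_sum (I : Type) (s : seq I) (P : pred I) (F : I -> 'rV[R]_p -> R) :
  (forall i, sq (F i)) -> sq (\sum_(i <- s | P i) F i).
Proof.
move=> sF; elim/big_ind : _ => //; first exact: (trigp_sqint (trigp_cst T 0)).
by move=> ? ? ? ?; apply: sqintD => //; apply: measurable_rV_leb; exact: measurable_box.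
Qed.

Let mbox : measurable (box T : set (rV_leb R p)) := measurable_rV_leb (measurable_box T).

Lemma ip_suml (I : Type) (s : seq I) (F : I -> 'rV[R]_p -> R) g :
  (forall i, sq (F i)) -> sq g -> ip (\sum_(i <- s) F i) g = \sum_(i <- s) ip (F i) g.
Proof.
move=> sF sg; elim: s => [|i s IHs].
  rewrite !big_nil ipE; transitivity (\int[lebesgue_rV p]_(t in box T) (0 : R)).
    by apply: eq_Rintegral => t _; rewrite mul0r.
  by rewrite (Rintegral_cst (lebesgue_rV p) mbox 0) mul0r.
by rewrite !big_cons (ipDl mbox (sF i) (sqint_sum _ _ sF) sg) IHs.
Qed.

Lemma ip_lapE f g : trigp T f -> trigp T g ->
  ip (lap f) g = \sum_i ip (partial i (partial i f)) g.
Proof.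
move=> tf tg; apply: (@ip_suml _ _ (fun i => partial i (partial i f))).
  by move=> i; apply: trigp_sqint; do 2 apply: trigp_partial.
exact: trigp_sqint.
Qed.

Lemma oppr_ipC f g : - ip f g = - ip g f.
Proof. by rewrite ipC. Qed.

Lemma ip_partial2 i f g : trigp T f -> trigp T g ->
  ip (partial i (partial i f)) g = - ip (partial i f) (partial i g).
Proof.
move=> tf tg; rewrite ipC; apply: (etrans (ip_partial i tg (trigp_partial i tf))).
exact: oppr_ipC.
Qed.

Lemma ip_lap f g : trigp T f -> trigp T g -> ip (lap f) g = ip f (lap g).
Proof.
move=> tf tg; apply: (etrans (ip_lapE tf tg)); apply/esym.
rewrite ipC; apply: (etrans (ip_lapE tg tf)); apply: eq_bigr => i _.
apply: (etrans (ip_partial2 i tg tf)); apply/esym.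
by apply: (etrans (ip_partial2 i tf tg)); exact: oppr_ipC.
Qed.

Lemma sum_ip_partial f : trigp T f ->
  \sum_i ip (partial i f) (partial i f) = - ip f (lap f).
Proof.
move=> tf; apply/esym; rewrite oppr_ipC (ip_lapE tf tf) -sumrN; apply: eq_bigr => i _.
by rewrite (ip_partial2 i tf tf) opprK.
Qed.

(** The squared norms of all first partials add up to [- ip f (lap f)], and nonnegativity of the
    squared norm of [f + lap f] bounds this by the right-hand side. *)
Lemma ip_partial_le i f : trigp T f ->
  ip (partial i f) (partial i f) <= ip f f + ip (lap f) (lap f).
Proof.
move=> tf; have := sum_ip_partial tf; rewrite (bigD1 i)//= => h.
have h0 : 0 <= \sum_(j < p | j != i) ip (partial j f) (partial j f).
  by apply: sumr_ge0 => j _; exact: ip_ge0.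
have sf := trigp_sqint tf; have sl := trigp_sqint (trigp_lap tf).
have hq := ip_ge0 (lebesgue_rV p) (box T) (f + lap f).
move: hq; rewrite (ipDl mbox sf sl (sqintD mbox sf sl)).
rewrite (ipC (lebesgue_rV p) (box T) f (f + lap f)) (ipC (lebesgue_rV p) (box T) (lap f) (f + lap f)).
rewrite (ipDl mbox sf sl sf) (ipDl mbox sf sl sl) (ipC (lebesgue_rV p) (box T) (lap f) f).
have := ip_ge0 (lebesgue_rV p) (box T) f.
have := ip_ge0 (lebesgue_rV p) (box T) (lap f).
move: h0 h; move: (\sum_(j < p | _) _) (ip (partial i f) _) (ip f f) (ip f (lap f)) (ip (lap f) (lap f)).
by move=> a b c d e; lra.
Qed.

(** This is [sum_ip_partial] for [partial k f]: the Laplacian commutes with [partial k], which one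
    more integration by parts moves back. Summing over [k] gives equal L^2 norms to the Hessian and
    the Laplacian. *)
Lemma sum_ip_partial2_row k f : trigp T f ->
  \sum_l ip (partial l (partial k f)) (partial l (partial k f)) =
    ip (partial k (partial k f)) (lap f).
Proof.
move=> tf; have e := ip_partial2 k tf (trigp_lap tf).
have := sum_ip_partial (trigp_partial k tf).
rewrite (lap_partial k tf) => ->.
by rewrite e.
Qed.

Lemma sum_ip_partial2 f : trigp T f ->
  \sum_k \sum_l ip (partial l (partial k f)) (partial l (partial k f)) =
  ip (lap f) (lap f).
Proof.
move=> tf; apply: (etrans _ (esym (ip_lapE tf (trigp_lap tf)))).
by apply: eq_bigr => k _; apply: sum_ip_partial2_row.
Qed.

Lemma le_double_sum (q : 'I_p -> 'I_p -> R) j i : (forall k l, 0 <= q k l) ->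
  q j i <= \sum_k \sum_l q k l.
Proof.
move=> q0; rewrite (bigD1 j)//= (bigD1 i)//= -addrA lerDl addr_ge0//.
  by apply: sumr_ge0.
by apply: sumr_ge0 => k _; apply: sumr_ge0.
Qed.

Lemma ip_partial2_le i j f : trigp T f ->
  ip (partial i (partial j f)) (partial i (partial j f)) <= ip (lap f) (lap f).
Proof.
move=> tf; rewrite -[leRHS](sum_ip_partial2 tf).
apply: (@le_double_sum (fun k l => ip (partial l (partial k f)) (partial l (partial k f)))).
by move=> k l; exact: ip_ge0.
Qed.

End integration_by_parts_on_the_box.

#[global] Instance lebesgue_rV_ae_filter (R : realType) p :
  Filter (nbhs (almost_everywhere (@lebesgue_rV R p))).
Proof. exact: ae_filter_ringOfSetsType. Qed.

(** * Approximation in the graph norm of the Laplacian *)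

Section periodic_approximation.
Context {R : realType} {p : nat}.
Variable T : 'rV[R]_p.
Hypothesis T0 : forall i, 0 < T 0 i.
Implicit Types f g u : 'rV[R]_p -> R.
Let mbox : measurable (box T : set (rV_leb R p)) := measurable_rV_leb (measurable_box T).
Local Notation sq := (sqint (lebesgue_rV p) (box T)).
Local Notation ip := (ip (lebesgue_rV p) (box T)).
Local Notation cvgL2 := (cvgL2 (lebesgue_rV p) (box T)).
Local Notation cauchyL2 := (cauchyL2 (lebesgue_rV p) (box T)).

Lemma ae_eq_trigp u w : sq u -> sq w ->
  (forall g, trigp T g -> ip u g = ip w g) ->
  {ae lebesgue_rV p, forall t, box T t -> u t = w t}.
Proof.
move=> su sw h; have suw := sqintB mbox su sw.
have i1 : (lebesgue_rV p).-integrable (box T) (EFin \o (u - w)).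
  have := sqint_mul mbox suw (trigp_sqint (trigp_cst T 1)).
  by apply: eq_integrable => // t _; rewrite /= mulr1.
have perp g : trigp T g -> \int[lebesgue_rV p]_(t in box T) ((u - w) t * g t) = 0.
  move=> tg; rewrite -ipE (ipBl mbox su sw (trigp_sqint tg)) h// subrr //.
have := trigp_total T0 i1 perp; apply: filterS => t uw tT.
by apply/eqP; rewrite -subr_eq0; apply/eqP; exact: uw.
Qed.

Lemma cauchy_rate (a : nat -> nat -> R) :
  (forall k l, a k l <= 2 / k.+1%:R + 2 / l.+1%:R) ->
  forall e, 0 < e -> exists N, forall k l, (N <= k)%N -> (N <= l)%N -> a k l <= e.
Proof.
move=> ha e e0; pose N := Num.truncn (4 / e); exists N.
have N1 : 2 / N.+1%:R <= e / 2.
  rewrite ler_pdivrMr// mulrAC ler_pdivlMr//.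
  have := truncnS_gt (4 / e); rewrite -/N ltr_pdivrMr// => /ltW.
  by rewrite mulrC; lra.
have Nk k : (N <= k)%N -> 2 / k.+1%:R <= e / 2.
  by move=> Nk; apply: le_trans N1; rewrite ler_wpM2l// lef_pV2 ?posrE// ler_nat ltnS.
by move=> k l /Nk hk /Nk hl; rewrite (le_trans (ha k l))// (splitr e) lerD.
Qed.

(** The hypothesis says that [f] is the Laplacian of [u] in the weak sense. Near-projections of
    [(u, f)] on the graph are Cauchy in both components; totality identifies the limit of the first
    one with [u], while a Cauchy second component already controls all second partials. *)
Theorem trigp_H2_dense u f : sq u -> sq f ->
  (forall g, trigp T g -> ip u (lap g) = ip f g) ->
  exists v : nat -> 'rV[R]_p -> R,
  [/\ forall k, trigp T (v k), cvgL2 v u & cauchyL2 (fun k => lap (v k))].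
Proof.
move=> su sf weak.
(* The graph of the Laplacian, inside [L^2 x L^2]. *)
pose V := (('rV[R]_p -> R) * ('rV[R]_p -> R))%type : lmodType R.
pose P (x : V) := sq x.1 /\ sq x.2.
pose B (x y : V) : R := ip x.1 y.1 + ip x.2 y.2.
pose S (x : V) := trigp T x.1 /\ x.2 = lap x.1.
have PD x y : P x -> P y -> P (x + y).
  by move=> [x1 x2] [y1 y2]; split; exact: sqintD.
have PZ a x : P x -> P (a *: x) by move=> [x1 x2]; split; exact: sqintZ.
have Bsym x y : B x y = B y x by rewrite /B ipC (ipC (lebesgue_rV p) (box T) x.2).
have BD x y z : P x -> P y -> P z -> B (x + y) z = B x z + B y z.
  move=> [x1 x2] [y1 y2] [z1 z2]; rewrite /B /=.
  by rewrite (ipDl mbox x1 y1 z1) (ipDl mbox x2 y2 z2) addrACA.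
have BZ a x y : P x -> P y -> B (a *: x) y = a * B x y.
  move=> [x1 x2] [y1 y2]; rewrite /B /=.
  by rewrite (ipZl mbox a x1 y1) (ipZl mbox a x2 y2) mulrDr.
have Bge0 x : P x -> 0 <= B x x by move=> _; rewrite addr_ge0 ?ip_ge0.
have SP x : S x -> P x.
  by case: x => x y [/= tx ->]; split; apply: trigp_sqint => //; exact: trigp_lap.
have S0 : S 0.
  split; first exact: (trigp_cst T 0).
  have := lapZ 0 (trigp_cst T 0); rewrite !scale0r => e.
  exact: esym e.
have SD x y : S x -> S y -> S (x + y).
  move=> [tx ex] [ty ey]; split; first exact: trigpD.
  by rewrite /= ex ey (lapD tx ty).
have SZ a x : S x -> S (a *: x).
  by move=> [tx ex]; split; [exact: trigpZ|rewrite /= ex (lapZ a tx)].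
have Puf : P (u, f) by [].
have [s [Ss cs ps]] := near_projection PD PZ Bsym BD BZ Bge0 SP S0 SD SZ Puf.
pose v k := (s k).1; have tv k : trigp T (v k) by case: (Ss k).
have sv k := trigp_sqint (tv k); have slv k := trigp_sqint (trigp_lap (tv k)).
have es k : (s k).2 = lap (v k) by case: (Ss k).
have cv : cauchyL2 v.
  apply: (@cauchy_rate (fun k l => ip (v k - v l) (v k - v l))) => k l.
  by apply: le_trans (cs k l); rewrite lerDl ip_ge0.
have clv : cauchyL2 (fun k => lap (v k)).
  apply: (@cauchy_rate (fun k l => ip (lap (v k) - lap (v l)) (lap (v k) - lap (v l)))) => k l.
  by apply: le_trans (cs k l); rewrite -!es lerDr ip_ge0.
have [ub [sub cub]] := L2_complete mbox sv cv.
exists v; split => //; apply: (eq_cvgL2 mbox sv sub su _ cub).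
apply: ae_eq_trigp => // g.
(* As [phi] is an eigenfunction, asymptotic orthogonality of [(u, f) - s k] to
   [(phi, lap phi)] reads [(1 + lam ^ 2) (ip u phi - ip (v k) phi) -> 0]. *)
suff wave_eq m c : ip ub (wave T m c) = ip u (wave T m c).
  elim => [|a m c h th IH].
    by rewrite !(ipC (lebesgue_rV p) (box T) _ (cst 0)) -[cst 0](scale0r u) !(ipZl mbox) ?mul0r.
  have sw := trigp_sqint (trigp_wave T m c); have sh := trigp_sqint th.
  have saw := sqintZ mbox a sw.
  rewrite ipC (ipDl mbox saw sh sub) (ipZl mbox a sw sub).
  rewrite [RHS]ipC (ipDl mbox saw sh su) (ipZl mbox a sw su).
  by rewrite ipC wave_eq (ipC (lebesgue_rV p) (box T) h) IH ipC (ipC (lebesgue_rV p) (box T) u h).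
set phi := wave T m c; have tphi : trigp T phi by exact: trigp_wave.
have sphi := trigp_sqint tphi.
pose lam := \sum_i freq T m i ^+ 2.
have lam0 : 0 <= lam by apply: sumr_ge0 => i _; exact: sqr_ge0.
have lapphi : lap phi = (- lam) *: phi by exact: lap_wave.
have slphi := trigp_sqint (trigp_lap tphi).
have Bphi k : B ((u, f) - s k) (phi, lap phi) = (1 + lam ^+ 2) * (ip u phi - ip (v k) phi).
  rewrite /B /= es (ipBl mbox su (sv k) sphi) (ipBl mbox sf (slv k) slphi).
  have e x : sq x -> ip x (lap phi) = - lam * ip x phi.
    by move=> sx; rewrite ipC lapphi (ipZl mbox _ sphi sx) ipC.
  rewrite (e _ sf) (e _ (slv k)) -(weak _ tphi) (ip_lap T0 (tv k) tphi).
  by rewrite (e _ su) (e _ (sv k)); ring.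
have cphi := cvgL2_ip mbox sv sub sphi cub.
have : ip u phi - ip (v k) phi @[k --> \oo] --> (0 : R).
  have lim0 : (B (phi, lap phi) (phi, lap phi) * k.+1%:R^-1) @[k --> \oo] --> (0 : R).
    rewrite -(mulr0 (B (phi, lap phi) (phi, lap phi))).
    by apply: cvgM; [exact: cvg_cst|exact: cvg_harmonic].
  apply/cvgrPdist_le => e e0.
  have /cvgrPdist_le/(_ (e ^+ 2) (exprn_gt0 2 e0)) := lim0.
  apply: filterS => k; rewrite !sub0r !normrN => /(le_trans (ler_norm _)) hk.
  have Sphi : S (phi, lap phi) by split; [exact: tphi|exact: erefl].
  have := le_trans (ps k _ Sphi) hk; rewrite Bphi => h.
  rewrite -ler_sqr ?nnegrE// ?(ltW e0)// real_normK ?num_real//.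
  (* The factor [1 + lam ^+ 2] is at least 1 and may be dropped. *)
  apply: le_trans h; rewrite exprMn ler_peMl ?sqr_ge0// exprn_ege1//.
  by rewrite lerDl sqr_ge0.
have : ip u phi - ip (v k) phi @[k --> \oo] --> ip u phi - ip ub phi.
  by apply: cvgB => //; exact: cvg_cst.
move=> /cvg_unique h /h => /(_ (@Rhausdorff R)) /eqP; rewrite subr_eq0 => /eqP.
by [].
Qed.

End periodic_approximation.

Section euclidean_norm.
Context {R : realType} {n : nat}.
Implicit Types x : 'rV[R]_n.

Lemma dot_ge0 x : 0 <= dot x x.
Proof. by apply: sumr_ge0 => j _; rewrite -expr2 sqr_ge0. Qed.

Lemma sqr_enorm x : enorm x ^+ 2 = dot x x.
Proof. by rewrite sqr_sqrtr ?dot_ge0. Qed.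

Lemma enorm_sqrE x : enorm x ^+ 2 = \sum_j x 0 j ^+ 2.
Proof. by rewrite sqr_enorm; apply: eq_bigr => j _; rewrite expr2. Qed.

Lemma le_coord_enorm x j : x 0 j ^+ 2 <= enorm x ^+ 2.
Proof.
rewrite enorm_sqrE (bigD1 j)//= lerDl; apply: sumr_ge0 => k _; exact: sqr_ge0.
Qed.

End euclidean_norm.

(** * Vector-valued L^2 functions, coordinate by coordinate *)

Section vector_valued.
Context d (X : measurableType d) (R : realType) (n : nat).
Variables (mu : {measure set X -> \bar R}) (D : set X) (mD : measurable D).
Implicit Types (u v w : X -> 'rV[R]_n).

Definition coordf u (j : 'I_n) : X -> R := fun t => u t 0 j.

Local Notation sq := (sqint mu D).
Local Notation ip := (ip mu D).

Lemma measurable_sqr_enorm u : (forall j, measurable_fun D (coordf u j)) ->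
  measurable_fun D (fun t => (enorm (u t) ^+ 2)%:E).
Proof.
move=> mu_; apply/measurable_EFinP; under eq_fun do rewrite enorm_sqrE.
by apply: measurable_sum => j; apply: measurable_funX; exact: mu_.
Qed.

Lemma sqint_coordP u :
  ((forall j, measurable_fun D (coordf u j)) /\
   (\int[mu]_(t in D) (enorm (u t) ^+ 2)%:E < +oo)%E) <->
  (forall j, sq (coordf u j)).
Proof.
split=> [[mu_ iu] j|su].
  apply/sqint_ltyP; first exact: mu_.
  apply: le_lt_trans iu; apply: ge0_le_integral => //.
  - by move=> t _; rewrite lee_fin sqr_ge0.
  - by apply/measurable_EFinP; apply: measurable_funX; exact: mu_.
  - exact: measurable_sqr_enorm.
  - by move=> t _; rewrite lee_fin le_coord_enorm.
have mu_ j : measurable_fun D (coordf u j) by case: (su j).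
split => //; rewrite (eq_integral (fun t => \sum_j (coordf u j t ^+ 2)%:E)%E); last first.
  by move=> t _; rewrite enorm_sqrE sumEFin.
rewrite ge0_integral_sum//.
- by apply: lte_sum_pinfty => j _; apply/sqint_ltyP.
- by move=> j; apply/measurable_EFinP; apply: measurable_funX; exact: mu_.
- by move=> j t _; rewrite lee_fin sqr_ge0.
Qed.

Lemma integrable_dot_coord u v : (forall j, sq (coordf u j)) -> (forall j, sq (coordf v j)) ->
  mu.-integrable D (fun t => (dot (u t) (v t))%:E).
Proof.
move=> su sv.
have := @integrable_sum _ _ _ mu D mD _ (index_enum 'I_n) xpredT
  (fun j t => (coordf u j t * coordf v j t)%:E) (fun j _ => sqint_mul mD (su j) (sv j)).
by apply: eq_integrable => // t _; rewrite sumEFin.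
Qed.

Lemma Rintegral_dot_coord u v : (forall j, sq (coordf u j)) -> (forall j, sq (coordf v j)) ->
  \int[mu]_(t in D) dot (u t) (v t) = \sum_j ip (coordf u j) (coordf v j).
Proof.
move=> su sv; rewrite /Rintegral.
rewrite (eq_integral (fun t => \sum_j (coordf u j t * coordf v j t)%:E)%E); last first.
  by move=> t _; rewrite sumEFin.
rewrite integral_sum//; last by move=> j; exact: sqint_mul.
rewrite (eq_bigr (fun j => (ip (coordf u j) (coordf v j))%:E)) ?sumEFin// => j _.
by rewrite ipE /Rintegral fineK//; apply: integrable_fin_num => //; exact: sqint_mul.
Qed.

Lemma coordfD u v j : coordf (u + v) j = coordf u j + coordf v j.
Proof. by apply/funext => t; rewrite /coordf !fctE mxE. Qed.

Lemma coordfZ a u j : coordf (a *: u) j = a *: coordf u j.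
Proof. by apply/funext => t; rewrite /coordf !fctE mxE. Qed.

Lemma coordfB u v j : coordf (u - v) j = coordf u j - coordf v j.
Proof. by apply/funext => t; rewrite /coordf !fctE !mxE. Qed.

Lemma integral_sqr_enorm u : (forall j, sq (coordf u j)) ->
  (\int[mu]_(t in D) (enorm (u t) ^+ 2)%:E = (\sum_j ip (coordf u j) (coordf u j))%:E)%E.
Proof.
move=> su; rewrite -(Rintegral_dot_coord su su) /Rintegral fineK; last first.
  by apply: integrable_fin_num => //; exact: integrable_dot_coord.
by apply: eq_integral => t _; rewrite sqr_enorm.
Qed.

Lemma cvg_sqr_enorm (v : nat -> X -> 'rV[R]_n) w :
  (forall k j, sq (coordf (v k) j)) -> (forall j, sq (coordf w j)) ->
  (forall j, cvgL2 mu D (fun k => coordf (v k) j) (coordf w j)) ->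
  (\int[mu]_(t in D) (enorm (v k t - w t) ^+ 2)%:E)%E @[k --> \oo] --> 0%E.
Proof.
move=> sv sw vw.
have e k : (\int[mu]_(t in D) (enorm (v k t - w t) ^+ 2)%:E =
    (\sum_j ip (coordf (v k) j - coordf w j) (coordf (v k) j - coordf w j))%:E)%E.
  rewrite (integral_sqr_enorm (u := v k - w)); last first.
    by move=> j; rewrite coordfB; exact: sqintB.
  by under eq_bigr do rewrite coordfB.
under eq_fun do rewrite e.
have : \sum_j ip (coordf (v k) j - coordf w j) (coordf (v k) j - coordf w j) @[k --> \oo] -->
    \sum_(j < n) (0 : R).
  apply: (@cvg_big _ _ +%R 0 xpredT (@add_continuous R) _ \oo (index_enum 'I_n)
    (fun j k => ip (coordf (v k) j - coordf w j) (coordf (v k) j - coordf w j)) (fun=> 0)).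
  by move=> j _; exact: vw.
by rewrite big1// => h; apply: cvg_EFin h; exact: nearW.
Qed.

End vector_valued.

Section L2_functions.
Context {R : realType} {p n : nat}.
Variables (D : set 'rV[R]_p) (mD : measurable (D : set (rV_leb R p))).
Local Notation sq := (sqint (lebesgue_rV p) D).
Local Notation ip := (ip (lebesgue_rV p) D).
Local Notation coordf := (@coordf _ (rV_leb R p) R n).
Implicit Types u v w : 'rV[R]_p -> 'rV[R]_n.

Lemma L2_coord u : L2 D u <-> forall j, sq (coordf u j).
Proof. exact: sqint_coordP. Qed.

Lemma L2D u v : L2 D u -> L2 D v -> L2 D (u + v).
Proof.
by move=> /L2_coord su /L2_coord sv; apply/L2_coord => j; rewrite coordfD; exact: sqintD.
Qed.

Lemma L2Z a u : L2 D u -> L2 D (a *: u).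
Proof. by move=> /L2_coord su; apply/L2_coord => j; rewrite coordfZ; exact: sqintZ. Qed.

Lemma Rintegral_dot u v : L2 D u -> L2 D v ->
  \int[lebesgue_rV p]_(t in D) dot (u t) (v t) = \sum_j ip (coordf u j) (coordf v j).
Proof. by move=> /L2_coord su /L2_coord sv; exact: Rintegral_dot_coord. Qed.

Lemma integrable_dot u v : L2 D u -> L2 D v ->
  (lebesgue_rV p).-integrable D (fun t => (dot (u t) (v t))%:E).
Proof. by move=> /L2_coord su /L2_coord sv; exact: integrable_dot_coord. Qed.

Lemma cvg_L2_coord (v : nat -> 'rV[R]_p -> 'rV[R]_n) w :
  (forall k, L2 D (v k)) -> L2 D w ->
  (forall j, cvgL2 (lebesgue_rV p) D (fun k => coordf (v k) j) (coordf w j)) ->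
  cvg_L2 D v w.
Proof.
move=> Lv /L2_coord sw vw; apply: (cvg_sqr_enorm mD _ sw vw) => k.
by apply/L2_coord; exact: Lv.
Qed.

End L2_functions.

Section row_valued.
Context {R : realType} {p n : nat}.
Implicit Types f : 'I_n -> 'rV[R]_p -> R.
Local Notation coordf := (@coordf _ (rV_leb R p) R n).

Definition vrow f : 'rV[R]_p -> 'rV[R]_n := fun t => \row_j f j t.

Lemma coordf_vrow f j : coordf (vrow f) j = f j.
Proof. by apply/funext => t; rewrite /coordf mxE. Qed.

Lemma differentiable_vrow f t : (forall j, differentiable (f j) t) ->
  differentiable (vrow f) t.
Proof.
move=> df; rewrite (_ : vrow f = \sum_j (fun t => f j t *: delta_mx 0 j)).
  by apply: differentiable_sum => j; exact: differentiableZl.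
apply/funext => x; rewrite fct_sumE; apply/rowP => k.
rewrite mxE summxE (bigD1 k)//= big1 ?addr0 => [|j jk]; rewrite !mxE ?eqxx ?mulr1//=.
by rewrite eq_sym (negbTE jk) mulr0.
Qed.

Lemma partial_vrow i f : (forall j t, differentiable (f j) t) ->
  partial i (vrow f) = vrow (fun j => partial i (f j)).
Proof.
move=> df; apply/funext => t; rewrite /partial derive_mx.
  apply/rowP => j; rewrite [LHS]mxE [RHS]mxE.
  have e : (fun x : 'rV[R]_p => vrow f x 0 j) = f j.
    by apply/funext => x; rewrite mxE.
  by rewrite e.
by apply: diff_derivable; exact: differentiable_vrow.
Qed.

Lemma coordf_partial i (v : 'rV[R]_p -> 'rV[R]_n) j : (forall t, differentiable v t) ->
  coordf (partial i v) j = partial i (coordf v j : 'rV[R]_p -> R).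
Proof.
move=> dv; apply/funext => t; rewrite /coordf /partial derive_mx ?mxE//.
exact: diff_derivable.
Qed.

(** Rows of trigonometric polynomials are stable under every [partial i], so all iterated partials
    are again such rows. *)
Lemma smooth_vrow_trigp T f : (forall j, trigp T (f j)) -> smooth (vrow f).
Proof.
move=> tf s t.
have : exists2 g, forall j, trigp T (g j) & foldr (fun i g => partial i g) (vrow f) s = vrow g.
  elim: s => [|i s [g tg e]]; first by exists f.
  exists (fun j => partial i (g j)); first by move=> j; exact: trigp_partial.
  by rewrite /= e partial_vrow// => j x; exact: (trigp_differentiable _ (tg j)).
by move=> [g tg ->]; apply: differentiable_vrow => j; exact: (trigp_differentiable _ (tg j)).
Qed.

End row_valued.

(** * Traces *)

Section traces.
Context {R : realType} {p n : nat}.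
Variable T : 'rV[R]_p.+1.
Hypothesis T0 : forall i, 0 < T 0 i.
Let mbox : measurable (box T : set (rV_leb R p.+1)) := measurable_rV_leb (measurable_box T).
Local Notation sq := (sqint (lebesgue_rV p.+1) (box T)).
Local Notation fip i := (ip (lebesgue_rV p) (face_box T i)).
Local Notation ip := (ip (lebesgue_rV p.+1) (box T)).

Definition face_fun (i : 'I_p.+1) (h : 'rV[R]_p.+1 -> R) (y : 'rV[R]_p) : R := h (face_point i 0 y).

Let mface (i : 'I_p.+1) : measurable (face_box T i : set (rV_leb R p)) := measurable_rV_leb (measurable_face_box T i).

Lemma face_fun_sqint (i : 'I_p.+1) h : trigp T h ->
  sqint (lebesgue_rV p) (face_box T i) (face_fun i h).
Proof.
move=> th; rewrite face_boxE; apply: continuous_sqint => y.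
have cface : {for y, continuous (fun y : 'rV[R]_p => face_point i 0 y)}.
  apply: (@cvg_rV _ _ _ (nbhs y)) => k; rewrite mxE.
  rewrite (_ : (fun _ => _) = fun y : 'rV[R]_p => oapp (y 0) 0 (unlift i k)); last first.
    by apply/funext => x; rewrite mxE.
  by case: unlift => [j|]; [exact: coord_continuous|exact: cvg_cst].
have ch : {for (face_point i 0 y), continuous h} by exact: (trigp_continuous th).
exact: (@continuous_comp _ _ _ (fun y : 'rV[R]_p => face_point i 0 y : 'rV[R]_p.+1) h y cface ch).
Qed.

(** [face_trace_le] is applied to [h * h], whose partial is twice [h * partial i h] and thus at most
    the sum of the two squares. This gives the factor [1 + T 0 i], divided by the [T 0 i] on the
    left. *)
Lemma face_ip_le (i : 'I_p.+1) h : trigp T h ->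
  fip i (face_fun i h) (face_fun i h) <=
  ((1 + T 0 i) / T 0 i) * (ip h h + ip (partial i h) (partial i h)).
Proof.
move=> th; have td := trigp_partial i th.
have [Chh dhh] := C1_alongM (trigp_C1 i th) (trigp_C1 i th).
have Ti := T0 i.
have hh0 t : 0 <= (h * h) t by rewrite -[X in 0 <= X]/(h t * h t) -expr2 sqr_ge0.
have := face_trace_le (T0 i) Chh hh0.
have -> : (\int[lebesgue_rV p]_(y in face_box T i) ((h * h) (face_point i 0 y))%:E)%E
    = (fip i (face_fun i h) (face_fun i h))%:E.
  by rewrite ip_sqrE//; exact: face_fun_sqint.
have sh := trigp_sqint th; have sd := trigp_sqint td.
set K := (1 + T 0 i); have K0 : 0 <= K by rewrite addr_ge0// ltW.
have mq : measurable_fun (box T : set (rV_leb R p.+1))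
    (fun t => (h * h) t + T 0 i * `|partial i (h * h) t|).
  have [chh _ cdhh] := Chh; apply: measurable_fun_rV_leb; first exact: measurable_box.
  apply: measurable_funTS; apply: measurable_funD.
    exact: continuous_measurable_rV.
  apply: measurable_funM; first exact: measurable_cst.
  by apply: measurableT_comp => //; exact: continuous_measurable_rV.
have bound := integral_le_ip mbox sh sd K0 mq.
move=> /le_trans /(_ (bound _)) h_le.
rewrite mulrAC ler_pdivlMr// mulrC -lee_fin EFinM; apply: h_le => t _.
rewrite dhh -[(h * h) t]/(h t * h t) -[(_ + _) t]/(h t * partial i h t + h t * partial i h t).
apply/andP; split.
  by apply: addr_ge0; [rewrite -expr2 sqr_ge0|apply: mulr_ge0 => //; exact: ltW].
set x := h t; set y := partial i h t.
have xy : `|x * y + x * y| <= x ^+ 2 + y ^+ 2.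
  have e1 : x ^+ 2 + y ^+ 2 - (x * y + x * y) = (x - y) ^+ 2 by ring.
  have e2 : x * y + x * y + (x ^+ 2 + y ^+ 2) = (x + y) ^+ 2 by ring.
  rewrite ler_norml -subr_ge0 opprK e2 sqr_ge0/= -subr_ge0 e1; exact: sqr_ge0.
rewrite /K mulrDl mul1r; apply: lerD; last by rewrite ler_wpM2l// ltW.
by rewrite -expr2 lerDl sqr_ge0.
Qed.

(** The trace inequality makes the restrictions of the [V k j] to a face Cauchy. Periodicity makes
    their restrictions to the opposite face the same functions, so one limit [G] is the trace on
    both. *)
Lemma same_traces_trigp (w : 'rV[R]_p.+1 -> 'rV[R]_n)
    (V : nat -> 'I_n -> 'rV[R]_p.+1 -> R) :
  (forall k j, trigp T (V k j)) -> L2 (box T) w ->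
  (forall j, cvgL2 (lebesgue_rV p.+1) (box T) (fun k => V k j) (fun t => w t 0 j)) ->
  (forall al j, cauchyL2 (lebesgue_rV p.+1) (box T) (fun k => partial al (V k j))) ->
  forall i, same_traces T i w.
Proof.
move=> tV Lw Vw cV i.
have sw := (L2_coord mbox w).1 Lw.
have td al k j := trigp_partial al (tV k j).
have cauchyV j : cauchyL2 (lebesgue_rV p.+1) (box T) (fun k => V k j).
  exact: (cvgL2_cauchy mbox (fun k => trigp_sqint (tV k j)) (sw j) (Vw j)).
have /choice[W hW] (al : 'I_p.+1) : exists W : 'I_n -> 'rV[R]_p.+1 -> R, forall j, sq (W j) /\
    cvgL2 (lebesgue_rV p.+1) (box T) (fun k => partial al (V k j)) (W j).
  have W_ j := L2_complete mbox (fun k => trigp_sqint (td al k j)) (cV al j).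
  by have [W hW] := choice W_; exists W => j; exact: hW.
have /choice[G hG] (j : 'I_n) : exists G : 'rV[R]_p -> R,
    sqint (lebesgue_rV p) (face_box T i) G /\
    cvgL2 (lebesgue_rV p) (face_box T i) (fun k => face_fun i (V k j)) G.
  apply: (L2_complete (mface i)); first by move=> k; exact: (face_fun_sqint i (tV k j)).
  move=> e e0; pose C := (1 + T 0 i) / T 0 i.
  have C0 : 0 < C by apply: divr_gt0 (T0 i); exact: addr_gt0 ltr01 (T0 i).
  have e2 : 0 < e / C / 2 by do 2 apply: divr_gt0 => //.
  have [N1 h1] := cauchyV j _ e2; have [N2 h2] := cV i j _ e2.
  exists (maxn N1 N2) => k l; rewrite !geq_max => /andP[k1 k2] /andP[l1 l2].
  have := face_ip_le i (trigpB (tV k j) (tV l j)).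
  rewrite (partialB i (tV k j) (tV l j)) => /le_trans; apply.
  rewrite -/C mulrC -ler_pdivlMr// (splitr (e / C)).
  by apply: lerD; [exact: h1|exact: h2].
exists (vrow G), (vrow G).
have Lface : L2 (face_box T i) (vrow G).
  by apply/(L2_coord (mface i)) => j; rewrite coordf_vrow; case: (hG j).
have trace_at c : (forall k j y, V k j (face_point i c y) = face_fun i (V k j) y) ->
    is_trace T i c w (vrow G).
  move=> hc; split => //; exists (fun k => vrow (V k)); split.
  - by move=> k; exact: (smooth_vrow_trigp (tV k)).
  - apply: (cvg_L2_coord mbox).
      by move=> k; apply/(L2_coord mbox) => j; rewrite coordf_vrow; exact: (trigp_sqint (tV k j)).
      exact: Lw.
    by move=> j; under eq_fun do rewrite coordf_vrow; exact: Vw.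
  - move=> al; exists (vrow (W al)).
      by apply/(L2_coord mbox) => j; rewrite coordf_vrow; case: (hW al j).
    have dV k j t := trigp_differentiable t (tV k j).
    have e : (fun k => partial al (vrow (V k))) = fun k => vrow (fun j => partial al (V k j)).
      by apply/funext => k; exact: partial_vrow.
    rewrite e; apply: (cvg_L2_coord mbox).
    + by move=> k; apply/(L2_coord mbox) => j; rewrite coordf_vrow; exact: (trigp_sqint (td al k j)).
    + by apply/(L2_coord mbox) => j; rewrite coordf_vrow; case: (hW al j).
    + move=> j; rewrite coordf_vrow; under eq_fun do rewrite coordf_vrow.
      by case: (hW al j).
  - have e : (fun k y => vrow (V k) (face_point i c y)) =
        fun k => vrow (fun j => face_fun i (V k j)).
      by apply/funext => k; apply/funext => y; apply/rowP => j; rewrite !mxE; exact: hc.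
    rewrite e; apply: (cvg_L2_coord (mface i)).
      move=> k; apply/(L2_coord (mface i)) => j; rewrite coordf_vrow.
      exact: (face_fun_sqint i (tV k j)).
      exact: Lface.
    move=> j; rewrite coordf_vrow; under eq_fun do rewrite coordf_vrow.
    by case: (hG j).
split.
- by apply: trace_at => k j y.
- apply: trace_at => k j y; rewrite -[T 0 i]addr0 face_point_add addrC.
  by rewrite (trigp_periodic _ _ (tV k j))// gt_eqF.
- exact: aeW.
Qed.

End traces.

Lemma Rintegral_sum d (X : measurableType d) (R : realType)
    (mu : {measure set X -> \bar R}) (D : set X) (I : Type) (s : seq I) (F : I -> X -> R) :
  measurable D -> (forall i, mu.-integrable D (EFin \o F i)) ->
  \int[mu]_(t in D) (\sum_(i <- s) F i t) = \sum_(i <- s) \int[mu]_(t in D) F i t.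
Proof.
move=> mD iF; rewrite /Rintegral.
rewrite (eq_integral (fun t => \sum_(i <- s) (F i t)%:E)%E); last first.
  by move=> t _; rewrite sumEFin.
rewrite integral_sum//.
rewrite (eq_bigr (fun i => (\int[mu]_(t in D) F i t)%:E)) ?sumEFin// => i _.
by rewrite /Rintegral fineK//; exact: (integrable_fin_num mD (iF i)).
Qed.

(** * From weak derivatives to smooth approximants *)

Section regularity.
Context {R : realType} {p n : nat}.
Variable T : 'rV[R]_p.
Hypothesis T0 : forall i, 0 < T 0 i.
Let mbox : measurable (box T : set (rV_leb R p)) := measurable_rV_leb (measurable_box T).
Local Notation sq := (sqint (lebesgue_rV p) (box T)).
Local Notation ip := (ip (lebesgue_rV p) (box T)).
Local Notation cvgL2 := (cvgL2 (lebesgue_rV p) (box T)).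
Local Notation cauchyL2 := (cauchyL2 (lebesgue_rV p) (box T)).
Local Notation coordf := (@coordf _ (rV_leb R p) R n).
Implicit Types u w f : 'rV[R]_p -> 'rV[R]_n.

Lemma weak_partialP al u : H1 T u ->
  L2 (box T) (weak_partial T al u) /\ is_weak_partial T al u (weak_partial T al u).
Proof.
move=> [_ /(_ al)[w hw]].
by have := @getPex _ [set w | L2 (box T) w /\ is_weak_partial T al u w]; apply; exists w.
Qed.

(** As a test function it isolates the [j]-th component and turns vector identities into scalar
    ones. *)
Definition unit_row (j : 'I_n) (g : 'rV[R]_p -> R) : 'rV[R]_p -> 'rV[R]_n :=
  vrow (fun k => if k == j then g else cst 0).

Lemma coordf_unit_row j g k : coordf (unit_row j g) k = if k == j then g else cst 0.
Proof. exact: coordf_vrow. Qed.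

Lemma unit_row_trigp j g : trigp T g -> forall k : 'I_n, trigp T (if k == j then g else cst 0).
Proof. by move=> tg k; case: ifP => // _; exact: trigp_cst. Qed.

Lemma Cinf_per_unit_row j g : trigp T g -> Cinf_per T (unit_row j g).
Proof.
move=> tg; have tk := unit_row_trigp j tg.
split; first exact: smooth_vrow_trigp tk.
move=> i t; apply/rowP => k; rewrite !mxE.
by rewrite (trigp_periodic _ _ (tk k))// gt_eqF.
Qed.

Lemma partial_unit_row al j g : trigp T g ->
  partial al (unit_row j g) = unit_row j (partial al g).
Proof.
move=> tg; have tk := unit_row_trigp j tg.
rewrite partial_vrow; last by move=> k t; exact: trigp_differentiable (tk k).
by congr vrow; apply/funext => k; case: ifP => // _; exact: partial_cst0.
Qed.

Lemma L2_unit_row j g : trigp T g -> L2 (box T) (unit_row j g).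
Proof.
move=> tg; apply/(L2_coord mbox) => k; rewrite coordf_unit_row.
exact: (trigp_sqint (unit_row_trigp j tg k)).
Qed.

Lemma Rintegral_dot_unit_row w j g : L2 (box T) w -> trigp T g ->
  \int[lebesgue_rV p]_(t in box T) dot (w t) (unit_row j g t) = ip (coordf w j) g.
Proof.
move=> Lw tg; rewrite (Rintegral_dot mbox Lw (L2_unit_row j tg)).
rewrite (bigD1 j)//= coordf_unit_row eqxx big1 ?addr0// => k kj.
rewrite coordf_unit_row (negbTE kj) ipE.
transitivity (\int[lebesgue_rV p]_(t in box T) (0 : R)).
  by apply: eq_Rintegral => t _; rewrite mulr0.
by rewrite (Rintegral_cst (lebesgue_rV p) mbox 0) mul0r.
Qed.

Lemma weak_partial_trigp al u w j g : L2 (box T) u -> L2 (box T) w ->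
  is_weak_partial T al u w -> trigp T g ->
  ip (coordf u j) (partial al g) = - ip (coordf w j) g.
Proof.
move=> Lu Lw uw tg; have := uw _ (Cinf_per_unit_row j tg).
rewrite (partial_unit_row al j tg).
by rewrite (Rintegral_dot_unit_row j Lu (trigp_partial al tg)) (Rintegral_dot_unit_row j Lw tg).
Qed.

(** Both derivatives move onto [g]: the weak Laplacian is tested with [g], and each weak partial
    with the trigonometric polynomial [partial al g]. *)
Lemma weak_laplacian_trigp u f j g : H1 T u -> L2 (box T) f ->
  (forall v, Cinf_per T v ->
    \int[lebesgue_rV p]_(t in box T)
      (\sum_(al < p) dot (weak_partial T al u t) (partial al v t)) =
    - \int[lebesgue_rV p]_(t in box T) dot (f t) (v t)) ->
  trigp T g -> ip (coordf u j) (lap g) = ip (coordf f j) g.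
Proof.
move=> Hu Lf uf tg; have [Lu _] := Hu.
have := uf _ (Cinf_per_unit_row j tg); rewrite (Rintegral_dot_unit_row j Lf tg).
have Lw al := (weak_partialP al Hu).1.
have Lu_ al : L2 (box T) (partial al (unit_row j g)).
  by rewrite (partial_unit_row al j tg); exact: (L2_unit_row j (trigp_partial al tg)).
have -> : \int[lebesgue_rV p]_(t in box T)
      (\sum_(al < p) dot (weak_partial T al u t) (partial al (unit_row j g) t)) =
    \sum_(al < p) ip (coordf (weak_partial T al u) j) (partial al g).
  rewrite (Rintegral_sum _ mbox); last by move=> al; exact: (integrable_dot mbox).
  apply: eq_bigr => al _; rewrite (partial_unit_row al j tg).
  exact: (Rintegral_dot_unit_row j (Lw al) (trigp_partial al tg)).
rewrite (eq_bigr (fun al => - ip (coordf u j) (partial al (partial al g)))); last first.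
  move=> al _; rewrite (weak_partial_trigp j Lu (Lw al) (weak_partialP al Hu).2) ?opprK//.
  exact: trigp_partial.
rewrite sumrN => /oppr_inj <-; rewrite ipC /lap.
have su := (L2_coord mbox u).1 Lu j.
rewrite (ip_suml _ (fun al => trigp_sqint (trigp_partial al (trigp_partial al tg))) su).
by apply: eq_bigr => al _; rewrite ipC.
Qed.

Theorem H2_approximation u f : H1 T u -> L2 (box T) f ->
  (forall j g, trigp T g -> ip (coordf u j) (lap g) = ip (coordf f j) g) ->
  exists V : nat -> 'I_n -> 'rV[R]_p -> R,
  [/\ forall k j, trigp T (V k j),
   forall j, cvgL2 (fun k => V k j) (coordf u j),
   forall al j, cvgL2 (fun k => partial al (V k j)) (coordf (weak_partial T al u) j) &
   forall be al j, cauchyL2 (fun k => partial be (partial al (V k j)))].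
Proof.
move=> Hu Lf weak; have [Lu _] := Hu.
have su := (L2_coord mbox u).1 Lu; have sf := (L2_coord mbox f).1 Lf.
have Lw al := (weak_partialP al Hu).1.
have /choice[V hV] : forall j, exists v : nat -> 'rV[R]_p -> R,
    [/\ forall k, trigp T (v k), cvgL2 v (coordf u j) & cauchyL2 (fun k => lap (v k))].
  by move=> j; exact: (trigp_H2_dense T0 (su j) (sf j) (weak j)).
have tV j k : trigp T (V j k) by case: (hV j).
have cV j : cauchyL2 (V j).
  by apply: (cvgL2_cauchy mbox (fun k => trigp_sqint (tV j k)) (su j)); case: (hV j).
have clV j : cauchyL2 (fun k => lap (V j k)) by case: (hV j).
exists (fun k j => V j k); split.
- by move=> k j; exact: tV.
- by move=> j; case: (hV j).
- move=> al j; have tdV k := trigp_partial al (tV j k).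
  have cd : cauchyL2 (fun k => partial al (V j k)).
    move=> e e0; have e2 : 0 < e / 2 by rewrite divr_gt0.
    have [N1 h1] := cV j _ e2; have [N2 h2] := clV j _ e2.
    exists (maxn N1 N2) => k l; rewrite !geq_max => /andP[k1 k2] /andP[l1 l2].
    rewrite -(partialB al (tV j k) (tV j l)).
    apply: le_trans (ip_partial_le T0 al (trigpB (tV j k) (tV j l))) _.
    rewrite (lapB (tV j k) (tV j l)) (splitr e).
    by apply: lerD; [exact: h1|exact: h2].
  have [W [sW cW]] := L2_complete mbox (fun k => trigp_sqint (tdV k)) cd.
  have sw := (L2_coord mbox _).1 (Lw al) j.
  apply: (eq_cvgL2 mbox (fun k => trigp_sqint (tdV k)) sW sw _ cW).
  (* The limit of the partials is the chosen weak partial because both give the same result against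
     every trigonometric polynomial. *)
  apply: (ae_eq_trigp T0 sW sw) => g tg.
  have tdg := trigp_partial al tg.
  have l1 := cvgL2_ip mbox (fun k => trigp_sqint (tdV k)) sW (trigp_sqint tg) cW.
  have cvj : cvgL2 (V j) (coordf u j) by case: (hV j).
  have l2 := cvgL2_ip mbox (fun k => trigp_sqint (tV j k)) (su j) (trigp_sqint tdg) cvj.
  have e k : ip (partial al (V j k)) g = - ip (V j k) (partial al g).
    by rewrite (ip_partial T0 al (tV j k) tg) opprK.
  have l1' : - ip (V j k) (partial al g) @[k --> \oo] --> ip W g.
    by under eq_fun do rewrite -e.
  have := cvg_unique (@Rhausdorff R) l1' (cvgN l2) => ->.
  by rewrite (weak_partial_trigp j Lu (Lw al) (weak_partialP al Hu).2 tg) opprK.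
- move=> be al j e e0; have [N h] := clV j _ e0; exists N => k l Nk Nl.
  have tk := trigp_partial al (tV j k); have tl := trigp_partial al (tV j l).
  rewrite -(partialB be tk tl) -(partialB al (tV j k) (tV j l)).
  apply: le_trans (ip_partial2_le T0 be al (trigpB (tV j k) (tV j l))) _.
  by rewrite (lapB (tV j k) (tV j l)); exact: h.
Qed.

End regularity.

(** * The Euler-Lagrange equation *)

Section growth.
Context {R : realType}.
Variables a a' : R -> R.
Hypothesis a_C1 : C1_halfline a a'.

Lemma halfline_quotient (r e : R) : 0 <= r -> 0 < e -> exists2 d, 0 < d &
  forall h, h != 0 -> `|h| < d -> 0 <= h + r -> `|a' r - (a (h + r) - a r) / h| <= e.
Proof.
move=> r0 e0; have /cvgrPdist_le/(_ e e0) := a_C1.1 r r0.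
move=> [d /= d0 hd]; exists d => // h h0 hlt hr.
have := hd (h + r); rewrite /= addrK; apply.
- by rewrite /ball_ /= opprD addrCA subrr addr0 normrN.
- by rewrite -subr_eq0 addrK.
- exact: hr.
Qed.

Lemma is_derive_halfline (r : R) : 0 < r -> is_derive r 1 a (a' r).
Proof.
move=> r0.
have c : h^-1 *: ((a \o shift r) (h *: 1) - a r) @[h --> 0^'] --> a' r.
  apply/cvgrPdist_le => e e0.
  have [d d0 hd] := halfline_quotient (ltW r0) e0.
  have m0 : 0 < Num.min d r by rewrite lt_min d0 r0.
  exists (Num.min d r) => // h /=; rewrite /ball_ /= sub0r normrN lt_min => /andP[h1 h2] h0.
  rewrite [h *: 1]mulr1 -[h^-1 *: _]/(h^-1 * _) mulrC; apply: hd => //.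
  by move: h2; rewrite ltr_norml => /andP[h2 _]; rewrite -lerBlDr sub0r ltW.
split; last exact: cvg_lim c.
by apply/cvg_ex; exists (a' r).
Qed.

(** Near 0 the difference quotient stays within 1 of [a' 0], hence below [K] in absolute value, and
    [a] is Lipschitz at 0. This supplies the endpoint for the mean value theorem. *)
Lemma halfline_right_continuous : a x @[x --> 0^'+] --> a 0.
Proof.
apply/cvgrPdist_le => e e0.
have [d d0 hd] := halfline_quotient (lexx 0) ltr01.
pose K := `|a' 0| + 1; have K0 : 0 < K by rewrite ltr_wpDl.
have m0 : 0 < Num.min d (e / K) by rewrite lt_min d0 divr_gt0.
exists (Num.min d (e / K)) => // x /=; rewrite /ball_ /= sub0r normrN lt_min => /andP[h1 h2] x0.
have := hd x; rewrite addr0 gt_eqF// => /(_ isT h1 (ltW x0)) h.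
set q := (a x - a 0) / x in h.
have qK : `|q| <= K.
  rewrite -(subKr (a' 0) q) (le_trans (ler_normB _ _))// lerD2l//.
have xneq : x != 0 by rewrite gt_eqF.
rewrite distrC (_ : a x - a 0 = q * x); last by rewrite /q divfK.
rewrite normrM (le_trans (ler_wpM2r (normr_ge0 x) qK))// mulrC -ler_pdivlMr//.
exact: ltW.
Qed.

Lemma linear_growth M s : (forall s, 0 <= s -> a' s <= M) -> 0 <= s -> a s <= a 0 + M * s.
Proof.
move=> hM; rewrite le_eqVlt => /predU1P[<-|s0]; first by rewrite mulr0 addr0.
have [||c] := @MVT R a a' 0 s s0.
- by move=> x; rewrite in_itv/= => /andP[x0 _]; exact: is_derive_halfline.
- apply/continuous_within_itvP => //; split.
  + move=> x; rewrite in_itv/= => /andP[x0 _]; apply: differentiable_continuous.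
    by apply/derivable1_diffP; case: (is_derive_halfline x0).
  + exact: halfline_right_continuous.
  + apply: cvg_at_left_filter; apply: differentiable_continuous.
    by apply/derivable1_diffP; case: (is_derive_halfline s0).
rewrite in_itv/= subr0 => /andP[c0 _] e.
by rewrite addrC -lerBlDr e ler_wpM2r ?hM// ltW.
Qed.

End growth.

Section euclidean_inequalities.
Context {R : realType} {n : nat}.
Implicit Types (x y v : 'rV[R]_n) (f : 'rV[R]_n -> R).

Lemma enorm_ge0 x : 0 <= enorm x.
Proof. exact: sqrtr_ge0. Qed.

Lemma sqr_enormD_le x y : enorm (x + y) ^+ 2 <= 2 * (enorm x ^+ 2 + enorm y ^+ 2).
Proof.
rewrite !enorm_sqrE -big_split mulr_sumr; apply: ler_sum => j _ /=; rewrite mxE.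
rewrite -subr_ge0 (_ : _ - _ = (x 0 j - y 0 j) ^+ 2) ?sqr_ge0//; ring.
Qed.

Lemma sqr_enormZ s x : enorm (s *: x) ^+ 2 = s ^+ 2 * enorm x ^+ 2.
Proof.
by rewrite !enorm_sqrE mulr_sumr; apply: eq_bigr => j _; rewrite mxE exprMn.
Qed.

Lemma normr_dot_le x y : `|dot x y| <= 2^-1 * (enorm x ^+ 2 + enorm y ^+ 2).
Proof.
rewrite !enorm_sqrE -big_split mulr_sumr (le_trans (ler_norm_sum _ _ _))//.
apply: ler_sum => j _ /=; set a := x 0 j; set b := y 0 j.
have h1 := sqr_ge0 (a - b); have h2 := sqr_ge0 (a + b).
have e1 : (a - b) ^+ 2 = a ^+ 2 + b ^+ 2 - 2 * (a * b) by ring.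
have e2 : (a + b) ^+ 2 = a ^+ 2 + b ^+ 2 + 2 * (a * b) by ring.
rewrite e1 in h1; rewrite e2 in h2.
rewrite ler_norml; apply/andP; split; lra.
Qed.

Lemma derive_dot_gradient f x v : differentiable f x -> 'D_v f x = dot (gradient f x) v.
Proof.
move=> df; rewrite deriveE// {1}(row_sum_delta v) linear_sum.
apply: eq_bigr => j _; rewrite linearZ /= -deriveE// mxE mulrC.
by [].
Qed.

Lemma is_derive_line f x v (s : R) : (forall z, differentiable f z) ->
  is_derive s 1 (fun s => f (x + s *: v)) (dot (gradient f (x + s *: v)) v).
Proof.
move=> df; have dv := @diff_derivable _ _ _ _ _ v (df (x + s *: v)).
have e : (fun h => h^-1 *: (((fun s => f (x + s *: v)) \o shift s) (h *: 1)
      - (fun s => f (x + s *: v)) s)) =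
    fun h => h^-1 *: ((f \o shift (x + s *: v)) (h *: v) - f (x + s *: v)).
  apply/funext => h /=; congr (_ *: (f _ - _)).
  by rewrite [h *: 1]mulr1 scalerDl addrCA.
split; first by rewrite /derivable e.
by rewrite -derive_dot_gradient// /derive e.
Qed.

Lemma line_MVT f x v (s : R) : 0 < s -> (forall z, differentiable f z) ->
  exists2 c, 0 <= c <= s & f (x + s *: v) - f x = dot (gradient f (x + c *: v)) v * s.
Proof.
move=> s0 df.
have [|c] := MVT s0 (fun c _ => is_derive_line x v c df).
  apply: continuous_subspaceT => c; apply: differentiable_continuous.
  by apply/derivable1_diffP; case: (is_derive_line x v c df).
rewrite in_itv/= => /andP[c0 cs]; rewrite scale0r addr0 subr0 => e.
by exists c => //; rewrite !ltW.
Qed.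

End euclidean_inequalities.

Section superposition.
Context {R : realType} {p n : nat}.
Variable T : 'rV[R]_p.
Let mbox : measurable (box T : set (rV_leb R p)) := measurable_rV_leb (measurable_box T).
Variable F : 'rV[R]_p -> 'rV[R]_n -> R.
Hypothesis F_meas : forall x, measurable_fun (box T : set (rV_leb R p)) (F ^~ x).
Hypothesis F_C1 : forall t, box T t -> C1 (F t).
Variable K : R.
Hypothesis K0 : 0 <= K.
Hypothesis F_growth : forall x t, box T t -> `|F t x| <= K * (1 + enorm x).
Hypothesis gradF_growth : forall x t, box T t -> enorm (gradient (F t) x) <= K * (1 + enorm x).
Local Notation coordf := (@coordf _ (rV_leb R p) R n).
Implicit Types u v : 'rV[R]_p -> 'rV[R]_n.

Lemma measurable_superposition u : vmeasurable (box T) u ->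
  measurable_fun (box T : set (rV_leb R p)) (fun t => F t (u t)).
Proof.
move=> mu; apply: (measurable_fun_caratheodory mbox F_meas) => // t tT x.
by apply: differentiable_continuous; exact: (F_C1 tT).1.
Qed.

(** For fixed [x] a partial derivative is a pointwise limit in [t] of difference quotients of
    measurable sections. *)
Lemma measurable_gradient j x :
  measurable_fun (box T : set (rV_leb R p)) (fun t => gradient (F t) x 0 j).
Proof.
pose h k : R := k.+1%:R^-1.
apply: (@measurable_fun_cvg _ (rV_leb R p) R (box T)
  (fun k t => (h k)^-1 * (F t (h k *: basis_vec j + x) - F t x))).
  move=> k; apply: measurable_funM; first exact: measurable_cst.
  by apply: measurable_funB; exact: F_meas.
move=> t tT; rewrite mxE /partial.
have dF := @diff_derivable _ _ _ _ _ (basis_vec j) ((F_C1 tT).1 x).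
have /cvgr_dnbhsP := dF; apply; split; first by move=> k; rewrite invr_eq0.
exact: cvg_harmonic.
Qed.

Lemma measurable_gradient_superposition u : vmeasurable (box T) u ->
  vmeasurable (box T) (fun t => gradient (F t) (u t)).
Proof.
move=> mu j.
have cG t : box T t -> continuous (fun x => gradient (F t) x 0 j).
  move=> tT x; have cG := (F_C1 tT).2 x.
  exact: (@continuous_comp _ _ _ _ (fun y : 'rV[R]_n => y 0 j) x cG (@coord_continuous _ _ _ _ _ _)).
exact: (@measurable_fun_caratheodory _ (rV_leb R p) R n (box T) mbox
  (fun t x => gradient (F t) x 0 j) u (measurable_gradient j) cG mu).
Qed.

Lemma sqr_growth (x : 'rV[R]_n) : (K * (1 + enorm x)) ^+ 2 <= 2 * K ^+ 2 * (1 + enorm x ^+ 2).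
Proof.
have -> : 2 * K ^+ 2 * (1 + enorm x ^+ 2) = K ^+ 2 * (2 * (1 + enorm x ^+ 2)) by ring.
rewrite exprMn; apply: ler_wpM2l; first exact: sqr_ge0.
by have := sqr_ge0 (1 - enorm x); nra.
Qed.

Lemma L2_finite_sqr u : L2 (box T) u ->
  (lebesgue_rV p).-integrable (box T) (fun t => (enorm (u t) ^+ 2)%:E).
Proof.
move=> Lu; have := integrable_dot mbox Lu Lu.
by apply: eq_integrable => // t _; rewrite sqr_enorm.
Qed.

Lemma integrable_box_cst (c : R) : (lebesgue_rV p).-integrable (box T) (fun=> c%:E).
Proof. by apply: (continuous_box_integrable T (f := cst c)); exact: cst_continuous. Qed.

Lemma integrable_affine_sqr u (c e : R) : L2 (box T) u ->
  (lebesgue_rV p).-integrable (box T) (fun t => (c + e * enorm (u t) ^+ 2)%:E).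
Proof.
move=> Lu; have := integrableD mbox (integrable_box_cst c) (integrableZl mbox e (L2_finite_sqr Lu)).
by apply: eq_integrable => // t _.
Qed.

Lemma integrable_superposition u : L2 (box T) u ->
  (lebesgue_rV p).-integrable (box T) (fun t => (F t (u t))%:E).
Proof.
move=> Lu; have mF := measurable_superposition Lu.1.
have mFE : measurable_fun (box T : set (rV_leb R p)) (fun t => (F t (u t))%:E).
  exact/measurable_EFinP.
apply: (le_integrable mbox mFE _ (integrable_affine_sqr (2 * K) K Lu)).
move=> t tT /=; rewrite lee_fin (le_trans (F_growth (u t) tT))//.
apply: le_trans (ler_norm _); rewrite (mulrC 2) -mulrDr ler_wpM2l//.
have := sqr_ge0 (1 - enorm (u t)); have := sqr_ge0 (enorm (u t)); nra.
Qed.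

Lemma L2_gradient_superposition u : L2 (box T) u ->
  L2 (box T) (fun t => gradient (F t) (u t)).
Proof.
move=> Lu; have mG := measurable_gradient_superposition Lu.1.
split => //; have mE := measurable_sqr_enorm mG.
have i1 := integrable_affine_sqr (2 * K ^+ 2) (2 * K ^+ 2) Lu.
suff : (lebesgue_rV p).-integrable (box T) (fun t => (enorm (gradient (F t) (u t)) ^+ 2)%:E).
  move=> /integrableP[_]; apply: le_lt_trans; rewrite le_eqVlt; apply/orP; left; apply/eqP.
  by apply: eq_integral => t _; rewrite gee0_abs// lee_fin sqr_ge0.
apply: (le_integrable mbox mE _ i1) => t tT /=.
rewrite lee_fin ger0_norm ?sqr_ge0//; apply: le_trans (ler_norm _).
rewrite -[X in X + _]mulr1 -mulrDr; apply: le_trans (sqr_growth _).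
by rewrite ler_sqr ?nnegrE ?enorm_ge0 ?mulr_ge0 ?addr_ge0 ?enorm_ge0// gradF_growth.
Qed.

(** The increments [1 / k.+1] suffice, since the critical point condition will be tested along this
    sequence only; the mean value theorem on the segment supplies the domination. *)
Lemma cvg_quotient_superposition u v : L2 (box T) u -> L2 (box T) v ->
  \int[lebesgue_rV p]_(t in box T)
    (k.+1%:R * (F t (u t + k.+1%:R^-1 *: v t) - F t (u t))) @[k --> \oo] -->
  \int[lebesgue_rV p]_(t in box T) dot (gradient (F t) (u t)) (v t).
Proof.
move=> Lu Lv; pose q k t : R := k.+1%:R * (F t (u t + k.+1%:R^-1 *: v t) - F t (u t)).
have mq k : measurable_fun (box T : set (rV_leb R p)) (fun t => (q k t)%:E).
  apply/measurable_EFinP; apply: measurable_funM; first exact: measurable_cst.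
  apply: measurable_funB; last exact: (measurable_superposition Lu.1).
  apply: (measurable_superposition (u := fun t => u t + k.+1%:R^-1 *: v t)).
  exact: (L2D mbox Lu (L2Z mbox k.+1%:R^-1 Lv)).1.
have idot := integrable_dot mbox (L2_gradient_superposition Lu) Lv.
(* Half of [2 * K ^+ 2 * (1 + 2 * (enorm (u t) ^+ 2 + enorm (v t) ^+ 2))], which bounds the squared
   gradient on the segment, plus half of [enorm (v t) ^+ 2]. *)
pose g t := (K ^+ 2 + (2 * K ^+ 2 * enorm (u t) ^+ 2 + (2 * K ^+ 2 + 2^-1) * enorm (v t) ^+ 2))%R.
have ig : (lebesgue_rV p).-integrable (box T) (fun t => (g t)%:E).
  have := integrableD mbox (integrable_affine_sqr (K ^+ 2) (2 * K ^+ 2) Lu)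
    (integrable_affine_sqr 0 (2 * K ^+ 2 + 2^-1) Lv).
  by apply: eq_integrable => // t _; rewrite -EFinD add0r -addrA.
have qg k t : box T t -> `|q k t| <= g t.
  move=> tT; have k0 : 0 < k.+1%:R^-1 :> R by rewrite invr_gt0.
  have [c /andP[c0 ck] e] := line_MVT (u t) (v t) k0 (F_C1 tT).1.
  rewrite /q e mulrC divfK ?pnatr_eq0// (le_trans (normr_dot_le _ _))//.
  have c1 : c <= 1 by rewrite (le_trans ck)// invf_le1 ?ler1n// ltr0n.
  have cc : c ^+ 2 <= 1 by rewrite expr_le1.
  have h1 : enorm (gradient (F t) (u t + c *: v t)) ^+ 2 <=
      2 * K ^+ 2 * (1 + enorm (u t + c *: v t) ^+ 2).
    apply: le_trans (sqr_growth _).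
    by rewrite ler_sqr ?nnegrE ?enorm_ge0 ?mulr_ge0 ?addr_ge0 ?enorm_ge0// gradF_growth.
  have h2 := sqr_enormD_le (u t) (c *: v t); rewrite sqr_enormZ in h2.
  have h3 : c ^+ 2 * enorm (v t) ^+ 2 <= enorm (v t) ^+ 2.
    by rewrite ler_piMl// sqr_ge0.
  rewrite /g; move: h1 h2 h3; move: (enorm (gradient _ _) ^+ 2) (enorm (u t + _) ^+ 2).
  move: (enorm (u t) ^+ 2) (enorm (v t) ^+ 2) => x y G z h1 h2 h3.
  have K2 : 0 <= K ^+ 2 by exact: sqr_ge0.
  have h4 : K ^+ 2 * z <= K ^+ 2 * (2 * (x + y)) by apply: ler_wpM2l => //; lra.
  by lra.
have lim : (\int[lebesgue_rV p]_(t in box T) (q k t)%:E)%E @[k --> \oo] -->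
    (\int[lebesgue_rV p]_(t in box T) (dot (gradient (F t) (u t)) (v t))%:E)%E.
  apply: (@dominated_cvg _ _ R (lebesgue_rV p) _ mbox _ _ (fun t => (g t)%:E) mq).
  - move=> t tT.
    have dF := @diff_derivable _ _ _ _ _ (v t) ((F_C1 tT).1 (u t)).
    have /cvgr_dnbhsP/(_ (fun k => k.+1%:R^-1)) h := dF.
    have hk : forall k : nat, (k.+1%:R^-1 : R) != 0 by move=> k; rewrite invr_eq0.
    have lim_q : q k t @[k --> \oo] --> dot (gradient (F t) (u t)) (v t).
      rewrite -(derive_dot_gradient _ ((F_C1 tT).1 (u t))).
      rewrite (_ : (fun k => q k t) = fun k : nat => (k.+1%:R^-1)^-1 *:
          ((F t \o shift (u t)) (k.+1%:R^-1 *: v t) - F t (u t))).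
        by apply: h; split; [exact: hk|exact: cvg_harmonic].
      by apply/funext => k; rewrite /q /= invrK [u t + _]addrC.
    by apply: cvg_EFin lim_q; exact: nearW.
  - by move=> t _.
  - exact: ig.
  - by move=> k t tT; rewrite lee_fin; exact: qg.
have e := fineK (integrable_fin_num mbox idot).
by rewrite -e in lim; exact: (fine_cvg lim).
Qed.

End superposition.

Lemma eq_ip_ae d (X : measurableType d) (R : realType)
    (mu : {measure set X -> \bar R}) (D : set X) (f g : X -> R) :
  measurable D -> sqint mu D f -> sqint mu D g ->
  {ae mu, forall x, D x -> f x = g x} -> ip mu D f f = ip mu D g g.
Proof.
move=> mD sf sg fg; apply: EFin_inj; rewrite !ip_sqrE//; apply: ae_eq_integral => //.
- by case: sf => _ /integrableP[].
- by case: sg => _ /integrableP[].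
- by apply: filterS fg => x h Dx; rewrite h.
Qed.

(** * Smooth variations of the action *)

Section variations.
Context {R : realType} {p n : nat}.
Variable T : 'rV[R]_p.
Hypothesis T0 : forall i, 0 < T 0 i.
Let mbox : measurable (box T : set (rV_leb R p)) := measurable_rV_leb (measurable_box T).
Local Notation sq := (sqint (lebesgue_rV p) (box T)).
Local Notation ip := (ip (lebesgue_rV p) (box T)).
Local Notation coordf := (@coordf _ (rV_leb R p) R n).
Implicit Types u v w : 'rV[R]_p -> 'rV[R]_n.

Lemma Cinf_differentiable v t : Cinf_per T v -> differentiable v t.
Proof. by move=> [sv _]; exact: (sv [::] t). Qed.

Lemma Cinf_differentiable_partial al v t : Cinf_per T v -> differentiable (partial al v) t.
Proof. by move=> [sv _]; exact: (sv [:: al] t). Qed.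

Lemma continuous_coordf v j : (forall t, differentiable v t) ->
  continuous (coordf v j : 'rV[R]_p -> R).
Proof.
move=> dv t; have cv := differentiable_continuous (dv t).
exact: (@continuous_comp _ _ _ v (fun y : 'rV[R]_n => y 0 j) t cv (@coord_continuous _ _ _ _ _ _)).
Qed.

Lemma C1_along_coordf i v j : Cinf_per T v -> C1_along i (coordf v j).
Proof.
move=> Cv; have dv t := Cinf_differentiable t Cv; split.
- exact: continuous_coordf.
- move=> t; have := @diff_derivable _ _ _ _ _ (basis_vec i) (dv t).
  by move=> /derivable_mxP; exact.
- rewrite -(coordf_partial i j dv); apply: continuous_coordf => t.
  exact: Cinf_differentiable_partial.
Qed.

Lemma periodic_coordf i v j t : Cinf_per T v ->
  coordf v j (t + T 0 i *: basis_vec i) = coordf v j t.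
Proof. by move=> [_ pv]; rewrite /coordf pv. Qed.

Lemma L2_Cinf v : Cinf_per T v -> L2 (box T) v.
Proof.
move=> Cv; apply/(L2_coord mbox) => j; apply: continuous_sqint.
by apply: continuous_coordf => t; exact: Cinf_differentiable.
Qed.

Lemma L2_partial_Cinf al v : Cinf_per T v -> L2 (box T) (partial al v).
Proof.
move=> Cv; apply/(L2_coord mbox) => j; apply: continuous_sqint.
by apply: continuous_coordf => t; exact: Cinf_differentiable_partial.
Qed.

Lemma is_weak_partial_Cinf al v : Cinf_per T v -> is_weak_partial T al v (partial al v).
Proof.
move=> Cv w Cw.
rewrite (Rintegral_dot mbox (L2_Cinf Cv) (L2_partial_Cinf al Cw)).
rewrite (Rintegral_dot mbox (L2_partial_Cinf al Cv) (L2_Cinf Cw)) -sumrN.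
apply: eq_bigr => j _; have dv t := Cinf_differentiable t Cv.
have dw t := Cinf_differentiable t Cw.
rewrite (coordf_partial al j dv) (coordf_partial al j dw) !ipE.
exact: (Rintegral_by_parts T0 (C1_along_coordf al j Cv) (C1_along_coordf al j Cw)
  (fun t => periodic_coordf al j t Cv) (fun t => periodic_coordf al j t Cw)).
Qed.

Lemma H1_Cinf v : Cinf_per T v -> H1 T v.
Proof.
move=> Cv; split; first exact: L2_Cinf.
move=> al; exists (partial al v); split; first exact: L2_partial_Cinf.
exact: is_weak_partial_Cinf.
Qed.

Lemma ip_coordf_affine u w s v j : L2 (box T) u -> L2 (box T) w -> L2 (box T) v ->
  ip (coordf (u + s *: w) j) (coordf v j) =
  ip (coordf u j) (coordf v j) + s * ip (coordf w j) (coordf v j).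
Proof.
move=> /(L2_coord mbox) su /(L2_coord mbox) sw /(L2_coord mbox) sv.
rewrite coordfD coordfZ (ipDl mbox (su j) (sqintZ mbox s (sw j)) (sv j)).
by rewrite (ipZl mbox s (sw j) (sv j)).
Qed.

Lemma is_weak_partial_affine al u v s w w' :
  L2 (box T) u -> L2 (box T) v -> L2 (box T) w -> L2 (box T) w' ->
  is_weak_partial T al u w -> is_weak_partial T al v w' ->
  is_weak_partial T al (u + s *: v) (w + s *: w').
Proof.
move=> Lu Lv Lw Lw' uw vw' g Cg.
have Lg := L2_Cinf Cg; have Ldg := L2_partial_Cinf al Cg.
have := uw g Cg; have := vw' g Cg.
rewrite (Rintegral_dot mbox Lu Ldg) (Rintegral_dot mbox Lv Ldg).
rewrite (Rintegral_dot mbox Lw Lg) (Rintegral_dot mbox Lw' Lg) => e2 e1.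
rewrite (Rintegral_dot mbox (L2D mbox Lu (L2Z mbox s Lv)) Ldg).
rewrite (Rintegral_dot mbox (L2D mbox Lw (L2Z mbox s Lw')) Lg).
rewrite (eq_bigr _ (fun j _ => ip_coordf_affine s j Lu Lv Ldg)).
rewrite (eq_bigr _ (fun j _ => ip_coordf_affine s j Lw Lw' Lg)).
by rewrite !big_split -!mulr_sumr /= e1 e2 opprD mulrN.
Qed.

Lemma weak_partial_unique al u w w' j : L2 (box T) u -> L2 (box T) w -> L2 (box T) w' ->
  is_weak_partial T al u w -> is_weak_partial T al u w' ->
  {ae lebesgue_rV p, forall t, box T t -> coordf w j t = coordf w' j t}.
Proof.
move=> Lu Lw Lw' uw uw'.
apply: (ae_eq_trigp T0 ((L2_coord mbox w).1 Lw j) ((L2_coord mbox w').1 Lw' j)) => g tg.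
have := weak_partial_trigp T0 j Lu Lw uw tg.
by rewrite (weak_partial_trigp T0 j Lu Lw' uw' tg) => /oppr_inj.
Qed.

Definition energy (w : 'I_p -> 'rV[R]_p -> 'rV[R]_n) : R :=
  \sum_(al < p) \sum_(j < n) ip (coordf (w al) j) (coordf (w al) j).

(** The chosen weak partials need not be additive pointwise, but their energy may be computed from
    any weak derivatives, by uniqueness almost everywhere. *)
Lemma energy_weak_partial u (w : 'I_p -> 'rV[R]_p -> 'rV[R]_n) :
  H1 T u -> (forall al, L2 (box T) (w al)) ->
  (forall al, is_weak_partial T al u (w al)) ->
  energy (fun al => weak_partial T al u) = energy w.
Proof.
move=> Hu Lw uw; apply: eq_bigr => al _; apply: eq_bigr => j _.
have [Lwp uwp] := weak_partialP al Hu.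
apply: (eq_ip_ae mbox ((L2_coord mbox _).1 Lwp j) ((L2_coord mbox _).1 (Lw al) j)).
exact: weak_partial_unique Hu.1 Lwp (Lw al) uwp (uw al).
Qed.

Lemma Rintegral_energy (w : 'I_p -> 'rV[R]_p -> 'rV[R]_n) : (forall al, L2 (box T) (w al)) ->
  \int[lebesgue_rV p]_(t in box T) (\sum_(al < p) dot (w al t) (w al t)) = energy w.
Proof.
move=> Lw; rewrite (Rintegral_sum _ mbox); last first.
  by move=> al; exact: (integrable_dot mbox (Lw al) (Lw al)).
by apply: eq_bigr => al _; rewrite (Rintegral_dot mbox (Lw al) (Lw al)).
Qed.

Lemma integrable_energy (w w' : 'I_p -> 'rV[R]_p -> 'rV[R]_n) :
  (forall al, L2 (box T) (w al)) -> (forall al, L2 (box T) (w' al)) ->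
  (lebesgue_rV p).-integrable (box T) (fun t => (\sum_(al < p) dot (w al t) (w' al t))%:E).
Proof.
move=> Lw Lw'.
have := @integrable_sum _ _ _ (lebesgue_rV p) (box T) mbox _ (index_enum 'I_p) xpredT
  (fun al t => (dot (w al t) (w' al t))%:E) (fun al _ => integrable_dot mbox (Lw al) (Lw' al)).
by apply: eq_integrable => // t _; rewrite sumEFin.
Qed.

Lemma actionE F u : H1 T u ->
  (lebesgue_rV p).-integrable (box T) (fun t => (F t (u t))%:E) ->
  action T F u = 2^-1 * energy (fun al => weak_partial T al u) +
    \int[lebesgue_rV p]_(t in box T) F t (u t).
Proof.
move=> Hu iF; have Lw al := (weak_partialP al Hu).1.
have iE := integrable_energy Lw Lw.
rewrite /action (RintegralD mbox); last exact: iF.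
  by rewrite (RintegralZl 2^-1 mbox iE) (Rintegral_energy Lw).
have := integrableZl mbox 2^-1 iE.
by apply: eq_integrable => // t _; rewrite EFinM.
Qed.

Lemma H1dotE u : H1 T u -> H1dot T u u =
  \sum_j ip (coordf u j) (coordf u j) + energy (fun al => weak_partial T al u).
Proof.
move=> Hu; have Lw al := (weak_partialP al Hu).1.
rewrite /H1dot (RintegralD mbox).
- by rewrite (Rintegral_dot mbox Hu.1 Hu.1) Rintegral_energy.
- exact: (integrable_dot mbox Hu.1 Hu.1).
- exact: (integrable_energy Lw Lw).
Qed.

End variations.

Section critical_points.
Context {R : realType} {p n : nat}.
Variable T : 'rV[R]_p.
Hypothesis T0 : forall i, 0 < T 0 i.
Let mbox : measurable (box T : set (rV_leb R p)) := measurable_rV_leb (measurable_box T).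
Local Notation sq := (sqint (lebesgue_rV p) (box T)).
Local Notation ip := (ip (lebesgue_rV p) (box T)).
Local Notation coordf := (@coordf _ (rV_leb R p) R n).
Local Notation energy := (energy T).
Implicit Types u v : 'rV[R]_p -> 'rV[R]_n.

Lemma energy_affine (w w' : 'I_p -> 'rV[R]_p -> 'rV[R]_n) s :
  (forall al, L2 (box T) (w al)) -> (forall al, L2 (box T) (w' al)) ->
  energy (fun al => w al + s *: w' al) = energy w +
    s * (2 * \sum_(al < p) \sum_(j < n) ip (coordf (w al) j) (coordf (w' al) j)) +
    s ^+ 2 * energy w'.
Proof.
move=> Lw Lw'; rewrite /energy !mulr_sumr -!big_split; apply: eq_bigr => al _ /=.
rewrite !mulr_sumr -!big_split; apply: eq_bigr => j _ /=.
have Ls := L2D mbox (Lw al) (L2Z mbox s (Lw' al)).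
rewrite (ip_coordf_affine s j (Lw al) (Lw' al) Ls).
rewrite ipC (ipC (lebesgue_rV p) (box T) (coordf (w' al) j)).
rewrite (ip_coordf_affine s j (Lw al) (Lw' al) (Lw al)).
rewrite (ip_coordf_affine s j (Lw al) (Lw' al) (Lw' al)).
rewrite (ipC (lebesgue_rV p) (box T) (coordf (w' al) j) (coordf (w al) j)).
by ring.
Qed.

Lemma H1_affine u v s : H1 T u -> Cinf_per T v -> H1 T (u + s *: v).
Proof.
move=> Hu Cv; have Lv := L2_Cinf Cv.
split; first exact: (L2D mbox Hu.1 (L2Z mbox s Lv)).
move=> al; have [Lw uw] := weak_partialP al Hu.
exists (weak_partial T al u + s *: partial al v); split.
  exact: (L2D mbox Lw (L2Z mbox s (L2_partial_Cinf al Cv))).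
exact: (is_weak_partial_affine s Hu.1 Lv Lw (L2_partial_Cinf al Cv) uw (is_weak_partial_Cinf T0 al Cv)).
Qed.

Lemma energy_H1_affine u v s : H1 T u -> Cinf_per T v ->
  energy (fun al => weak_partial T al (u + s *: v)) =
  energy (fun al => weak_partial T al u + s *: partial al v).
Proof.
move=> Hu Cv; apply: (energy_weak_partial T0 (H1_affine s Hu Cv)) => al.
  exact: (L2D mbox (weak_partialP al Hu).1 (L2Z mbox s (L2_partial_Cinf al Cv))).
have [Lw uw] := weak_partialP al Hu.
exact: (is_weak_partial_affine s Hu.1 (L2_Cinf Cv) Lw (L2_partial_Cinf al Cv) uw (is_weak_partial_Cinf T0 al Cv)).
Qed.

Lemma H1norm_Zge0 v s : 0 <= s -> Cinf_per T v -> H1norm T (s *: v) = s * H1norm T v.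
Proof.
move=> s0 Cv; have Hv := H1_Cinf T0 Cv; have Lv := L2_Cinf Cv.
have dv al := L2_partial_Cinf al Cv.
(* This form brings a multiple of [v] under the lemmas on affine variations. *)
have svE : s *: v = v + (s - 1) *: v by rewrite scalerBl scale1r addrC subrK.
have Hsv : H1 T (s *: v) by rewrite svE; exact: (H1_affine (s - 1) Hv Cv).
have Ev : energy (fun al => weak_partial T al v) = energy (fun al => partial al v).
  by apply: (energy_weak_partial T0 Hv dv) => al; exact: is_weak_partial_Cinf.
have Esv : energy (fun al => weak_partial T al (s *: v)) = s ^+ 2 * energy (fun al => partial al v).
  have wv al := is_weak_partial_Cinf T0 al Cv.
  have -> : energy (fun al => weak_partial T al (s *: v)) =
      energy (fun al => partial al v + (s - 1) *: partial al v).
    apply: (energy_weak_partial T0 Hsv) => al.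
      exact: (L2D mbox (dv al) (L2Z mbox (s - 1) (dv al))).
    rewrite svE.
    exact: (is_weak_partial_affine (s - 1) Lv Lv (dv al) (dv al) (wv al) (wv al)).
  by rewrite (energy_affine _ dv dv) -/(energy _); ring.
rewrite /H1norm (H1dotE Hsv) (H1dotE Hv) Ev Esv.
rewrite (eq_bigr (fun j => s ^+ 2 * ip (coordf v j) (coordf v j))); last first.
  move=> j _; have sj := (L2_coord mbox v).1 Lv j.
  rewrite coordfZ (ipZl mbox s sj (sqintZ mbox s sj)) ipC (ipZl mbox s sj sj).
  by rewrite mulrA -expr2.
by rewrite -mulr_sumr -mulrDr sqrtrM ?sqr_ge0// sqrtr_sqr ger0_norm.
Qed.

End critical_points.

Section euler_lagrange.
Context {R : realType} {p n : nat}.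
Variable T : 'rV[R]_p.
Hypothesis T0 : forall i, 0 < T 0 i.
Let mbox : measurable (box T : set (rV_leb R p)) := measurable_rV_leb (measurable_box T).
Variable F : 'rV[R]_p -> 'rV[R]_n -> R.
Hypothesis F_meas : forall x, measurable_fun (box T : set (rV_leb R p)) (F ^~ x).
Hypothesis F_C1 : forall t, box T t -> C1 (F t).
Variable K : R.
Hypothesis K0 : 0 <= K.
Hypothesis F_growth : forall x t, box T t -> `|F t x| <= K * (1 + enorm x).
Hypothesis gradF_growth : forall x t, box T t -> enorm (gradient (F t) x) <= K * (1 + enorm x).
Local Notation ip := (ip (lebesgue_rV p) (box T)).
Local Notation coordf := (@coordf _ (rV_leb R p) R n).
Implicit Types u v : 'rV[R]_p -> 'rV[R]_n.

(** The kinetic part is quadratic, so its increment is an exact polynomial in the step; only the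
    potential part remains as a difference quotient. *)
Lemma action_quotient u v k : H1 T u -> Cinf_per T v ->
  action T F (u + k.+1%:R^-1 *: v) - action T F u =
  k.+1%:R^-1 * (\sum_(al < p) \sum_(j < n)
      ip (coordf (weak_partial T al u) j) (coordf (partial al v) j) +
    k.+1%:R^-1 * (2^-1 * energy T (fun al => partial al v)) +
    \int[lebesgue_rV p]_(t in box T)
      (k.+1%:R * (F t (u t + k.+1%:R^-1 *: v t) - F t (u t)))).
Proof.
move=> Hu Cv; have Lv := L2_Cinf Cv; set s := k.+1%:R^-1.
have i0 := integrable_superposition F_meas F_C1 K0 F_growth Hu.1.
have i1 := integrable_superposition F_meas F_C1 K0 F_growth (L2D mbox Hu.1 (L2Z mbox s Lv)).
have Lw al := (weak_partialP al Hu).1.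
rewrite (actionE (H1_affine T0 s Hu Cv) i1) (actionE Hu i0) (energy_H1_affine T0 s Hu Cv).
rewrite (energy_affine s Lw (fun al => L2_partial_Cinf al Cv)).
have iB : (lebesgue_rV p).-integrable (box T)
    (fun t => (F t (u t + s *: v t) - F t (u t))%:E).
  have := integrableB mbox i1 i0.
  by apply: eq_integrable => // t _; rewrite EFinB.
rewrite (RintegralZl k.+1%:R mbox iB) (RintegralB mbox i1 i0).
have sk : s * k.+1%:R = 1 by rewrite mulVf// pnatr_eq0.
set E0 := energy _ (fun al => weak_partial _ _ _); set I1 := Rintegral _ _ _.
set I0 := Rintegral _ _ _.
rewrite [s * (_ + s * _ + _)]mulrDr [s * (k.+1%:R * _)]mulrA sk mul1r.
by field.
Qed.

(** Divided by the step, the increment of the action tends to the sum of both integrals by dominated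
    convergence, and to 0 because the derivative vanishes and the H^1 norm is homogeneous. *)
Lemma critical_weak_laplacian u v : H1 T u -> H1_critical T (action T F) u -> Cinf_per T v ->
  \int[lebesgue_rV p]_(t in box T)
    (\sum_(al < p) dot (weak_partial T al u t) (partial al v t)) =
  - \int[lebesgue_rV p]_(t in box T) dot (gradient (F t) (u t)) (v t).
Proof.
move=> Hu [_ crit] Cv; have Lv := L2_Cinf Cv.
have Lw al := (weak_partialP al Hu).1.
rewrite (Rintegral_sum _ mbox); last first.
  by move=> al; exact: (integrable_dot mbox (Lw al) (L2_partial_Cinf al Cv)).
rewrite (eq_bigr _ (fun al _ => Rintegral_dot mbox (Lw al) (L2_partial_Cinf al Cv))).
have cQ := cvg_quotient_superposition F_meas F_C1 K0 gradF_growth Hu.1 Lv.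
have aq k := action_quotient k Hu Cv.
move: cQ aq; set Q := Rintegral _ _ _; set A := \sum_(al < p) _; set E := 2^-1 * _.
set q := (X in X @ \oo --> Q) => cQ aq.
have cs : (fun k => k.+1%:R^-1 : R) @ \oo --> (0 : R) by exact: cvg_harmonic.
have c1 : (fun k => A + k.+1%:R^-1 * E + q k) @ \oo --> A + 0 * E + Q.
  by apply: cvgD cQ; apply: cvgD; [exact: cvg_cst|apply: cvgMl; exact: cs].
suff c0 : (fun k => A + k.+1%:R^-1 * E + q k) @ \oo --> (0 : R).
  by apply/eqP; rewrite -addr_eq0 -(cvg_unique _ c1 c0)// mul0r addr0.
set N := H1norm T v; have N0 : 0 <= N by exact: sqrtr_ge0.
have N1 : 0 < N + 1 by rewrite ltr_wpDl.
apply/cvgrPdist_le => eps eps0.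
(* The denominator [N + 1] allows a test function of norm 0. *)
have [d d0 Hd] := crit (eps / (N + 1)) (divr_gt0 eps0 N1).
have csN : (fun k => k.+1%:R^-1 * N) @ \oo --> 0 * N by apply: cvgMl; exact: cs.
move/cvgrPdist_le: csN => /(_ d d0); apply: filterS => k; rewrite mul0r sub0r normrN => hk.
have s0 : 0 < k.+1%:R^-1 :> R by rewrite invr_gt0 ltr0Sn.
have nE := H1norm_Zge0 T0 (ltW s0) Cv.
have Hsv : H1 T (k.+1%:R^-1 *: v).
  have -> : k.+1%:R^-1 *: v = v + (k.+1%:R^-1 - 1) *: v.
    by rewrite scalerBl scale1r addrC subrK.
  exact: (H1_affine T0 _ (H1_Cinf T0 Cv) Cv).
have := Hd _ Hsv; rewrite nE -/N => /(_ (le_trans (ler_norm _) hk)).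
rewrite subr0 aq normrM (ger0_norm (ltW s0)) [eps / _ * _]mulrCA (ler_pM2l s0) sub0r normrN => h.
apply: (le_trans h); rewrite mulrAC ler_pdivrMr// ler_pM2l//.
by rewrite lerDl.
Qed.

End euler_lagrange.

(** For [u] the approximants have convergent first partials. For a weak partial the approximants are
    the partials of these, and the Cauchy second partials play that role. *)
Lemma weak_laplacian_same_traces {R : realType} {p n : nat} (T : 'rV[R]_p.+1)
    (T0 : forall i, 0 < T 0 i) (u f : 'rV[R]_p.+1 -> 'rV[R]_n) :
  H1 T u -> L2 (box T) f ->
  (forall v, Cinf_per T v ->
    \int[lebesgue_rV p.+1]_(t in box T)
      (\sum_(al < p.+1) dot (weak_partial T al u t) (partial al v t)) =
    - \int[lebesgue_rV p.+1]_(t in box T) dot (f t) (v t)) ->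
  forall i, same_traces T i u /\ forall al, same_traces T i (weak_partial T al u).
Proof.
move=> Hu Lf weak i.
have mbox := measurable_rV_leb (measurable_box T).
have [V [tV cV cdV cddV]] := H2_approximation T0 Hu Lf
  (fun j g => weak_laplacian_trigp T0 j Hu Lf weak (g := g)).
have Lw al := (weak_partialP al Hu).1.
have tdV al k j := trigp_partial al (tV k j).
split=> [|al].
  apply: (same_traces_trigp T0 tV Hu.1 cV) => al j.
  exact: (cvgL2_cauchy mbox (fun k => trigp_sqint (tdV al k j))
    ((L2_coord mbox _).1 (Lw al) j) (cdV al j)).
exact: (same_traces_trigp T0 (tdV al) (Lw al) (cdV al) (fun be => cddV be al)).
Qed.

Lemma vintegrable_L2 {R : realType} {p n : nat} (T : 'rV[R]_p) (f : 'rV[R]_p -> 'rV[R]_n) :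
  L2 (box T) f -> vintegrable (box T) f.
Proof.
move=> Lf j; have mbox := measurable_rV_leb (measurable_box T).
have := sqint_mul mbox ((L2_coord mbox f).1 Lf j) (trigp_sqint (trigp_cst T 1)).
by apply: eq_integrable => // t _; rewrite mulr1.
Qed.

Lemma linear_growth_box {R : realType} {p : nat} (T : 'rV[R]_p)
    (a a' : R -> R) (b : 'rV[R]_p -> R) :
  (forall s, 0 <= s -> 0 <= a s) -> C1_halfline a a' ->
  (exists M, forall s, 0 <= s -> a' s <= M) -> {within box T, continuous b} ->
  exists2 K, 0 <= K & forall s t, 0 <= s -> box T t -> a s * b t <= K * (1 + s).
Proof.
move=> a0 aC1 [M aM] /within_continuous_box_bounded[C C0 hC].
(* [C] bounds [b] on the compact box, and [a 0 + M * s] is at most this sum times [1 + s]. *)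
have a00 := a0 0 (lexx 0); exists ((a 0 + `|M|) * C).
  by rewrite mulr_ge0 ?addr_ge0// ltW.
move=> s t s0 tT; have as0 := a0 s s0.
have h1 : a s * b t <= a s * C.
  by apply: ler_wpM2l => //; exact: le_trans (ler_norm _) (hC t tT).
apply: (le_trans h1); rewrite mulrAC; apply: ler_wpM2r; first exact: ltW.
apply: (le_trans (linear_growth aC1 aM s0)).
have hM : M * s <= `|M| * s by apply: ler_wpM2r => //; exact: ler_norm.
have := normr_ge0 M; have := mulr_ge0 a00 s0; lra.
Qed.

Theorem corollary2 (R : realType) (p n : nat) (p_gt0 : (0 < p)%N)
    (n_gt0 : (0 < n)%N)
    (T : 'rV[R]_p) (T_gt0 : forall i, 0 < T 0 i)
    (F : 'rV[R]_p -> 'rV[R]_n -> R)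
    (F_meas : forall x, measurable_fun (box T : set (rV_leb R p)) (F ^~ x))
    (F_C1 : forall t, box T t -> C1 (F t))
    (a a' : R -> R) (b : 'rV[R]_p -> R)
    (a_ge0 : forall s, 0 <= s -> 0 <= a s)
    (a_C1 : C1_halfline a a')
    (a'_ub : exists M, forall s, 0 <= s -> a' s <= M)
    (b_ge0 : forall t, box T t -> 0 <= b t)
    (b_cont : {within box T, continuous b})
    (F_bound : forall x t, box T t -> `|F t x| <= a (enorm x) * b t)
    (gradF_bound : forall x t, box T t ->
       enorm (gradient (F t) x) <= a (enorm x) * b t)
    (u : 'rV[R]_p -> 'rV[R]_n) (u_H1 : H1 T u)
    (u_crit : H1_critical T (action T F) u) :
  (exists lap_u : 'rV[R]_p -> 'rV[R]_n,
     is_weak_laplacian T u lap_u /\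
     {ae lebesgue_rV p, forall t, box T t -> lap_u t = gradient (F t) (u t)}) /\
  (forall i : 'I_p,
     same_traces T i u /\
     forall al : 'I_p, same_traces T i (weak_partial T al u)).
Proof.
have [K K0 hK] := linear_growth_box a_ge0 a_C1 a'_ub b_cont.
have FK x t : box T t -> `|F t x| <= K * (1 + enorm x).
  by move=> tT; exact: le_trans (F_bound x t tT) (hK _ _ (enorm_ge0 x) tT).
have gK x t : box T t -> enorm (gradient (F t) x) <= K * (1 + enorm x).
  by move=> tT; exact: le_trans (gradF_bound x t tT) (hK _ _ (enorm_ge0 x) tT).
have Lg : L2 (box T) (fun t => gradient (F t) (u t)).
  exact: (L2_gradient_superposition F_meas F_C1 K0 gK u_H1.1).
have weak v : Cinf_per T v -> _ :=
  critical_weak_laplacian T_gt0 F_meas F_C1 K0 FK gK u_H1 u_crit.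
split.
  (* The superposed gradient itself is the weak Laplacian, so the equation holds everywhere for this
     representative. *)
  exists (fun t => gradient (F t) (u t)); split.
    by split; [exact: vintegrable_L2|exact: weak].
  by apply: aeW.
(* Faces have dimension [p.-1]; writing [p] as a successor lets this compute. *)
case: p p_gt0 T T_gt0 F F_meas F_C1 b b_ge0 b_cont F_bound gradF_bound u u_H1
  u_crit hK FK gK Lg weak => // p _ T T_gt0 F _ _ b _ _ _ _ u u_H1 _ _ _ _ Lg weak.
exact: (weak_laplacian_same_traces T_gt0 u_H1 Lg weak).
Qed.
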